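(* (i) Let $\Sigma$ be any connected surface, $A\subset\Sigma$ a countable dense subset and $x_0\in\mathring\Sigma:=\Sigma\setminus A$. Then the group $\pi_1(\mathring\Sigma,x_0)$ is not Hopfian. (ii) If $X$ is the Sierpiński curve, the Sierpiński gasket, or the Menger curve, and $x_0\in X$, then $\pi_1(X,x_0)$ is not Hopfian.
   Context: A surface is a paracompact 2-manifold without boundary. A group $G$ is Hopfian if every surjective homomorphism $G\to G$ is an isomorphism. The Sierpiński curve is the standard Sierpiński carpet in $[0,1]^2$; the Sierpiński gasket is the standard Sierpiński triangle in $\mathbb R^2$; the Menger curve is the standard Menger sponge in $[0,1]^3$. *)

(* Defs.v *)
From HB Require Import structures.
From mathcomp Require Import all_boot all_order all_algebra.
From mathcomp Require Import generic_quotient ring lra.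
From mathcomp Require Import all_classical all_reals.
From mathcomp Require Import topology normedtype homotopy.

Set Implicit Arguments.
Unset Strict Implicit.
Unset Printing Implicit Defensive.

Import Order.TTheory GRing.Theory Num.Theory.
Import numFieldNormedType.Exports.

Local Open Scope classical_set_scope.
Local Open Scope quotient_scope.
Local Open Scope ring_scope.

Definition unit_interval (R : realType) : Type := set_type `[0 : R, 1].

HB.instance Definition _ (R : realType) :=
  Topological.copy (unit_interval R) (set_type `[0 : R, 1]).

Section unit_interval.
Variable R : realType.
Local Notation I := (unit_interval R).

Definition unit_val (t : I) : R := set_val t.

Lemma unit_val_itv (t : I) : 0 <= unit_val t <= 1.
Proof. by have /set_mem := valP t; rewrite /= in_itv. Qed.

Lemma unit_val_inj : injective unit_val.
Proof. by move=> s t; exact: val_inj. Qed.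

Lemma unit_val_continuous : continuous unit_val.
Proof. exact: initial_continuous. Qed.

Lemma clamp_proof (r : R) : Num.max 0 (Num.min 1 r) \in `[0 : R, 1]%classic.
Proof.
apply/mem_set => /=; rewrite in_itv /= le_max lexx /=.
by rewrite ge_max ler01 ge_min lexx.
Qed.

(* The nearest-point retraction of the line onto the unit interval. *)
Definition clamp (r : R) : I := SigSub (clamp_proof r).

Lemma clampE (r : R) : 0 <= r <= 1 -> unit_val (clamp r) = r.
Proof.
move=> /andP[r0 r1]; rewrite /unit_val set_valE /=.
by rewrite (min_idPr r1) (max_idPr r0).
Qed.

Lemma clamp_le0 (r : R) : r <= 0 -> clamp r = clamp 0.
Proof.
move=> r0; apply: val_inj => /=.
by rewrite !min_r ?max_l ?ler01 ?(le_trans r0) ?ler01.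
Qed.

Lemma clamp_ge1 (r : R) : 1 <= r -> clamp r = clamp 1.
Proof. by move=> r1; apply: val_inj => /=; rewrite !min_l. Qed.

Lemma clampK (t : I) : clamp (unit_val t) = t.
Proof. by apply: unit_val_inj; rewrite clampE // unit_val_itv. Qed.

Lemma clamp_continuous : continuous clamp.
Proof.
apply: (@continuous_comp_initial _ _ R) => x.
rewrite (_ : _ \o _ = (cst 0 : R -> R^o) \max ((cst 1 : R -> R^o) \min id)).
  apply: continuous_max; first exact: cvg_cst.
  by apply: continuous_min; [exact: cvg_cst|exact: cvg_id].
by apply/funext => r.
Qed.

Definition unit_zero : I := clamp 0.
Definition unit_one : I := clamp 1.

Lemma unit_zeroE : unit_val unit_zero = 0.
Proof. by rewrite clampE // lexx ler01. Qed.

Lemma unit_oneE : unit_val unit_one = 1.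
Proof. by rewrite clampE // lexx ler01. Qed.

Fact unit_zero_one_neq : unit_zero != unit_one.
Proof.
apply/eqP => /(congr1 unit_val); rewrite unit_zeroE unit_oneE.
by move/eqP; rewrite eq_sym oner_eq0.
Qed.

HB.instance Definition _ := isBiPointed.Build I unit_zero_one_neq.

Lemma paste_continuous (X Y : topologicalType) (phi : X -> R) (c : R)
    (f g : X -> Y) :
  continuous phi -> continuous f -> continuous g ->
  (forall x, phi x = c -> f x = g x) ->
  continuous (fun x => if phi x <= c then f x else g x).
Proof.
move=> cphi cf cg fg; pose h x := if phi x <= c then f x else g x.
suff: continuous h by [].
pose A := phi @^-1` [set r | r <= c]; pose B := phi @^-1` [set r | r >= c].
have clA : closed A by apply: preimage_closed; [|exact: closed_le].
have clB : closed B by apply: preimage_closed; [|exact: closed_ge].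
apply/continuous_subspace_setT.
have <- : A `|` B = setT.
  by apply/seteqP; split => // x _; case: (leP (phi x) c) => [|/ltW]; [left|right].
apply: withinU_continuous => //.
- apply: (@subspace_eq_continuous _ A _ f); last exact: continuous_subspaceT.
  by move=> x /set_mem xA; rewrite /from_subspace /h ifT.
- apply: (@subspace_eq_continuous _ B _ g); last exact: continuous_subspaceT.
  move=> x /set_mem cx; rewrite /from_subspace /h; case: ifPn => // xc.
  by apply/esym/fg/eqP; rewrite eq_le xc cx.
Qed.

Lemma affine_continuous (X : topologicalType) (f : X -> R) (a b : R) :
  continuous f -> continuous (fun x => a * f x + b).
Proof.
move=> cf x; apply: cvgD; last exact: cvg_cst.
by apply: cvgM; [exact: cvg_cst|exact: cf].
Qed.

Lemma clamp_comp_continuous (X : topologicalType) (f : X -> R) :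
  continuous f -> continuous (fun x => clamp (f x)).
Proof.
by move=> cf x; apply: continuous_comp; [exact: cf|exact: clamp_continuous].
Qed.

Lemma unit_val_comp_continuous (X : topologicalType) (f : X -> I) :
  continuous f -> continuous (fun x => unit_val (f x)).
Proof.
by move=> cf x; apply: continuous_comp; [exact: cf|exact: unit_val_continuous].
Qed.

End unit_interval.

Lemma comp_continuous (X Y Z : topologicalType) (f : X -> Y) (g : Y -> Z) :
  continuous f -> continuous g -> continuous (fun x => g (f x)).
Proof. by move=> cf cg x; apply: continuous_comp; [exact: cf|exact: cg]. Qed.

Lemma pair_continuous (X Y Z : topologicalType) (f : X -> Y) (g : X -> Z) :
  continuous f -> continuous g -> continuous (fun x => (f x, g x)).
Proof. by move=> cf cg x; apply: cvg_pair; [exact: cf|exact: cg]. Qed.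

Lemma fst_continuous (X Y : topologicalType) : continuous (@fst X Y).
Proof. by move=> x; exact: cvg_fst. Qed.

Lemma snd_continuous (X Y : topologicalType) : continuous (@snd X Y).
Proof. by move=> x; exact: cvg_snd. Qed.

Section homotopy.
Variables (R : realType) (T : topologicalType).
Local Notation I := (unit_interval R).

Lemma I_zeroE : unit_val (zero : I) = 0. Proof. exact: unit_zeroE. Qed.
Lemma I_oneE : unit_val (one : I) = 1. Proof. exact: unit_oneE. Qed.

Definition path_homotopic (x y : T) (p q : {path I from x to y in T}) : Prop :=
  exists H : I * I -> T,
    [/\ continuous H,
        forall t, H (zero, t) = p t, forall t, H (one, t) = q t,
        forall s, H (s, zero) = x & forall s, H (s, one) = y].

Section relation.
Variables x y : T.
Implicit Types p q r : {path I from x to y in T}.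

Lemma reparam_homotopic p q (f : I -> T) (phi psi : I -> I) :
  continuous f -> continuous phi -> continuous psi ->
  phi zero = psi zero -> phi one = psi one ->
  p =1 f \o phi -> q =1 f \o psi -> path_homotopic p q.
Proof.
move=> cf cphi cpsi e0 e1 pE qE.
pose g (z : I * I) : R := unit_val (phi z.2) +
  unit_val z.1 * (unit_val (psi z.2) - unit_val (phi z.2)).
have cg : continuous g.
  have c2 (h : I -> I) : continuous h ->
      continuous (fun z : I * I => unit_val (h z.2) : R).
    move=> ch; apply: unit_val_comp_continuous; apply: comp_continuous ch.
    exact: snd_continuous.
  move=> z; apply: cvgD; first exact: c2.
  apply: cvgM; last by apply: cvgB; exact: c2.
  exact/unit_val_comp_continuous/fst_continuous.
exists (fun z => f (clamp (g z))); split.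
- by apply: comp_continuous cf; exact: clamp_comp_continuous.
- by move=> t; rewrite pE /g /= I_zeroE mul0r addr0 clampK.
- by move=> t; rewrite qE /g /= I_oneE mul1r addrC subrK clampK.
- move=> s; rewrite /g /= e0 subrr mulr0 addr0 clampK -[LHS](qE zero).
  exact: path_zero.
- move=> s; rewrite /g /= e1 subrr mulr0 addr0 clampK -[LHS](qE one).
  exact: path_one.
Qed.

Lemma path_homotopic_refl p : path_homotopic p p.
Proof. by apply: (@reparam_homotopic _ _ p id id) => //;
  [exact: cts_fun|by move=> t; exact: cvg_id..]. Qed.

Lemma path_homotopic_sym p q : path_homotopic p q -> path_homotopic q p.
Proof.
move=> [H [cH H0 H1 Hx Hy]].
pose g (z : I * I) := (clamp (-1 * unit_val z.1 + 1), z.2).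
have cg : continuous g.
  apply: pair_continuous; last exact: snd_continuous.
  apply: clamp_comp_continuous; apply: affine_continuous.
  exact/unit_val_comp_continuous/fst_continuous.
exists (H \o g); split => [|t|t|s|s].
- exact: comp_continuous cg cH.
- by rewrite /g /= I_zeroE mulr0 add0r -H1.
- by rewrite /g /= I_oneE mulr1 addNr -H0.
- exact: Hx.
- exact: Hy.
Qed.

Lemma path_homotopic_trans p q r :
  path_homotopic p q -> path_homotopic q r -> path_homotopic p r.
Proof.
move=> [H [cH H0 H1 Hx Hy]] [K [cK K0 K1 Kx Ky]].
pose phi (z : I * I) : R := unit_val z.1.
have cphi : continuous phi.
  exact/unit_val_comp_continuous/fst_continuous.
pose g (b : R) (z : I * I) := (clamp (2 * phi z + b), z.2).
have cg b : continuous (g b).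
  apply: pair_continuous; last exact: snd_continuous.
  by apply: clamp_comp_continuous; exact: affine_continuous.
exists (fun z => if phi z <= 2^-1 then H (g 0 z) else K (g (-1) z)).
split => [|t|t|s|s].
- apply: paste_continuous => //.
  + exact: comp_continuous (cg 0) cH.
  + exact: comp_continuous (cg (-1)) cK.
  move=> z; rewrite /g => ->; rewrite divff ?pnatr_eq0 // addr0 subrr.
  by rewrite [LHS]H1 [RHS]K0.
- by rewrite /g /phi /= I_zeroE invr_ge0 ler0n mulr0 addr0 -H0.
- rewrite /g /phi /= I_oneE ifF; last by apply/negbTE; rewrite -ltNge; lra.
  by rewrite mulr1 -K1; congr (K (clamp _, _)); lra.
- by case: ifP => _; [exact: Hx|exact: Kx].
- by case: ifP => _; [exact: Hy|exact: Ky].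
Qed.

End relation.

Section concatenation.
Variables x y z : T.

Definition path_concat_fun (p q : I -> T) (t : I) : T :=
  if unit_val t <= 2^-1 then p (clamp (2 * unit_val t))
  else q (clamp (2 * unit_val t - 1)).

Variables (p : {path I from x to y in T}) (q : {path I from y to z in T}).

Lemma path_concat_continuous : continuous (path_concat_fun p q).
Proof.
have c b : continuous (fun t : I => clamp (2 * unit_val t + b)).
  apply: clamp_comp_continuous; apply: affine_continuous.
  exact: unit_val_continuous.
apply: paste_continuous; first exact: unit_val_continuous.
- apply: comp_continuous; last exact: cts_fun.
  have -> : (fun t : I => clamp (2 * unit_val t)) =
      (fun t : I => clamp (2 * unit_val t + 0)).
    by apply/funext => u; rewrite addr0.
  exact: c.
- by apply: comp_continuous; [exact: c|exact: cts_fun].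
- move=> t ->; rewrite divff ?pnatr_eq0 // subrr.
  by rewrite [LHS](path_one (s := p)) [RHS](path_zero (s := q)).
Qed.

Lemma path_concat_zero : path_concat_fun p q zero = x.
Proof.
by rewrite /path_concat_fun I_zeroE invr_ge0 ler0n mulr0 [LHS]path_zero.
Qed.

Lemma path_concat_one : path_concat_fun p q one = z.
Proof.
rewrite /path_concat_fun I_oneE ifF; last by apply/negbTE; rewrite -ltNge; lra.
by rewrite (_ : 2 * 1 - 1 = 1); [exact: path_one|lra].
Qed.

(* First p, then q. *)
Definition path_concat : {path I from x to z in T} :=
  mk_path path_concat_continuous path_concat_zero path_concat_one.

End concatenation.

Section reversal.
Variables x y : T.
Variable p : {path I from x to y in T}.

Definition path_rev_fun (t : I) : T := p (clamp (1 - unit_val t)).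

Lemma path_rev_continuous : continuous path_rev_fun.
Proof.
apply: comp_continuous; last exact: cts_fun.
apply: clamp_comp_continuous.
have -> : (fun t : I => 1 - unit_val t) = (fun t : I => -1 * unit_val t + 1).
  by apply/funext => t; rewrite mulN1r addrC.
by apply: affine_continuous; exact: unit_val_continuous.
Qed.

Lemma path_rev_zero : path_rev_fun zero = y.
Proof. by rewrite /path_rev_fun I_zeroE subr0 [LHS]path_one. Qed.

Lemma path_rev_one : path_rev_fun one = x.
Proof. by rewrite /path_rev_fun I_oneE subrr [LHS]path_zero. Qed.

Definition path_rev : {path I from y to x in T} :=
  mk_path path_rev_continuous path_rev_zero path_rev_one.

End reversal.

Lemma path_revK (x y : T) (p : {path I from x to y in T}) :
  path_rev (path_rev p) = p.
Proof.
apply/path_eqP => t; rewrite /= /mk_path /path_rev_fun /= /mk_path /path_rev_fun.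
have := unit_val_itv t => /andP[t0 t1]; rewrite clampE; last by lra.
by rewrite subKr clampK.
Qed.

Definition path_cst (x : T) : {path I from x to x in T} :=
  mk_path (@cst_continuous I T x) erefl erefl.

Lemma path_concat_homotopic (x y z : T) (p p' : {path I from x to y in T})
    (q q' : {path I from y to z in T}) :
  path_homotopic p p' -> path_homotopic q q' ->
  path_homotopic (path_concat p q) (path_concat p' q').
Proof.
move=> [H [cH H0 H1 Hx Hy]] [K [cK K0 K1 Kx Ky]].
pose phi (z : I * I) : R := unit_val z.2.
have cphi : continuous phi.
  exact/unit_val_comp_continuous/snd_continuous.
pose g (b : R) (z : I * I) := (z.1, clamp (2 * phi z + b)).
have cg b : continuous (g b).
  apply: pair_continuous; first exact: fst_continuous.
  by apply: clamp_comp_continuous; exact: affine_continuous.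
exists (fun z => if phi z <= 2^-1 then H (g 0 z) else K (g (-1) z)).
split => [|t|t|s|s].
- apply: paste_continuous => //.
  + exact: comp_continuous (cg 0) cH.
  + exact: comp_continuous (cg (-1)) cK.
  move=> w; rewrite /g => ->; rewrite divff ?pnatr_eq0 // addr0 subrr.
  by rewrite [LHS]Hy [RHS]Kx.
- by rewrite /= /mk_path /path_concat_fun /g /phi /= addr0 H0 K0.
- by rewrite /= /mk_path /path_concat_fun /g /phi /= addr0 H1 K1.
- by rewrite /g /phi /= I_zeroE invr_ge0 ler0n mulr0 addr0 -[RHS](Hx s).
- rewrite /g /phi /= I_oneE ifF; last by apply/negbTE; rewrite -ltNge; lra.
  by rewrite -[RHS](Ky s); congr (K (_, clamp _)); lra.
Qed.

Lemma path_rev_homotopic (x y : T) (p q : {path I from x to y in T}) :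
  path_homotopic p q -> path_homotopic (path_rev p) (path_rev q).
Proof.
move=> [H [cH H0 H1 Hx Hy]].
exists (fun z => H (z.1, clamp (-1 * unit_val z.2 + 1))); split => [|t|t|s|s].
- apply: comp_continuous cH; apply: pair_continuous; first exact: fst_continuous.
  apply: clamp_comp_continuous; apply: affine_continuous.
  exact/unit_val_comp_continuous/snd_continuous.
- by rewrite /= /mk_path /path_rev_fun H0 mulN1r addrC.
- by rewrite /= /mk_path /path_rev_fun H1 mulN1r addrC.
- by rewrite /= I_zeroE mulr0 add0r -[RHS](Hy s).
- by rewrite /= I_oneE mulr1 addNr -[RHS](Hx s).
Qed.

Let aff_continuous (a b : R) : continuous (fun t : I => a * unit_val t + b).
Proof. by apply: affine_continuous; exact: unit_val_continuous. Qed.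

Lemma path_concatA (x y z w : T) (p : {path I from x to y in T})
    (q : {path I from y to z in T}) (r : {path I from z to w in T}) :
  path_homotopic (path_concat p (path_concat q r))
                 (path_concat (path_concat p q) r).
Proof.
pose f (t : I) : R := if unit_val t <= 4^-1 then 2 * unit_val t + 0 else
  if unit_val t <= 2^-1 then 1 * unit_val t + 4^-1
  else 2^-1 * unit_val t + 2^-1.
have cf : continuous f.
  apply: paste_continuous; [exact: unit_val_continuous|exact: aff_continuous| |].
    apply: paste_continuous; [exact: unit_val_continuous|
      exact: aff_continuous|exact: aff_continuous|].
    by move=> t ->; lra.
  by move=> t ->; rewrite ifT; lra.
apply: (@reparam_homotopic _ _ _ _ (path_concat p (path_concat q r)) id
  (fun t => clamp (f t))) => //.
- exact: cts_fun.
- by move=> t; exact: cvg_id.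
- exact: clamp_comp_continuous.
- by rewrite /f I_zeroE ifT ?invr_ge0 ?ler0n // mulr0 addr0.
- rewrite /f I_oneE !ifF; [|by apply/negbTE; rewrite -ltNge; lra..].
  by rewrite (_ : _ + _ = 1) //; lra.
move=> t; rewrite /= /mk_path /path_concat_fun /= /mk_path /path_concat_fun /f.
have /andP[t0 t1] := unit_val_itv t; set u := unit_val t in t0 t1 *.
case: (leP u 4^-1) => u4.
  rewrite (_ : u <= 2^-1) /=; last by lra.
  rewrite (@clampE _ (2 * u)) ?(@clampE _ (2 * u + 0)); [|lra..].
  rewrite (_ : 2 * u <= 2^-1); last by lra.
  rewrite (_ : 2 * u + 0 <= 2^-1); last by lra.
  by congr (p (clamp _)); lra.
case: (leP u 2^-1) => u2.
  rewrite (@clampE _ (2 * u)) ?(@clampE _ (1 * u + 4^-1)); [|lra..].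
  rewrite (lt_geF (_ : 2^-1 < 2 * u)); last by lra.
  rewrite (lt_geF (_ : 2^-1 < 1 * u + 4^-1)); last by lra.
  rewrite (@clampE _ (2 * (1 * u + 4^-1) - 1)); last by lra.
  rewrite (_ : 2 * (1 * u + 4^-1) - 1 <= 2^-1); last by lra.
  by congr (q (clamp _)); lra.
rewrite (@clampE _ (2^-1 * u + 2^-1)); last by lra.
rewrite (lt_geF (_ : 2^-1 < 2^-1 * u + 2^-1)); last by lra.
rewrite (@clampE _ (2 * (2^-1 * u + 2^-1) - 1)); last by lra.
rewrite (lt_geF (_ : 2^-1 < 2 * (2^-1 * u + 2^-1) - 1)); last by lra.
by congr (r (clamp _)); lra.
Qed.

Lemma path_concat1p (x y : T) (p : {path I from x to y in T}) :
  path_homotopic (path_concat (path_cst x) p) p.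
Proof.
apply: (@reparam_homotopic _ _ _ _ p (fun t => clamp (2 * unit_val t + (-1))) id)
    => //.
- exact: cts_fun.
- by apply: clamp_comp_continuous; exact: aff_continuous.
- by move=> t; exact: cvg_id.
- by rewrite I_zeroE clamp_le0 //; lra.
- by rewrite I_oneE (_ : _ + _ = 1) //; lra.
move=> t; rewrite /= /mk_path /path_concat_fun; case: ifPn => // t2.
rewrite /= /mk_path /cst -[LHS](@path_zero _ _ _ _ p); congr (p _).
by rewrite clamp_le0 //; lra.
Qed.

Lemma path_concatp1 (x y : T) (p : {path I from x to y in T}) :
  path_homotopic (path_concat p (path_cst y)) p.
Proof.
apply: (@reparam_homotopic _ _ _ _ p (fun t => clamp (2 * unit_val t + 0)) id)
    => //.
- exact: cts_fun.
- by apply: clamp_comp_continuous; exact: aff_continuous.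
- by move=> t; exact: cvg_id.
- by rewrite I_zeroE mulr0 addr0.
- by rewrite I_oneE clamp_ge1 //; lra.
move=> t; rewrite /= /mk_path /path_concat_fun addr0; case: (leP _ _) => // t2.
rewrite /= /mk_path /cst -[LHS](@path_one _ _ _ _ p); congr (p _).
by rewrite clamp_ge1 //; lra.
Qed.

Lemma path_concatpV (x y : T) (p : {path I from x to y in T}) :
  path_homotopic (path_concat p (path_rev p)) (path_cst x).
Proof.
pose f (t : I) : R :=
  if unit_val t <= 2^-1 then 2 * unit_val t + 0 else -2 * unit_val t + 2.
have cf : continuous f.
  apply: paste_continuous; [exact: unit_val_continuous|
    exact: aff_continuous|exact: aff_continuous|].
  by move=> t ->; lra.
apply: (@reparam_homotopic _ _ _ _ p (fun t => clamp (f t)) (fun=> zero)).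
- exact: cts_fun.
- exact: clamp_comp_continuous.
- exact: cst_continuous.
- by rewrite /f I_zeroE invr_ge0 ler0n mulr0 addr0.
- rewrite /f I_oneE ifF; last by apply/negbTE; rewrite -ltNge; lra.
  by rewrite (_ : _ + _ = 0) //; lra.
- move=> t; rewrite /= /mk_path /path_concat_fun /f.
  have /andP[t0 t1] := unit_val_itv t; case: (leP _ _) => t2.
    by rewrite addr0.
  rewrite /= /mk_path /path_rev_fun clampE; last by lra.
  by congr (p (clamp _)); lra.
- by move=> t; rewrite /= path_zero.
Qed.

Lemma path_concatVp (x y : T) (p : {path I from x to y in T}) :
  path_homotopic (path_concat (path_rev p) p) (path_cst y).
Proof. by have := path_concatpV (path_rev p); rewrite path_revK. Qed.

End homotopy.

Section fundamental_group.
Variables (R : realType) (T : topologicalType) (x0 : T).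
Local Notation loop := {path (unit_interval R) from x0 to x0 in T}.

Definition loop_homotopic : rel loop := fun p q => `[< path_homotopic p q >].

Lemma loop_homotopic_refl : reflexive loop_homotopic.
Proof. by move=> p; apply/asboolP; exact: path_homotopic_refl. Qed.

Lemma loop_homotopic_sym : symmetric loop_homotopic.
Proof.
by move=> p q; apply/asboolP/asboolP; exact: path_homotopic_sym.
Qed.

Lemma loop_homotopic_trans : transitive loop_homotopic.
Proof.
move=> q p r /asboolP pq /asboolP qr; apply/asboolP.
exact: path_homotopic_trans pq qr.
Qed.

Canonical loop_homotopic_equiv :=
  EquivRel loop_homotopic
    loop_homotopic_refl loop_homotopic_sym loop_homotopic_trans.

Definition fundamental_group : Type := {eq_quot loop_homotopic_equiv}.

HB.instance Definition _ := Choice.on fundamental_group.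
HB.instance Definition _ := Quotient.copy fundamental_group
  {eq_quot loop_homotopic_equiv}.

Definition loop_class (p : loop) : fundamental_group := \pi_fundamental_group p.

Lemma loop_classP (p q : loop) :
  loop_class p = loop_class q <-> path_homotopic p q.
Proof.
split=> [/eqmodP/asboolP//|pq].
by apply/eqmodP/asboolP.
Qed.

Lemma loop_class_repr (a : fundamental_group) : loop_class (repr a) = a.
Proof. exact: reprK. Qed.

Definition pi1_mul (a b : fundamental_group) : fundamental_group :=
  loop_class (path_concat (repr a) (repr b)).
Definition pi1_one : fundamental_group := loop_class (path_cst R x0).
Definition pi1_inv (a : fundamental_group) : fundamental_group :=
  loop_class (path_rev (repr a)).

Lemma pi1_mulE (p q : loop) :
  pi1_mul (loop_class p) (loop_class q) = loop_class (path_concat p q).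
Proof.
by apply/loop_classP/path_concat_homotopic; apply/loop_classP;
  rewrite loop_class_repr.
Qed.

Lemma pi1_invE (p : loop) :
  pi1_inv (loop_class p) = loop_class (path_rev p).
Proof.
by apply/loop_classP/path_rev_homotopic/loop_classP; rewrite loop_class_repr.
Qed.

Lemma pi1_mulA : associative pi1_mul.
Proof.
move=> a b c; rewrite -(loop_class_repr a) -(loop_class_repr b).
rewrite -(loop_class_repr c) !pi1_mulE; apply/loop_classP; exact: path_concatA.
Qed.

Lemma pi1_mul1 : left_id pi1_one pi1_mul.
Proof.
move=> a; rewrite -(loop_class_repr a) pi1_mulE; apply/loop_classP.
exact: path_concat1p.
Qed.

Lemma pi1_mulr1 : right_id pi1_one pi1_mul.
Proof.
move=> a; rewrite -(loop_class_repr a) pi1_mulE; apply/loop_classP.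
exact: path_concatp1.
Qed.

Lemma pi1_mulV : left_inverse pi1_one pi1_inv pi1_mul.
Proof.
move=> a; rewrite -(loop_class_repr a) pi1_invE pi1_mulE; apply/loop_classP.
exact: path_concatVp.
Qed.

Lemma pi1_mulrV : right_inverse pi1_one pi1_inv pi1_mul.
Proof.
move=> a; rewrite -(loop_class_repr a) pi1_invE pi1_mulE; apply/loop_classP.
exact: path_concatpV.
Qed.

HB.instance Definition _ := isGroup.Build fundamental_group
  pi1_mulA pi1_mul1 pi1_mulr1 pi1_mulV pi1_mulrV.

End fundamental_group.

Definition hopfian (G : groupType) : Prop :=
  forall f : {multiplicative G -> G}, set_surj setT setT f -> bijective f.

Definition homeomorphic (X Y : topologicalType) : Prop :=
  exists (f : X -> Y) (g : Y -> X),
    [/\ continuous f, continuous g, cancel f g & cancel g f].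

Definition locally_finite_family (X : topologicalType) (C : set (set X)) :=
  forall x : X, exists2 N, nbhs x N & finite_set [set U | C U /\ U `&` N !=set0].

Definition paracompact_space (X : topologicalType) : Prop :=
  forall C : set (set X), C `<=` open -> cover C id = setT ->
  exists D : set (set X),
    [/\ D `<=` open, cover D id = setT,
        forall V, D V -> exists2 U, C U & V `<=` U
      & locally_finite_family D].

Definition locally_planar (R : realType) (X : topologicalType) : Prop :=
  forall x : X, exists (U : set X) (V : set (R * R)),
    [/\ open U, U x, open V & homeomorphic (set_type U) (set_type V)].

Definition surface (R : realType) (X : topologicalType) : Prop :=
  [/\ hausdorff_space X, paracompact_space X & locally_planar R X].

Section iterated_function_systems.
Variables (J E : Type) (D : set J) (phi : J -> E -> E).

Definition hutchinson (S : set E) : set E := \bigcup_(j in D) (phi j @` S).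

Definition ifs_limit (K : set E) : set E := \bigcap_n iter n hutchinson K.

End iterated_function_systems.

Section fractals.
Variable R : realType.

(* The contraction of [0, 1] onto its d-th third; the carpet and the sponge
   keep the cells having at most one middle coordinate. *)
Definition third (r : R) (d : 'I_3) : R := (r + d%:R) / 3.

Definition sierpinski_carpet : set (R * R) :=
  ifs_limit
    [set d : 'I_3 * 'I_3 | ((d.1 == 1 :> nat) + (d.2 == 1 :> nat) < 2)%N]
    (fun d p => (third p.1 d.1, third p.2 d.2))
    (`[0, 1] `*` `[0, 1]).

Definition menger_sponge : set (R * R * R) :=
  ifs_limit
    [set d : 'I_3 * 'I_3 * 'I_3 |
      ((d.1.1 == 1 :> nat) + (d.1.2 == 1 :> nat) + (d.2 == 1 :> nat) < 2)%N]
    (fun d p => (third p.1.1 d.1.1, third p.1.2 d.1.2, third p.2 d.2))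
    (`[0, 1] `*` `[0, 1] `*` `[0, 1]).

(* The vertices of an equilateral triangle of side 1; gasket_triangle is their
   convex hull. *)
Definition gasket_vertex (j : 'I_3) : R * R :=
  nth (0, 0) [:: (0, 0); (1, 0); (2^-1, Num.sqrt 3 / 2)] j.

Definition gasket_triangle : set (R * R) :=
  [set p | exists a : 'I_3 -> R,
    [/\ forall j, 0 <= a j, \sum_j a j = 1,
        p.1 = \sum_j a j * (gasket_vertex j).1
      & p.2 = \sum_j a j * (gasket_vertex j).2]].

Definition sierpinski_gasket : set (R * R) :=
  ifs_limit setT
    (fun j p => ((p.1 + (gasket_vertex j).1) / 2,
                 (p.2 + (gasket_vertex j).2) / 2))
    gasket_triangle.

End fractals.

Arguments third {R}.
Arguments sierpinski_carpet : clear implicits.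
Arguments menger_sponge : clear implicits.
Arguments gasket_triangle : clear implicits.
Arguments sierpinski_gasket : clear implicits.

(* Main.v *)
(* A space X with an endomap f that induces a surjection, but not an injection,
   on fundamental groups is a counterexample to the Hopf property as soon as it
   is path connected.

   For the three fractals, f folds X onto one of its corner copies and blows the
   copy up again.  Two adjacent copies give two sections s, s' of f, and for a
   loop c around a hole the loop s(c) s'(c)^-1 is killed by f.  It is essential
   because it runs exactly once through a slit joining two holes of X, which
   s'(c) avoids.

   For a surface with a countable dense set A removed, work in a chart and take a
   disc E, a smaller disc D inside E, and a point a of A in the annulus between
   them.  The map f is the identity outside E; on D it is a homeomorphism h of
   the plane which preserves A and expands D beyond E (it exists because the
   plane is countable dense homogeneous: the homeomorphism is an infinite
   composition of small shears built back and forth); the annulus punctured at a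
   is first retracted to its boundary circles and one segment joining them.  Each
   loop is a product of pieces outside E, fixed by f, and pieces in h(D), which
   lift by h^-1; so f is surjective on fundamental groups.  A small loop in the
   annulus around a point of A other than a is essential, and is killed by f,
   which extends over that point. *)

Require Import Defs.
From HB Require Import structures.
From mathcomp Require Import all_boot all_order all_algebra.
From mathcomp Require Import ring lra.
From mathcomp Require Import all_classical all_reals interval_inference.
From mathcomp Require Import topology normedtype homotopy sequences lebesgue_measure.
From Stdlib Require Setoid Morphisms.

Set Implicit Arguments.
Unset Strict Implicit.
Unset Printing Implicit Defensive.

Import Order.TTheory GRing.Theory Num.Theory.
Import numFieldNormedType.Exports.

Local Open Scope classical_set_scope.
Local Open Scope ring_scope.

(** * Path classes and fundamental groups *)

(** Essential loops are detected without covering spaces or degree theory. Let three closed sets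
    cover a space and have no common point. Labelling points by a set that contains them maps the
    space, coarsely, to the boundary of a triangle, and a loop that runs once through the three sets
    in cyclic order winds once around it. On a fine grid over a homotopy this becomes a finite count
    modulo 3. The two sides of a slit and the rest of the space are such sets, except that they meet
    at the ends of the slit: this is why the ends have to be holes.

    For surfaces the obstacle is surjectivity, because [f] has no global section to compose with.
    Partial lifts through the identity outside and through the inverse of [h] inside end at
    different points whenever the loop passes from one region to the other. These end points are
    joined by a path whose image under [f] is null-homotopic; it crosses the annulus along the
    segment, and this requirement dictates the values of [f] there.

    Discs and annuli are taken in the l1 norm, so that polar coordinates are rational expressions in
    coordinates and absolute values. *)

Notation pathI R x y := {path (unit_interval R) from x to y in _}.
Local Notation "p ~~ q" := (path_homotopic p q) (at level 70).
Local Notation "p ** q" := (path_concat p q) (at level 40, left associativity).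

#[export] Hint Resolve path_homotopic_refl : core.

#[export] Instance path_homotopic_equivalence (R : realType)
    (T : topologicalType) (x y : T) : RelationClasses.Equivalence (@path_homotopic R T x y).
Proof.
apply: RelationClasses.Build_Equivalence.
- by move=> p; exact: path_homotopic_refl.
- by move=> p q; exact: path_homotopic_sym.
- by move=> p q r; exact: path_homotopic_trans.
Qed.

#[export] Instance path_concat_proper (R : realType) (T : topologicalType)
    (x y z : T) : Morphisms.Proper
      (Morphisms.respectful (@path_homotopic R T x y)
         (Morphisms.respectful (@path_homotopic R T y z)
            (@path_homotopic R T x z))) (@path_concat R T x y z).
Proof. move=> p p' pp q q' qq. exact: (path_concat_homotopic pp qq). Qed.

#[export] Instance path_rev_proper (R : realType) (T : topologicalType)
    (x y : T) : Morphisms.Proper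
      (Morphisms.respectful (@path_homotopic R T x y) (@path_homotopic R T y x))
      (@path_rev R T x y).
Proof. by move=> p p' pp; exact: (path_rev_homotopic pp). Qed.

Section path_groupoid.
Variables (R : realType) (T : topologicalType).
Implicit Types x y z w : T.

Lemma path_concatA' x y z w (p : pathI R x y) (q : pathI R y z)
  (r : pathI R z w) : p ** q ** r ~~ p ** (q ** r).
Proof. exact/path_homotopic_sym/path_concatA. Qed.

Lemma path_concatKp x y z (p : pathI R x y) (q : pathI R y z) :
  path_rev p ** (p ** q) ~~ q.
Proof. by rewrite path_concatA path_concatVp path_concat1p. Qed.

Lemma path_concatVKp x y z (p : pathI R y x) (q : pathI R y z) :
  p ** (path_rev p ** q) ~~ q.
Proof. by rewrite path_concatA path_concatpV path_concat1p. Qed.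

Lemma path_rev_concat x y z (p : pathI R x y) (q : pathI R y z) :
  path_rev (p ** q) ~~ path_rev q ** path_rev p.
Proof.
rewrite -[X in _ ~~ X](path_concatKp (p ** q)) (path_concatA' p).
by rewrite path_concatVKp path_concatpV path_concatp1.
Qed.

End path_groupoid.

Ltac path_simp := rewrite ?path_rev_concat ?path_revK;
  repeat first [rewrite path_concatA' | rewrite path_concatKp
    | rewrite path_concatVKp | rewrite path_concatpV | rewrite path_concatVp
    | rewrite path_concat1p | rewrite path_concatp1].

(** * Images of paths under a continuous map *)

Section path_image.
Variables (R : realType) (X Y : topologicalType) (f : X -> Y).
Hypothesis cf : continuous f.

Section ends.
Variables (x y : X) (x' y' : Y) (p : pathI R x y).
Hypotheses (ex : f x = x') (ey : f y = y').

Fact path_map_zero : f (p zero) = x'. Proof. by rewrite path_zero. Qed.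
Fact path_map_one : f (p one) = y'. Proof. by rewrite path_one. Qed.

Definition path_map : pathI R x' y' :=
  mk_path (comp_continuous (@cts_fun _ _ p) cf) path_map_zero path_map_one.

Lemma path_mapE t : path_map t = f (p t). Proof. by []. Qed.

End ends.

Lemma path_map_homotopic x y x' y' (p q : pathI R x y) (ex : f x = x')
  (ey : f y = y') : p ~~ q -> path_map p ex ey ~~ path_map q ex ey.
Proof.
move=> [H [cH H0 H1 Hx Hy]]; exists (f \o H); split => [|t|t|s|s].
- exact: comp_continuous cH cf.
- by rewrite /= H0.
- by rewrite /= H1.
- by rewrite /= Hx.
- by rewrite /= Hy.
Qed.

Lemma path_map_concat x y z x' y' z' (p : pathI R x y) (q : pathI R y z)
    (ex : f x = x') (ey : f y = y') (ez : f z = z') :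
  path_map (p ** q) ex ez = path_map p ex ey ** path_map q ey ez.
Proof.
apply/path_eqP => t; rewrite path_mapE /= /mk_path /path_concat_fun.
by case: ifP.
Qed.

Lemma path_map_rev x y x' y' (p : pathI R x y) (ex : f x = x')
  (ey : f y = y') : path_map (path_rev p) ey ex = path_rev (path_map p ex ey).
Proof. exact/path_eqP. Qed.

Lemma path_map_cst x x' (ex : f x = x') :
  path_map (path_cst R x) ex ex = path_cst R x'.
Proof. exact/path_eqP. Qed.

End path_image.

(** * A criterion for the failure of the Hopf property *)

Section not_hopfian.
Variables (R : realType) (X : topologicalType) (f : X -> X).
Hypothesis cf : continuous f.
Hypothesis connX : forall x y : X, inhabited (pathI R x y).

(** Since [f] need not fix any point, surjectivity and the killed loop come with their own base
    points, and path connectedness carries everything to [x0]. The endomorphism of the group is the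
    map induced by [f] followed by conjugation with a path [be] from [x0] to [f x0]. *)
Lemma not_hopfian_endo (y0 y1 : X) (e : f y0 = y1) (b : X) (l : pathI R b b)
    (x0 : X) :
  (forall q : pathI R y1 y1, exists p : pathI R y0 y0,
     path_map cf p e e ~~ q) ->
  path_map cf l erefl erefl ~~ path_cst R (f b) ->
  ~ (l ~~ path_cst R b) ->
  ~ hopfian (fundamental_group R x0).
Proof.
case: _ / e => surj ker nl hop.
have [al] := connX y0 x0; have [be] := connX x0 (f x0).
have [ga] := connX x0 b.
pose act (p : pathI R x0 x0) : pathI R x0 x0 :=
  be ** path_map cf p erefl erefl ** path_rev be.
pose phi (a : fundamental_group R x0) : fundamental_group R x0 :=
  loop_class (act (repr a)).
have phiE p : phi (loop_class p) = loop_class (act p).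
  apply/loop_classP; rewrite /act; apply: path_concat_homotopic => //.
  apply: path_concat_homotopic => //; apply: path_map_homotopic.
  by apply/loop_classP; rewrite loop_class_repr.
have phiM : {morph phi : a b / (a * b)%g}.
  move=> u v; rewrite -(loop_class_repr u) -(loop_class_repr v).
  rewrite [(loop_class _ * loop_class _)%g]pi1_mulE !phiE.
  rewrite [RHS]pi1_mulE; apply/loop_classP; rewrite /act.
  rewrite (@path_map_concat _ _ _ _ cf _ _ _ _ _ _ _ _ _ erefl).
  by path_simp.
pose F : {multiplicative fundamental_group R x0 -> fundamental_group R x0} :=
  HB.pack phi (isMultiplicative.Build _ _ phi phiM).
have surjF : set_surj setT setT F.
  move=> u _; rewrite -(loop_class_repr u); set q := repr u.
  pose fal := path_map cf al erefl erefl.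
  (* The target [q] is moved to a loop at [f y0] and lifted there; the lift is then carried back to
     [x0] along [al]. *)
  have [p pE] := surj (fal ** (path_rev be ** q ** be) ** path_rev fal).
  exists (loop_class (path_rev al ** p ** al)) => //.
  rewrite [LHS]phiE; apply/loop_classP; rewrite /act.
  rewrite !(@path_map_concat _ _ _ _ cf _ _ _ _ _ _ _ _ _ erefl).
  by rewrite (path_map_rev cf) pE -/fal; path_simp.
have [G GK _] := hop F surjF.
have one_ker : phi (loop_class (ga ** l ** path_rev ga)) =
    phi (loop_class (path_cst R x0)).
  rewrite !phiE; apply/loop_classP; rewrite /act.
  rewrite !(@path_map_concat _ _ _ _ cf _ _ _ _ _ _ _ _ _ erefl).
  by rewrite ker (path_map_rev cf) path_map_cst; path_simp.
have := can_inj GK one_ker => /loop_classP gl; apply: nl.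
have : path_rev ga ** (ga ** l ** path_rev ga) ** ga ~~ path_rev ga ** ga.
  by rewrite gl path_concatp1.
by path_simp.
Qed.

End not_hopfian.

(** * Winding through a slit *)

Section grid.

(** The representative of [b - a] modulo 3 among -1, 0, 1: a signed step along the boundary of a
    triangle. *)
Definition cyc_diff (a b : nat) : int :=
  if b == (a.+1 %% 3)%N then 1 else if a == b then 0 else -1.

(** A missing label cuts the triangle boundary open into a segment, on which [cyc_diff] is an honest
    difference of positions; so both ways around the cell give the same sum. *)
Lemma cyc_diff_cell a b c e k : (a < 3)%N -> (b < 3)%N -> (c < 3)%N ->
  (e < 3)%N -> (k < 3)%N -> k \notin [:: a; b; c; e] ->
  cyc_diff a b + cyc_diff b e = cyc_diff a c + cyc_diff c e.
Proof.
by case: a => [|[|[|//]]]; case: b => [|[|[|//]]]; case: c => [|[|[|//]]];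
  case: e => [|[|[|//]]]; case: k => [|[|[|//]]].
Qed.

(** Discrete homotopy invariance of the winding number: a row is traded for the next one cell by
    cell, and the constant labels on the two sides make the corrections at the ends vanish. *)
Lemma cyc_diff_grid (N : nat) (lab : nat -> nat -> nat) :
  (forall j i, (j <= N)%N -> (i <= N)%N -> (lab j i < 3)%N) ->
  (forall j i, (j < N)%N -> (i < N)%N -> exists2 k, (k < 3)%N &
    k \notin [:: lab j i; lab j i.+1; lab j.+1 i; lab j.+1 i.+1]) ->
  (forall j, (j <= N)%N -> lab j 0%N = 0%N /\ lab j N = 0%N) ->
  \sum_(i < N) cyc_diff (lab 0%N i) (lab 0%N i.+1) =
  \sum_(i < N) cyc_diff (lab N i) (lab N i.+1).
Proof.
move=> lab3 cell side.
suff row j : (j <= N)%N ->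
    \sum_(i < N) cyc_diff (lab 0%N i) (lab 0%N i.+1) =
    \sum_(i < N) cyc_diff (lab j i) (lab j i.+1) by exact: row.
elim: j => [//|j IH jN]; rewrite (IH (ltnW jN)).
(* Going [n] steps along row [j] and then across equals going across first and then along row
   [j.+1]. *)
have part n : (n <= N)%N ->
    \sum_(i < n) cyc_diff (lab j i) (lab j i.+1) +
      cyc_diff (lab j n) (lab j.+1 n) =
    cyc_diff (lab j 0%N) (lab j.+1 0%N) +
      \sum_(i < n) cyc_diff (lab j.+1 i) (lab j.+1 i.+1).
  elim: n => [|n IHn nN]; first by rewrite !big_ord0 addrC.
  rewrite !big_ord_recr /= [RHS]addrA -IHn ?(ltnW nN)//.
  have [k k3 kn] := cell j n jN nN.
  rewrite -!addrA; congr (_ + _).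
  by apply: (cyc_diff_cell _ _ _ _ k3 kn); apply: lab3 => //; exact: ltnW.
have := part N (leqnn N); have [-> ->] := side j (ltnW jN).
by have [-> ->] := side j.+1 jN; rewrite addr0 add0r.
Qed.

End grid.

Section winding.
Variables (R : realType) (Y : topologicalType).
Local Notation I := (unit_interval R).

(** A Lebesgue number argument: near each point [G] avoids one of the three closed sets, and
    compactness of the square, used in near-covering form, makes the size of the neighbourhood
    uniform. *)
Lemma small_cells (G : R * R -> Y) (C : nat -> set Y) : continuous G ->
  (forall i, closed (C i)) -> (forall y, C 0%N y -> C 1%N y -> ~ C 2%N y) ->
  \forall n \near \oo, forall z : R * R, 0 <= z.1 <= 1 -> 0 <= z.2 <= 1 ->
    exists2 k, (k < 3)%N & forall z' : R * R, `|z'.1 - z.1| <= n.+1%:R^-1 ->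
      `|z'.2 - z.2| <= n.+1%:R^-1 -> ~ C k (G z').
Proof.
move=> cG clC C3.
have cK : compact (`[0 : R, 1] `*` `[0 : R, 1]).
  by apply: compact_setX; exact: segment_compact.
pose P (n : nat) (z : R * R) := exists2 k, (k < 3)%N &
  forall z' : R * R, `|z'.1 - z.1| <= n.+1%:R^-1 ->
      `|z'.2 - z.2| <= n.+1%:R^-1 -> ~ C k (G z').
have /(_ nat \oo P _) cov : near_covering (`[0 : R, 1] `*` `[0 : R, 1]).
  exact/compact_near_coveringP.
have : \forall n \near \oo, `[0 : R, 1] `*` `[0 : R, 1] `<=` P n.
  apply: cov => z _.
  have [k k3 Ck] : exists2 k, (k < 3)%N & ~ C k (G z).
    have [C0|] := pselect (C 0%N (G z)); last by exists 0%N.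
    have [C1|] := pselect (C 1%N (G z)); last by exists 1%N.
    by exists 2%N => //; exact: C3.
  have : nbhs z (G @^-1` (~` C k)).
    apply: cG; apply: open_nbhs_nbhs; split => //.
    by rewrite openC.
  move=> /nbhs_ballP[e /= e0 ze].
  exists (ball z (e / 2), [set n | n.+1%:R^-1 < e / 2]).
    split; first by apply: nbhsx_ballx; rewrite divr_gt0.
    by have e2 : 0 < e / 2 by [rewrite divr_gt0]; exact: near_infty_natSinv_lt (PosNum e2).
  move=> [z1 n] [/= [z11 z12] ne]; exists k => // z' z'1 z'2.
  apply: ze; split; rewrite /ball /= in z11 z12 *.
    rewrite -(subrKA z1.1); apply: (le_lt_trans (ler_normD _ _)).
    by rewrite (splitr e) ltrD// distrC (le_lt_trans z'1).
  rewrite -(subrKA z1.2); apply: (le_lt_trans (ler_normD _ _)).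
  by rewrite (splitr e) ltrD// distrC (le_lt_trans z'2).
apply: filterS => n KP z z1 z2; apply: KP.
by split; rewrite /= in_itv.
Qed.

(** The three sets play the role of an angle function. Along the row of [g] the labels advance as 0,
    1, 2, 0 and their cyclic differences add up to 3, while the row of the constant loop gives 0. *)
Lemma winding_not_null (C0 C1 C2 : set Y) (x : Y) (g : pathI R x x)
    (t1 t2 t3 : R) :
  closed C0 -> closed C1 -> closed C2 ->
  (forall y, [\/ C0 y, C1 y | C2 y]) -> (forall y, C0 y -> C1 y -> ~ C2 y) ->
  0 < t1 -> t1 < t2 -> t2 < t3 -> t3 < 1 ->
  (forall t : I, unit_val t <= t1 -> C0 (g t)) ->
  (forall t : I, t1 <= unit_val t <= t2 -> C1 (g t)) ->
  (forall t : I, t2 <= unit_val t <= t3 -> C2 (g t)) ->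
  (forall t : I, t3 <= unit_val t -> C0 (g t)) ->
  ~ path_homotopic g (path_cst R x).
Proof.
move=> cl0 cl1 cl2 cov C012 t10 t12 t23 t31 g0 g1 g2 g3.
move=> [H [cH H0 H1 Hx Hy]].
pose C (i : nat) := nth C0 [:: C0; C1; C2] i.
pose G (z : R * R) := H (clamp z.1, clamp z.2).
have cG : continuous G.
  apply: comp_continuous cH; apply: pair_continuous;
    apply: clamp_comp_continuous; [exact: fst_continuous|exact: snd_continuous].
have clC i : closed (C i).
  by case: i => [|[|[|i]]] //; rewrite /C /= nth_nil.
have C012' y : C 0%N y -> C 1%N y -> ~ C 2%N y by exact: C012.
have := small_cells cG clC C012'.
have ntis (e : R) : 0 < e -> \forall n \near \oo, n.+1%:R^-1 < e.
  by move=> e0; exact: near_infty_natSinv_lt (PosNum e0).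
have e12 : 0 < t2 - t1 by rewrite subr_gt0.
have e23 : 0 < t3 - t2 by rewrite subr_gt0.
move=> near_small.
have := filterI (filterI near_small (ntis _ e12)) (ntis _ e23).
move=> [n _ /(_ n (leqnn n)) [[small n12] n23]].
pose N := n.+1; pose tau (i : nat) : R := i%:R / N%:R.
have N0 : 0 < N%:R :> R by rewrite ltr0n.
have tau01 i : (i <= N)%N -> 0 <= tau i <= 1.
  move=> iN; rewrite divr_ge0 ?ler0n//=.
  by rewrite ler_pdivrMr// mul1r ler_nat.
have tauS i : tau i.+1 = tau i + N%:R^-1.
  by rewrite /tau -natr1 mulrDl mul1r.
have tau0 : tau 0%N = 0 by rewrite /tau mul0r.
have tauN : tau N = 1 by rewrite /tau divff// gt_eqF.
(* The number of thresholds passed lifts the label from residues modulo 3 to integers; the row sum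
   for [g] will telescope to it. *)
pose m (t : R) : nat := ((t1 <= t)%R + (t2 <= t)%R + (t3 <= t)%R)%N.
have Cm (t : I) : C (m (unit_val t) %% 3)%N (g t).
  rewrite /m; case: (leP t1 (unit_val t)) => h1; last first.
    by rewrite !leNgt (lt_trans h1 t12) (lt_trans h1 (lt_trans t12 t23));
      apply/g0/ltW.
  case: (leP t2 (unit_val t)) => h2; last first.
    rewrite leNgt (lt_trans h2 t23) /=; apply: g1.
    by rewrite h1 ltW.
  case: (leP t3 (unit_val t)) => h3 /=; last by apply: g2; rewrite h2 ltW.
  exact: g3.
have cov' y : exists2 k, (k < 3)%N & C k y.
  by case: (cov y); [exists 0%N|exists 1%N|exists 2%N].
(* Row 0 carries the prescribed labels, the other three sides are mapped to [x] and get label 0, and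
   in the interior any set of the cover that contains the value may be chosen. *)
pose lab (j i : nat) : nat :=
  if j == 0%N then (m (tau i) %% 3)%N
  else if [|| j == N, i == 0%N | i == N] then 0%N
  else sval (cid2 (cov' (G (tau j, tau i)))).
have clampT i : (i <= N)%N -> unit_val (clamp (tau i)) = tau i.
  by move=> iN; rewrite clampE// tau01.
have labC j i : (j <= N)%N -> (i <= N)%N ->
    (lab j i < 3)%N /\ C (lab j i) (G (tau j, tau i)).
  move=> jN iN; rewrite /lab; case: eqP => [->|_].
    rewrite ltn_mod; split=> //; rewrite /G /= tau0 -/(unit_zero R) H0.
    by have := Cm (clamp (tau i)); rewrite clampT.
  case: ifPn => [|_]; last by case: cid2.
  have Cx : C 0%N x.
    by rewrite -(path_zero (s := g)); apply: g0; rewrite I_zeroE ltW.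
  move=> /or3P[] /eqP ->; split=> //; rewrite /G /= ?tau0 ?tauN.
  - by rewrite -/(unit_one R) H1.
  - by rewrite -/(unit_zero R) Hx.
  - by rewrite -/(unit_one R) Hy.
have m0 : m 0 = 0%N.
  by rewrite /m !leNgt t10 (lt_trans t10 t12) (lt_trans t10 (lt_trans t12 t23)).
have m1 : m 1 = 3%N.
  have -> // : m 1 = (true + true + true)%N.
  by congr (nat_of_bool _ + nat_of_bool _ + nat_of_bool _)%N; lra.
have labS : \sum_(i < N) cyc_diff (lab 0%N i) (lab 0%N i.+1) =
  \sum_(i < N) cyc_diff (lab N i) (lab N i.+1).
  apply: cyc_diff_grid => [j i jN iN|j i jN iN|j jN].
  - by have [] := labC j i jN iN.
  - have [||k k3 kn] := small (tau j, tau i); [exact/tau01/ltnW..|].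
    exists k => //.
    have nk j' i' : (j <= j' <= j.+1)%N -> (i <= i' <= i.+1)%N -> k != lab j' i'.
      move=> /andP[jj' j'j] /andP[ii' i'i]; apply/eqP => kE.
      have [||_] := labC j' i'; [exact: leq_trans jN|exact: leq_trans iN|].
      have near_tau a b : (a <= b <= a.+1)%N -> `|tau b - tau a| <= n.+1%:R^-1.
        case: (eqVneq b a) => [->|ba ab]; first by rewrite subrr normr0 invr_ge0.
        have -> : b = a.+1.
          by case/andP: ab => ab ba'; apply/eqP; rewrite eqn_leq ba' ltn_neqAle eq_sym ba.
        by rewrite tauS addrAC subrr add0r ger0_norm// invr_ge0.
      by rewrite -kE; apply: kn; apply: near_tau; apply/andP.
    by rewrite !inE !negb_or !nk// ?leqnn ?leqnSn.
  - rewrite /lab; have [_|_] := eqVneq j 0%N; last by rewrite !eqxx !orbT.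
    by rewrite tau0 tauN m0 m1.
have rowN : \sum_(i < N) cyc_diff (lab N i) (lab N i.+1) = 0.
  by apply: big1 => i _; rewrite /lab eqxx.
have row0 k : (k <= N)%N ->
    \sum_(i < k) cyc_diff (lab 0%N i) (lab 0%N i.+1) = (m (tau k))%:Z.
  elim: k => [_|k IH kN].
    by rewrite big_ord0 tau0 m0.
  rewrite big_ord_recr /= IH ?(ltnW kN)// /lab /=.
  (* The mesh is finer than [t2 - t1] and [t3 - t2], so no step passes two thresholds at once. *)
  have : m (tau k.+1) = m (tau k) \/ m (tau k.+1) = (m (tau k)).+1.
    have kS : 0 < N%:R^-1 :> R by rewrite invr_gt0.
    rewrite /m tauS; rewrite -/N in n12 n23; move: (tau k) => a.
    have [a3|a3] := leP t3 a.
      by left; congr (nat_of_bool _ + nat_of_bool _ + nat_of_bool _)%N; lra.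
    have [a2|a2] := leP t2 a.
      rewrite (_ : (t1 <= a) = true); last by lra.
      rewrite (_ : (t1 <= a + _) = true); last by lra.
      rewrite (_ : (t2 <= a + _) = true); last by lra.
      by case: (leP t3 (a + _)) => _; [right|left].
    have -> : (t3 <= a + N%:R^-1) = false by lra.
    have [a1|a1] := leP t1 a.
      rewrite (_ : (t1 <= a + _) = true); last by lra.
      by case: (leP t2 (a + _)) => _; [right|left].
    have -> : (t2 <= a + N%:R^-1) = false by lra.
    by case: (leP t1 (a + _)) => _; [right|left].
  have : (m (tau k) <= 3)%N.
    by rewrite /m; do 3 case: (_ <= tau k).
  case: (m (tau k)) => [|[|[|[|//]]]] _ [->|->] //.
by move: labS; rewrite rowN row0// tauN m1.
Qed.

End winding.

(** * Lifting loops *)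

Lemma connected_locally_constant (T : topologicalType) (P : T -> Prop) :
  connected [set: T] ->
  (forall x : T, exists2 W : set T, nbhs x W & forall u v, W u -> W v -> P u -> P v) ->
  forall a b, P a -> P b.
Proof.
move=> cT loc a b Pa; suff -> : P = setT by [].
apply: cT; first by exists a.
  exists P; last by rewrite setTI.
  rewrite openE => x Px; have [W xW WP] := loc x.
  have Wx := nbhs_singleton xW; rewrite /interior.
  by apply: filterS xW => v Wv; exact: (WP x v).
exists P; last by rewrite setTI.
rewrite -[P]setCK; apply: open_closedC; rewrite openE => x Px.
have [W xW WP] := loc x; have Wx := nbhs_singleton xW.
rewrite /interior; apply: filterS xW => v Wv /= Pv.
by apply: Px; exact: (WP v x).
Qed.

Lemma convex_lt (R : realType) (a b c r : R) : 0 <= r <= 1 -> a < c -> b < c ->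
  (b - a) * r + a < c.
Proof.
move=> /andP[r0 r1] ac bc; case: (leP a b) => ab.
  have : (b - a) * (1 - r) >= 0 by apply: mulr_ge0; lra.
  by lra.
have : (a - b) * r >= 0 by apply: mulr_ge0; lra.
by lra.
Qed.

Lemma convex_gt (R : realType) (a b c r : R) : 0 <= r <= 1 -> c < a -> c < b ->
  c < (b - a) * r + a.
Proof.
move=> r01 ca cb; rewrite -ltrN2; have := @convex_lt _ (- a) (- b) (- c) r r01.
by rewrite !ltrN2 => /(_ ca cb); lra.
Qed.

Section lift_loops.
Variables (R : realType).
Local Notation I := (unit_interval R).

Lemma unit_paths_homotopic (x y : I) (p q : pathI R x y) : p ~~ q.
Proof.
apply: (@reparam_homotopic _ _ _ _ _ _ id p q) => //.
- by move=> t; exact: cvg_id.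
- exact: cts_fun.
- exact: cts_fun.
- by rewrite !path_zero.
- by rewrite !path_one.
Qed.

Definition unit_segment_fun (u v : I) (t : I) : I :=
  clamp ((unit_val v - unit_val u) * unit_val t + unit_val u).

Lemma unit_segment_continuous u v : continuous (unit_segment_fun u v).
Proof.
apply: clamp_comp_continuous; apply: affine_continuous.
exact: unit_val_continuous.
Qed.

Lemma unit_segment_zero u v : unit_segment_fun u v zero = u.
Proof. by rewrite /unit_segment_fun I_zeroE mulr0 add0r clampK. Qed.

Lemma unit_segment_one u v : unit_segment_fun u v one = v.
Proof. by rewrite /unit_segment_fun I_oneE mulr1 subrK clampK. Qed.

Definition unit_segment u v : pathI R u v :=
  mk_path (@unit_segment_continuous u v) (unit_segment_zero u v)
    (unit_segment_one u v).

Variables (X : topologicalType) (f s : X -> X) (U V : set X) (p0 : X).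
Hypothesis cf : continuous f.
Hypothesis fU : forall x, U x -> f x = x.
Hypothesis fV : forall x, V x -> f (s x) = x.
Hypothesis cs : forall x, V x -> {for x, continuous s}.
Hypothesis cov : forall x : X, nbhs x U \/ nbhs x V.
Hypothesis Up0 : U p0.
Hypothesis switch : forall x (Ux : U x) (Vx : V x),
  exists z : pathI R x (s x),
    path_map cf z (fU Ux) (fV Vx) ~~ path_cst R x.

(** The predicate [G t] says that the part of [g] up to [t] lifts up to homotopy, with a lift ending
    at [g t] if [g t] is in [U] and one ending at [s (g t)] if it is in [V]. The hypothesis [switch]
    makes either kind of lift yield the other, and connectedness of the interval takes the place of
    a subdivision of the loop. *)
Lemma lift_loops (g : pathI R p0 p0) : exists h : pathI R p0 p0,
  path_map cf h (fU Up0) (fU Up0) ~~ g.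
Proof.
have cg : continuous g by exact: cts_fun.
pose seg u v : pathI R (g u) (g v) :=
  path_map cg (unit_segment u v) erefl erefl.
pose seg0 t : pathI R p0 (g t) :=
  path_map cg (unit_segment zero t) (path_zero (s := g)) erefl.
have seg0S u v : seg0 u ** seg u v ~~ seg0 v.
  rewrite -path_map_concat; apply: path_map_homotopic.
  exact: unit_paths_homotopic.
pose G t := (forall Ut : U (g t), exists h : pathI R p0 (g t),
    path_map cf h (fU Up0) (fU Ut) ~~ seg0 t) /\
  (forall Vt : V (g t), exists h : pathI R p0 (s (g t)),
    path_map cf h (fU Up0) (fV Vt) ~~ seg0 t).
have stepU t : U (g t) -> (exists (Ut : U (g t)) (h : pathI R p0 (g t)),
    path_map cf h (fU Up0) (fU Ut) ~~ seg0 t) -> G t.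
  move=> _ [Ut [h hE]]; split=> [Ut'|Vt]; first by exists h.
  have [z zE] := switch Ut Vt; exists (h ** z).
  by rewrite (path_map_concat cf _ _ _ (fU Ut)) hE zE path_concatp1.
have stepV t : (exists (Vt : V (g t)) (h : pathI R p0 (s (g t))),
    path_map cf h (fU Up0) (fV Vt) ~~ seg0 t) -> G t.
  move=> [Vt [h hE]]; split=> [Ut|Vt']; last by exists h.
  have [z zE] := switch Ut Vt; exists (h ** path_rev z).
  rewrite (path_map_concat cf _ _ _ (fV Vt)) hE (path_map_rev cf) zE.
  by rewrite (_ : path_rev (path_cst R _) = path_cst R _) ?path_concatp1//; exact/path_eqP.
have loc (t : I) : exists2 e : R, 0 < e & forall u v : I,
    `|unit_val u - unit_val t| < e -> `|unit_val v - unit_val t| < e ->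
    G u -> G v.
  have nb (W : set X) : nbhs (g t) W -> exists2 e : R, 0 < e &
      forall u v : I, `|unit_val u - unit_val t| < e ->
      `|unit_val v - unit_val t| < e -> forall r, W (g (unit_segment u v r)).
    move=> gW; pose w r := g (clamp r).
    have cw : continuous w by apply: (comp_continuous _ cg); exact: clamp_continuous.
    have : nbhs (unit_val t) (w @^-1` W) by apply: cw; rewrite /w clampK.
    move=> /nbhs_ballP[e /= e0 eW]; exists e => // u v ut vt r.
    apply: (eW (_ * _ + _)); rewrite /ball/= distrC.
    have r01 := unit_val_itv r.
    move: ut vt; rewrite !ltr_norml !ltrBlDr !ltrBrDr => /andP[u1 u2] /andP[v1 v2].
    by rewrite convex_lt// convex_gt.
  have [gU|gV] := cov (g t).
    have [e e0 eU] := nb _ gU; exists e => // u v ut vt [Gu _].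
    have Ut : U (g u) by have := eU u v ut vt zero; rewrite path_zero.
    have Vt : U (g v) by have := eU u v ut vt one; rewrite path_one.
    have [h hE] := Gu Ut; apply: stepU => //; exists Vt, (h ** seg u v).
    rewrite (path_map_concat cf _ _ _ (fU Ut)) hE -(seg0S u v).
    apply: path_concat_homotopic => //.
    rewrite (_ : path_map _ _ _ _ = seg u v) //; apply/path_eqP => r.
    by rewrite path_mapE; apply: fU; exact: eU.
  have [e e0 eV] := nb _ gV; exists e => // u v ut vt [_ Gu].
  have Ut : V (g u) by have := eV u v ut vt zero; rewrite path_zero.
  have Vt : V (g v) by have := eV u v ut vt one; rewrite path_one.
  have [h hE] := Gu Ut; apply: stepV => //.
  have css : continuous (s \o seg u v).
    move=> r; apply: continuous_comp; first exact: cts_fun.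
    by apply: cs; exact: eV.
  have ss0 : (s \o seg u v) zero = s (g u) by rewrite /= path_zero.
  have ss1 : (s \o seg u v) one = s (g v) by rewrite /= path_one.
  pose sseg : pathI R (s (g u)) (s (g v)) := mk_path css ss0 ss1.
  exists Vt, (h ** sseg).
  rewrite (path_map_concat cf _ _ _ (fV Ut)) hE -(seg0S u v).
  apply: path_concat_homotopic => //.
  rewrite (_ : path_map _ _ _ _ = seg u v) //; apply/path_eqP => r.
  by rewrite path_mapE; apply: fV; exact: eV.
have /(_ 0 1) : forall a b : R, G (clamp a) -> G (clamp b).
  apply: (@connected_locally_constant R^o (fun a => G (clamp a))).
    by apply/connected_intervalP => x y _ _ z _.
  move=> x; have [e e0 eG] := loc (clamp x).
  exists [set a | `|unit_val (clamp a) - unit_val (clamp x)| < e].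
    have ccl : continuous (fun a : R => unit_val (clamp a)).
      apply: unit_val_comp_continuous; exact: clamp_continuous.
    by have /cvgr_dist_lt /(_ e e0) := ccl x; apply: filterS => a; rewrite distrC.
  by move=> u v; exact: eG.
have G0 : G (clamp 0).
  have g0 : g (clamp 0) = p0 by exact: (path_zero (s := g)).
  have Ut : U (g (clamp 0)) by rewrite g0.
  apply: stepU => //; exists Ut.
  have ch : forall t : I, (fun=> p0 : X) t = p0 by [].
  pose h : pathI R p0 (g (clamp 0)) :=
    mk_path (@cst_continuous I X p0) erefl (esym g0).
  exists h; rewrite (_ : path_map _ _ _ _ = seg0 (clamp 0)) //; apply/path_eqP => r.
  rewrite !path_mapE /h /= /mk_path /cst (fU Up0).
  apply: etrans (esym g0) _; congr (g _).
  by rewrite /unit_segment_fun I_zeroE subrr mul0r add0r.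
move=> /(_ G0) [G1 _].
have g1 : g (clamp 1) = p0 by exact: (path_one (s := g)).
have Ut : U (g (clamp 1)) by rewrite g1.
have [h hE] := G1 Ut.
have h1 : h one = p0 by rewrite path_one.
(* The end point [g (clamp 1)] of [h] equals [p0] only propositionally, so the lift is repackaged as
   a loop and its homotopy is reused. *)
exists (mk_path (@cts_fun _ _ h) (path_zero (s := h)) h1).
have [H [cH H0 H1 Hx Hy]] := hE; exists H; split=> // t.
- rewrite H1 path_mapE /= /mk_path /unit_segment_fun I_zeroE -/(unit_one R).
  by rewrite unit_oneE subr0 mul1r addr0 clampK.
- by rewrite Hy.
Qed.

End lift_loops.

(** * Continuity of elementary functions and of maps into subspaces *)

Section real_continuity.
Variables (R : realType) (X : topologicalType).
Implicit Types (f g : X -> R) (x : X).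

Lemma continuousD f g : continuous f -> continuous g ->
  continuous (fun x => f x + g x).
Proof. by move=> cf cg x; apply: cvgD; [exact: cf|exact: cg]. Qed.

Lemma continuousB f g : continuous f -> continuous g ->
  continuous (fun x => f x - g x).
Proof. by move=> cf cg x; apply: cvgB; [exact: cf|exact: cg]. Qed.

Lemma continuousM f g : continuous f -> continuous g ->
  continuous (fun x => f x * g x).
Proof. by move=> cf cg x; apply: cvgM; [exact: cf|exact: cg]. Qed.

Lemma continuousN f : continuous f -> continuous (fun x => - f x).
Proof. by move=> cf x; apply: cvgN; exact: cf. Qed.

Lemma continuousV f : continuous f -> (forall x, f x != 0) ->
  continuous (fun x => (f x)^-1).
Proof. by move=> cf f0 x; apply: cvgV => //; exact: cf. Qed.

Lemma continuous_norm f : continuous f -> continuous (fun x => `|f x|).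
Proof. by move=> cf x; apply: cvg_norm; exact: cf. Qed.

Lemma continuous_minr f g : continuous f -> continuous g ->
  continuous (fun x => Num.min (f x) (g x)).
Proof. by move=> cf cg x; exact: (@continuous_min R X f g x (cf x) (cg x)). Qed.

Lemma continuous_maxr f g : continuous f -> continuous g ->
  continuous (fun x => Num.max (f x) (g x)).
Proof. by move=> cf cg x; exact: (@continuous_max R X f g x (cf x) (cg x)). Qed.

Lemma continuous_cst (c : R) : continuous (fun _ : X => c).
Proof. by move=> x; exact: cvg_cst. Qed.

End real_continuity.

Lemma continuous_id (X : topologicalType) : continuous (fun x : X => x).
Proof. by move=> x; exact: cvg_id. Qed.

Section pair_projections.
Variables (X Y Z : topologicalType).

Lemma continuous_fst (f : X -> Y * Z) : continuous f ->
  continuous (fun x => (f x).1).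
Proof. by move=> cf; apply: comp_continuous cf _; exact: fst_continuous. Qed.

Lemma continuous_snd (f : X -> Y * Z) : continuous f ->
  continuous (fun x => (f x).2).
Proof. by move=> cf; apply: comp_continuous cf _; exact: snd_continuous. Qed.

End pair_projections.

Ltac continuity := lazymatch goal with
  | |- forall x, continuous_at x (fun _ => ?c) => exact: (@continuous_cst _ _ c)
  | |- forall x, continuous_at x (fun y => y) => exact: continuous_id
  | |- forall x, continuous_at x (fun y => (@?f y, @?g y)) =>
      apply: (@pair_continuous _ _ _ f g); continuity
  | |- forall x, continuous_at x (fun y => (@?f y - @?g y)%R) =>
      apply: (@continuousB _ _ f g); continuity
  | |- forall x, continuous_at x (fun y => (@?f y + @?g y)%R) =>
      apply: (@continuousD _ _ f g); continuity
  | |- forall x, continuous_at x (fun y => (@?f y * @?g y)%R) =>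
      apply: (@continuousM _ _ f g); continuity
  | |- forall x, continuous_at x (fun y => (- @?f y)%R) =>
      apply: (@continuousN _ _ f); continuity
  | |- forall x, continuous_at x (fun y => `|@?f y|%R) =>
      apply: (@continuous_norm _ _ f); continuity
  | |- forall x, continuous_at x (fun y => Num.min (@?f y) (@?g y)) =>
      apply: (@continuous_minr _ _ f g); continuity
  | |- forall x, continuous_at x (fun y => Num.max (@?f y) (@?g y)) =>
      apply: (@continuous_maxr _ _ f g); continuity
  | |- forall x, continuous_at x (fun y => unit_val (@?f y)) =>
      apply: (@unit_val_comp_continuous _ _ f); continuity
  | |- forall x, continuous_at x (fun y => clamp (@?f y)) =>
      apply: (@clamp_comp_continuous _ _ f); continuity
  | |- forall x, continuous_at x (fun y => fst (@?f y)) =>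
      apply: (@continuous_fst _ _ _ f); continuity
  | |- forall x, continuous_at x (fun y => snd (@?f y)) =>
      apply: (@continuous_snd _ _ _ f); continuity
  | |- forall x, continuous_at x (fun y => _) =>
      try assumption
  | |- _ => try assumption
  end.


Section subtype_maps.
Variables (Y T : topologicalType) (S : set T).

Definition to_set_type (w : Y -> T) (Sw : forall y, S (w y)) (y : Y) :
  set_type S := SigSub (mem_set (Sw y)).

Lemma to_set_typeE w Sw y : set_val (@to_set_type w Sw y) = w y.
Proof. by rewrite set_valE. Qed.

Lemma to_set_type_continuous w Sw :
  continuous w -> continuous (@to_set_type w Sw).
Proof.
move=> cw; apply: (@continuous_comp_initial _ _ T).
by rewrite (_ : _ \o _ = w).
Qed.

Lemma set_val_continuous : continuous (set_val : set_type S -> T).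
Proof. exact: initial_continuous. Qed.

End subtype_maps.

Lemma set_val_inj (T : Type) (S : set T) : injective (set_val : set_type S -> T).
Proof. by move=> x y; rewrite !set_valE => /val_inj. Qed.

Lemma set_type_path (R : realType) (T : topologicalType) (S : set T)
    (x y : set_type S) (w : unit_interval R -> T) :
  continuous w -> w zero = set_val x -> w one = set_val y ->
  (forall t, S (w t)) ->
  exists p : pathI R x y, forall t, set_val (p t) = w t.
Proof.
move=> cw w0 w1 Sw; pose p := to_set_type Sw.
have cp : continuous p by exact: to_set_type_continuous.
have p0 : p zero = x by apply: set_val_inj; rewrite to_set_typeE.
have p1 : p one = y by apply: set_val_inj; rewrite to_set_typeE.
by exists (mk_path cp p0 p1) => t; exact: to_set_typeE.
Qed.

(** * Concatenation of infinitely many paths *)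

Section infinite_concatenation.
Variables (R : realType) (T : topologicalType) (y : nat -> T) (x : T).
Local Notation I := (unit_interval R).
Variable P : forall n, pathI R (y n) (y n.+1).
Hypothesis Px : forall W : set T, nbhs x W ->
  exists N, forall n t, (N <= n)%N -> W (P n t).

Fixpoint ray_path (n : nat) (r : R) : T :=
  if n is m.+1 then
    if r <= n%:R then ray_path m r else P n (clamp (r - n%:R))
  else P 0%N (clamp r).

Lemma ray_path_end n r : n.+1%:R <= r -> ray_path n r = y n.+1.
Proof.
case: n => [|n] nr /=; first by rewrite clamp_ge1// [LHS]path_one.
rewrite ifF; last by apply/negbTE; rewrite -ltNge (lt_le_trans _ nr)// ltr_nat.
by rewrite clamp_ge1 ?[LHS]path_one// lerBrDr nat1r.
Qed.

Lemma ray_path_continuous n : continuous (ray_path n : R -> T).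
Proof.
elim: n => [|n IH] /=.
  by apply: comp_continuous; [exact: clamp_continuous|exact: cts_fun].
apply: paste_continuous => //; first by move=> r; exact: cvg_id.
  apply: comp_continuous; last exact: cts_fun.
  apply: clamp_comp_continuous => r; apply: cvgB; first exact: cvg_id.
  exact: cvg_cst.
by move=> r ->; rewrite ray_path_end// subrr [RHS]path_zero.
Qed.

Lemma ray_path_stable n k r : r <= n.+1%:R -> ray_path (n + k) r = ray_path n r.
Proof.
move=> rn; elim: k => [|k IH]; first by rewrite addn0.
rewrite addnS /= ifT//; apply: (le_trans rn).
by rewrite ler_nat ltnS leq_addr.
Qed.

Lemma ray_path_tail n N r : N%:R < r -> r <= n.+1%:R ->
  exists k t, (N <= k)%N /\ ray_path n r = P k t.
Proof.
elim: n => [|n IH] Nr rn.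
  exists 0%N, (clamp r); split=> //.
  by rewrite leqNgt; apply/negP => N0; have := lt_le_trans Nr rn; rewrite ltr_nat ltnNge N0.
have [rn'|rn'] := leP r n.+1%:R.
  by have [k [t [Nk E]]] := IH Nr rn'; exists k, t; rewrite /= rn'.
exists n.+1, (clamp (r - n.+1%:R)); split; last by rewrite /= leNgt rn'.
by rewrite -ltnS -(ltr_nat R) (lt_le_trans Nr).
Qed.

(** The half-line carrying all the paths is squeezed into [[0, 1)] by [t / (1 - t)], and [Px]
    provides continuity at the added end point. *)
Lemma infinite_path : inhabited (pathI R (y 0%N) x).
Proof.
have arch (r : R) : exists n : nat, r <= n.+1%:R.
  exists (Num.trunc r); exact/ltW/truncnS_gt.
(* Every stage that runs at least until time [r] has the same value there, by [ray_path_stable], so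
   the chosen stage is immaterial. *)
pose q (r : R) := ray_path (sval (cid (arch r))) r.
have qE r n : r <= n.+1%:R -> q r = ray_path n r.
  rewrite /q; case: cid => m /= rm rn.
  have [mn|/ltnW nm] := leqP m n; first by rewrite -(subnKC mn) ray_path_stable.
  by rewrite -(subnKC nm) ray_path_stable.
pose h (t : R) := t / (1 - t).
pose p (t : I) : T := if unit_val t < 1 then q (h (unit_val t)) else x.
have cv : continuous (fun t : I => unit_val t : R) by exact: unit_val_continuous.
have cp : continuous p.
  move=> t; have [t1|t1] := ltP (unit_val t) 1; last first.
    rewrite /continuous_at {2}/p ltNge t1 /= => W xW; have Wx := nbhs_singleton xW; have [N NW] := Px xW.
    have : \forall s \near t, 1 - N.+2%:R^-1 < unit_val s.
      apply: (cvgr_gt _ (cv t)).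
      by rewrite (lt_le_trans _ t1)// ltrBlDr ltrDl invr_gt0.
    apply: filterS => s sN /=; rewrite /p; case: ifPn => s1 //.
    have [n hn] := arch (h (unit_val s)); rewrite (qE _ _ hn).
    have [|k [u [Nk ->]]] := @ray_path_tail n N _ _ hn; last exact: NW.
    have s0 : 0 < 1 - unit_val s by rewrite subr_gt0.
    rewrite /h ltr_pdivlMr//; move: sN; rewrite -natr1 -natr1.
    rewrite ltrBlDr -ltrBlDl -[X in _ < X]div1r ltr_pdivlMr; last first.
      by rewrite -addrA ltr_wpDl.
    by have /andP[? ?] := unit_val_itv s; nra.
  have [n hn] := arch (h (unit_val t) + 1).
  have ch : {for unit_val t, continuous h}.
    apply: cvgM; first exact: cvg_id.
    apply: cvgV; first by rewrite subr_eq0 eq_sym lt_eqF.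
    by apply: cvgB; [exact: cvg_cst|exact: cvg_id].
  have chv : {for t, continuous (fun s : I => h (unit_val s))}.
    by apply: continuous_comp; [exact: cv|exact: ch].
  have c : {for t, continuous (fun s : I => ray_path n (h (unit_val s)))}.
    by apply: continuous_comp; [exact: chv|exact: ray_path_continuous].
  have nearE : \forall s \near t, ray_path n (h (unit_val s)) = p s.
    have n1 : \forall s \near t, unit_val s < 1.
      exact: (cvgr_lt _ (cv t)).
    have n2 : \forall s \near t, h (unit_val s) < h (unit_val t) + 1.
      by apply: (cvgr_lt _ chv); rewrite ltrDl.
    apply: filterS2 n1 n2 => s s1 hs; rewrite /p s1 (qE _ n)//.
    exact: (le_trans (ltW hs)).
  rewrite /continuous_at -(nbhs_singleton nearE).
  apply: cvg_trans c; exact: (near_eq_cvg nearE).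
have p0 : p zero = y 0%N.
  rewrite /p I_zeroE ltr01 (qE _ 0%N) /h mul0r//= -/(unit_zero R).
  exact: (path_zero (s := P 0%N)).
have p1 : p one = x by rewrite /p I_oneE ltxx.
by split; exact: (mk_path cp p0 p1).
Qed.

End infinite_concatenation.

(** * Attractors of iterated function systems *)

Section ifs_limits.
Variables (J : finType) (E : Type) (D : set J) (phi : J -> E -> E) (K : set E).
Local Notation H := (hutchinson D phi).
Local Notation L := (ifs_limit D phi K).

Lemma hutchinson_mono (A B : set E) : A `<=` B -> H A `<=` H B.
Proof. by move=> AB x [j Dj [a Aa <-]]; exists j => //; exists a => //; exact: AB. Qed.

Lemma ifs_limit_base : L `<=` K.
Proof. by move=> x /(_ 0%N I). Qed.

(** The tool for proving that points belong to a fractal: it is enough that each point of [T] sits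
    in one copy with its blow-up again in [T], so infinite addresses are avoided. *)
Lemma ifs_limit_coind (T : set E) : T `<=` K -> T `<=` H T -> T `<=` L.
Proof.
move=> TK TH x Tx n _; elim: n x Tx => [|n IH] x Tx; first exact: TK.
by have := TH _ Tx; exact: hutchinson_mono.
Qed.

Hypothesis HK : H K `<=` K.

Lemma hutchinson_iter_decr m n : (m <= n)%N -> iter n H K `<=` iter m H K.
Proof.
elim: n m => [|n IH] [|m] mn //=.
  by apply: subset_trans HK; apply: hutchinson_mono; exact: (IH 0%N).
exact/hutchinson_mono/IH.
Qed.

Hypothesis phi_inj : forall j, injective (phi j).

(** The argument is combinatorial. By injectivity each [j] gives at most one preimage of [x]. If
    none belonged to the limit, each would be out from some stage on, and the largest of these
    finitely many stages contradicts that [x] lies in the following iterate. *)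
Lemma ifs_limit_unfold : L `<=` H L.
Proof.
move=> x Lx; apply: contrapT => nHL.
have out j : exists n, forall y, D j -> phi j y = x -> ~ iter n H K y.
  have [[y [Dj yE]]|no] := pselect (exists y, D j /\ phi j y = x); last first.
    by exists 0%N => y Dj yE; case: no; exists y.
  have [Ly|] := pselect (L y); first by case: nHL; exists j => //; exists y.
  move=> nLy; have [n nn] : exists n, ~ iter n H K y.
    by apply: contrapT => nn; apply: nLy => n _; apply: contrapT => ?; apply: nn; exists n.
  by exists n => y' _ y'E; have -> : y' = y by apply: (@phi_inj j); rewrite yE.
pose n j := sval (cid (out j)); pose N := \max_j n j.
have [j Dj [y Ky yE]] : H (iter N H K) x by exact: (Lx N.+1).
have := svalP (cid (out j)); rewrite -/(n j) => /(_ y Dj yE); apply.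
by apply: hutchinson_iter_decr Ky; exact: leq_bigmax.
Qed.

Lemma ifs_limit_fold : H L `<=` L.
Proof.
apply: ifs_limit_coind; last exact/hutchinson_mono/ifs_limit_unfold.
by apply: subset_trans HK; exact/hutchinson_mono/ifs_limit_base.
Qed.

End ifs_limits.

(** * Path connectedness of attractors *)

Section ifs_connected.
Variables (R : realType) (J : finType) (E : normedModType R) (D : set J).
Variables (phi : J -> E -> E) (K : set E) (b : E) (C : R).
Local Notation H := (hutchinson D phi).
Local Notation L := (ifs_limit D phi K).
Local Notation I := (unit_interval R).
Hypothesis HK : H K `<=` K.
Hypothesis phi_inj : forall j, injective (phi j).
Hypothesis phi_contr : forall j u v, `|phi j u - phi j v| <= 2^-1 * `|u - v|.
Hypothesis boundK : forall u v, K u -> K v -> `|u - v| <= C.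
Hypothesis Lb : L b.
Hypothesis base_path : forall j, D j -> exists w : I -> E,
  [/\ continuous w, w zero = b, w one = phi j b & forall t, L (w t)].

Lemma contraction_continuous j : continuous (phi j).
Proof.
move=> u; apply/cvgrPdist_lt => e e0.
have /cvgrPdist_lt /(_ e e0) : cvg_to (nbhs u) (nbhs u) by exact: cvg_id.
apply: filterS => v uv; apply: (le_lt_trans (phi_contr _ _ _)).
apply: le_lt_trans uv; rewrite ler_piMl// invf_le1//; lra.
Qed.

Fixpoint ifs_word (s : seq J) (u : E) : E :=
  if s is j :: s' then phi j (ifs_word s' u) else u.

Lemma ifs_word_rcons s j u : ifs_word (rcons s j) u = ifs_word s (phi j u).
Proof. by elim: s => //= k s ->. Qed.

Lemma ifs_word_continuous s : continuous (ifs_word s).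
Proof.
elim: s => [u|j s IH] /=; first exact: cvg_id.
by apply: comp_continuous IH _; exact: contraction_continuous.
Qed.

Lemma ifs_word_limit s u : (forall j, j \in s -> D j) -> L u -> L (ifs_word s u).
Proof.
elim: s => [//|j s IH] Ds Lu /=; apply: (ifs_limit_fold HK phi_inj).
exists j; first by apply: Ds; rewrite inE eqxx.
by exists (ifs_word s u) => //; apply: IH => // k ks; apply: Ds; rewrite inE ks orbT.
Qed.

Lemma ifs_word_contr s u v :
  `|ifs_word s u - ifs_word s v| <= 2^-1 ^+ size s * `|u - v|.
Proof.
elim: s => [|j s IH] /=; first by rewrite expr0 mul1r.
apply: (le_trans (phi_contr _ _ _)); rewrite exprS -mulrA.
by rewrite ler_wpM2l// invr_ge0.
Qed.

(** Follow an address of [y]. The images of the base paths under its successive prefixes link each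
    [ifs_word (ws n) b] to the next, their distance from [y] is at most [C] times the [n]-th power
    of one half, and so they concatenate to a path ending at [y]. *)
Lemma ifs_limit_path (y : set_type L) (b' : set_type L) : set_val b' = b ->
  inhabited (pathI R b' y).
Proof.
move=> b'E.
have step (u : set_type L) : exists jv : J * set_type L,
    D jv.1 /\ phi jv.1 (set_val jv.2) = set_val u.
  have [j Dj [v Lv vE]] := ifs_limit_unfold HK phi_inj (set_valP u).
  by exists (j, SigSub (mem_set Lv)); split; rewrite //= set_valE.
have [next nextP] := choice step.
pose xs n := iter n (fun u => (next u).2) y.
pose dig n := (next (xs n)).1.
have Ddig n : D (dig n) by have [] := nextP (xs n).
pose ws n := mkseq dig n.
have Dws n k : k \in ws n -> D k by move=> /mapP[i _ ->].
have wsE n : ifs_word (ws n) (set_val (xs n)) = set_val y.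
  elim: n => [//|n IH]; rewrite /ws /mkseq -addn1 iotaD map_cat cats1 add0n.
  by rewrite ifs_word_rcons /= addn1 (proj2 (nextP (xs n))).
have wsL n u : L u -> L (ifs_word (ws n) u) by apply: ifs_word_limit; exact: Dws.
pose yy n : set_type L := SigSub (mem_set (wsL n _ Lb)).
have yyE n : set_val (yy n) = ifs_word (ws n) b by rewrite set_valE.
have segs n : exists p : pathI R (yy n) (yy n.+1), forall t, exists2 u, L u &
    set_val (p t) = ifs_word (ws n) u.
  have [w [cw w0 w1 Lw]] := base_path (Ddig n).
  have [||||p pE] := @set_type_path R E L (yy n) (yy n.+1) (ifs_word (ws n) \o w).
  - exact: comp_continuous cw (@ifs_word_continuous _).
  - by rewrite /= w0 yyE.
  - rewrite /= w1 yyE /ws /mkseq -addn1 iotaD map_cat cats1 add0n.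
    by rewrite ifs_word_rcons.
  - by move=> t; exact: (wsL n).
  by exists p => t; exists (w t).
pose P n := sval (cid (segs n)).
have PP n t : exists2 u, L u & set_val (P n t) = ifs_word (ws n) u.
  exact: (svalP (cid (segs n))).
have [W yW|] := @infinite_path R _ yy y P.
  case: yW => _ [[O oO <-] /= Oy OW].
  have : nbhs (set_val y) O by exact: open_nbhs_nbhs.
  move=> /nbhs_ballP[e /= e0 eO].
  have C0 : 0 <= C by apply: le_trans (boundK (ifs_limit_base Lb) (ifs_limit_base Lb)).
  have /cvgrPdist_lt /(_ (e / (C + 1))) : (2^-1 : R) ^+ n @[n --> \oo] --> 0.
    by apply: cvg_expr; rewrite ger0_norm ?invr_ge0// invf_lt1// ltr1n.
  have C1 : 0 < C + 1 by rewrite ltr_wpDl.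
  move=> /(_ (divr_gt0 e0 C1)) [N _ Ne]; exists N => n t Nn; apply/OW/eO.
  rewrite -ball_normE /=; have [u Lu ->] := PP n t.
  rewrite -(wsE n); apply: (le_lt_trans (ifs_word_contr _ _ _)).
  rewrite size_mkseq; have := Ne n Nn; rewrite /= sub0r normrN ger0_norm ?exprn_ge0 ?invr_ge0//.
  rewrite ltr_pdivlMr// => /(le_lt_trans _); apply.
  rewrite ler_wpM2l ?exprn_ge0 ?invr_ge0// (@le_trans _ _ C) ?lerDl//.
  by apply: boundK; [exact: ifs_limit_base (set_valP _)|exact: ifs_limit_base Lu].
rewrite (_ : yy 0%N = b'); first by move=> p; split.
by apply: set_val_inj; rewrite yyE b'E.
Qed.

Lemma ifs_limit_path_connected (x y : set_type L) : inhabited (pathI R x y).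
Proof.
pose b' : set_type L := SigSub (mem_set Lb).
have b'E : set_val b' = b by rewrite set_valE.
have [p] := ifs_limit_path x b'E; have [q] := ifs_limit_path y b'E.
by split; exact: path_concat (path_rev p) q.
Qed.

End ifs_connected.

Lemma closed_le_fun (R : realType) (T : topologicalType) (f g : T -> R) :
  continuous f -> continuous g -> closed [set x | f x <= g x].
Proof.
move=> cf cg.
rewrite (_ : [set _ | _] = (fun x => f x - g x) @^-1` [set r | r <= 0]).
  by apply: preimage_closed; [|exact: closed_le] => x _;
    apply: cvgB; [exact: cf|exact: cg].
by apply/seteqP; split => x /=; rewrite subr_le0.
Qed.

Ltac closed_ineq := lazymatch goal with
  | |- closed (_ `|` _) => apply: closedU; closed_ineq
  | |- closed (_ `&` _) => apply: closedI; closed_ineq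
  | |- closed (mkset (fun x => is_true (@?f x <= @?g x)%R)) =>
      apply: (@closed_le_fun _ _ f g); continuity
  end.

(** * Foldings with two sections that meet *)

Section folding.
Variables (R : realType) (T : topologicalType) (L : set T).
Local Notation I := (unit_interval R).
Variables (f s s' : T -> T).
Hypotheses (cf : continuous f) (cs : continuous s) (cs' : continuous s').
Hypotheses (fL : forall x, L x -> L (f x)) (sL : forall x, L x -> L (s x))
  (sL' : forall x, L x -> L (s' x)).
Hypotheses (fs : forall x, L x -> f (s x) = x)
  (fs' : forall x, L x -> f (s' x) = x).
Variables (w : I -> T).
Hypotheses (cw : continuous w) (wL : forall t, L (w t)) (w01 : w one = w zero)
  (ss' : s (w zero) = s' (w zero)).
Variables (A0 A1 A2 : set T) (t1 t2 t3 : R).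
Hypotheses (cA0 : closed A0) (cA1 : closed A1) (cA2 : closed A2)
  (cov : forall x, [\/ A0 x, A1 x | A2 x])
  (A012 : forall x, L x -> A0 x -> A1 x -> ~ A2 x)
  (t10 : 0 < t1) (t12 : t1 < t2) (t23 : t2 < t3) (t31 : t3 < 1)
  (w0 : forall t, unit_val t <= t1 -> A0 (s (w t)))
  (w1 : forall t, t1 <= unit_val t <= t2 -> A1 (s (w t)))
  (w2 : forall t, t2 <= unit_val t <= t3 -> A2 (s (w t)))
  (w3 : forall t, t3 <= unit_val t -> A0 (s (w t)))
  (w' : forall t, A0 (s' (w t))).
Hypothesis connL : forall x y : set_type L, inhabited (pathI R x y).

(* The loop s(w) followed by the reverse of s'(w) is killed by the folding f,
   but only its first half crosses the slit A1 `|` A2. *)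
Lemma folding_not_hopfian (x0 : set_type L) : ~ hopfian (fundamental_group R x0).
Proof.
move: (t10) (t12) (t23) (t31) => u0 u1 u2 u3.
have res (g : T -> T) (cg : continuous g) (gL : forall x, L x -> L (g x)) :
    {g' : set_type L -> set_type L | continuous g' &
      forall x, set_val (g' x) = g (set_val x)}.
  have gL' (x : set_type L) : L (g (set_val x)) by exact/gL/set_valP.
  exists (to_set_type gL'); last by move=> x; exact: to_set_typeE.
  apply: to_set_type_continuous; apply: comp_continuous cg.
  exact: set_val_continuous.
have [f' cf' f'E] := res f cf fL; have [g cg gE] := res s cs sL.
have [g' cg' g'E] := res s' cs' sL'.
have f'g x : f' (g x) = x.
  by apply: set_val_inj; rewrite f'E gE fs//; exact: set_valP.
have f'g' x : f' (g' x) = x.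
  by apply: set_val_inj; rewrite f'E g'E fs'//; exact: set_valP.
pose c : set_type L := SigSub (mem_set (wL zero)).
have cE : set_val c = w zero by rewrite set_valE.
have [||||ga gaE] := @set_type_path R T L c c w; rewrite ?cE//.
have g'c : g' c = g c by apply: set_val_inj; rewrite g'E gE cE ss'.
pose la := path_map cg ga erefl erefl ** path_rev (path_map cg' ga g'c g'c).
apply: (@not_hopfian_endo R _ f' cf' connL (g c) c (f'g c) (g c) la).
- move=> q; exists (path_map cg q erefl erefl).
  rewrite (_ : path_map _ _ _ _ = q)//; apply/path_eqP => t.
  by rewrite !path_mapE f'g.
- rewrite (path_map_concat cf' _ _ _ erefl) (path_map_rev cf').
  rewrite (_ : path_map cf' (path_map cg' _ _ _) _ _ =
               path_map cf' (path_map cg ga erefl erefl) erefl erefl).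
    exact: path_concatpV.
  by apply/path_eqP => t; rewrite !path_mapE f'g f'g'.
pose B (A : set T) := (set_val : set_type L -> T) @^-1` A.
have cB A : closed A -> closed (B A).
  move=> cA; apply: preimage_closed cA => x _; exact: set_val_continuous.
have laE t : set_val (la t) = if unit_val t <= 2^-1
    then s (w (clamp (2 * unit_val t)))
    else s' (w (clamp (1 - unit_val (clamp (2 * unit_val t - 1))))).
  rewrite /la /= /mk_path /path_concat_fun; case: ifPn => _.
    by transitivity (set_val (g (ga (clamp (2 * unit_val t))))); rewrite // gE gaE.
  by rewrite -gaE -g'E.
apply: (@winding_not_null R _ (B A0) (B A1) (B A2) (g c) la (t1 / 2) (t2 / 2) (t3 / 2)).
- exact: cB.
- exact: cB.
- exact: cB.
- by move=> x; have := cov (set_val x).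
- by move=> x; exact: A012 (set_valP _).
- by lra.
- by lra.
- by lra.
- by lra.
- move=> t tt; rewrite /B /= laE ifT; last by lra.
  by apply: w0; have := unit_val_itv t => t01; rewrite clampE; lra.
- move=> t tt; rewrite /B /= laE ifT; last by lra.
  by apply: w1; have := unit_val_itv t => t01; rewrite clampE; lra.
- move=> t tt; rewrite /B /= laE ifT; last by lra.
  by apply: w2; have := unit_val_itv t => t01; rewrite clampE; lra.
- move=> t tt; rewrite /B /= laE; case: ifPn => [th|_]; last exact: w'.
  by apply: w3; have := unit_val_itv t => t01; rewrite clampE; lra.
Qed.

End folding.

(** * The boundary loop of the unit square *)

Section square_loop.
Variable R : realType.
Local Notation I := (unit_interval R).
Implicit Type t : I.

Let ramp (r : R) : R := unit_val (clamp r).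

Let ramp0 r : r <= 0 -> ramp r = 0.
Proof. by move=> r0; rewrite /ramp clamp_le0// clampE// lexx ler01. Qed.

Let ramp1 r : 1 <= r -> ramp r = 1.
Proof. by move=> r1; rewrite /ramp clamp_ge1// clampE// lexx ler01. Qed.

(** Clockwise from the origin, one side per quarter of the time, with the left side first. *)
Definition square_loop t : R * R :=
  (ramp (4 * unit_val t - 1) - ramp (4 * unit_val t - 3),
   ramp (4 * unit_val t) - ramp (4 * unit_val t - 2)).

Lemma square_loop_continuous : continuous square_loop.
Proof. by rewrite /square_loop /ramp; continuity.
Qed.

Lemma square_loop_left t : unit_val t <= 4^-1 -> square_loop t = (0, 4 * unit_val t).
Proof.
have := unit_val_itv t => t01 t4; rewrite /square_loop.
rewrite (ramp0 (r := _ - 1)); last by lra.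
rewrite (ramp0 (r := _ - 2)); last by lra.
rewrite (ramp0 (r := _ - 3)); last by lra.
by rewrite /ramp clampE ?subr0//; lra.
Qed.

Lemma square_loop_rest t : 4^-1 <= unit_val t -> let p := square_loop t in
  0 <= p.1 <= 1 /\ 0 <= p.2 <= 1 /\ [\/ p.2 = 1, p.1 = 1 | p.2 = 0].
Proof.
have := unit_val_itv t => t01 t4; rewrite /square_loop /=.
rewrite (ramp1 (r := 4 * _)); last by lra.
have r01 r : 0 <= ramp r <= 1 by exact: unit_val_itv.
have [t2|t2] := leP (unit_val t) 2^-1.
  rewrite (ramp0 (r := _ - 2)) ?(ramp0 (r := _ - 3)); [|lra..].
  by rewrite !subr0 r01 ler01 lexx; split=> //; split => //; constructor 1.
rewrite (ramp1 (r := _ - 1)); last by lra.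
have [t3|t3] := leP (unit_val t) (3 / 4).
  rewrite (ramp0 (r := _ - 3)); last by lra.
  rewrite !subr0 ler01 lexx; split=> //; split; last by constructor 2.
  by have := r01 (4 * unit_val t - 2); lra.
rewrite (ramp1 (r := _ - 2)); last by lra.
rewrite !subrr ler01 lexx; split; last by split => //; constructor 3.
by have := r01 (4 * unit_val t - 3); lra.
Qed.

Lemma square_loop_zero : square_loop zero = (0, 0).
Proof. by rewrite square_loop_left I_zeroE ?mulr0// invr_ge0. Qed.

Lemma square_loop_one : square_loop one = (0, 0).
Proof. by rewrite /square_loop I_oneE !ramp1 ?subrr//; lra. Qed.

Lemma square_loop_itv t : 0 <= (square_loop t).1 <= 1 /\ 0 <= (square_loop t).2 <= 1.
Proof.
have [t4|/ltW/square_loop_rest[? []//]] := leP (unit_val t) 4^-1.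
have := unit_val_itv t => t01; rewrite square_loop_left//= lexx ler01.
by split=> //; lra.
Qed.

End square_loop.

(** * Sierpinski carpet, Menger sponge and Sierpinski gasket *)

Section thirds.
Variable R : realType.
Implicit Types (r : R) (d : 'I_3).

(** The sawtooth with values 1, 0, 1, 0 at 0, 1/3, 2/3, 1: it stretches each third over the unit
    interval and reverses the two outer ones, which makes the pieces fit continuously. *)
Definition zigzag r : R := Num.min `|3 * r - 1| (3 - 3 * r).

Lemma ord3_case d (P : 'I_3 -> Prop) :
  P ord0 -> P (lift ord0 ord0) -> P ord_max -> P d.
Proof.
move=> P0 P1 P2.
have [->|[->|->]] // : d = ord0 \/ d = lift ord0 ord0 \/ d = ord_max.
by case: d => [[|[|[|//]]] i]; [left|right; left|right; right]; apply: ord_inj.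
Qed.

Lemma zigzag_third r d : 0 <= r <= 1 ->
  zigzag (third r d) = (if d == 1%N :> nat then r else 1 - r).
Proof.
move=> r01; rewrite /zigzag /third; elim/ord3_case: d => /=; rewrite ?/bump /=.
- rewrite ler0_norm ?minEle; last by lra.
  by rewrite ifT; lra.
- rewrite ger0_norm ?minEle; last by lra.
  by rewrite ifT; lra.
- rewrite ger0_norm ?minEle; last by lra.
  by case: ifP; lra.
Qed.

Lemma third_itv r d : 0 <= r <= 1 -> 0 <= third r d <= 1.
Proof. by move=> r01; rewrite /third; elim/ord3_case: d => /=; rewrite ?/bump /=; lra. Qed.

Lemma third_inj d : injective (fun x : R => third x d).
Proof. by move=> x y; rewrite /third => xy; lra. Qed.

Lemma third_dist d (x y : R) : `|third x d - third y d| = 3^-1 * `|x - y|.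
Proof.
rewrite -[X in X * _]ger0_norm ?invr_ge0// -normrM /third; congr `|_|; lra.
Qed.

Lemma third_flip r d : 1 - third r d = third (1 - r) (rev_ord d).
Proof.
by rewrite /third; elim/ord3_case: d => /=; rewrite ?/bump /= ?subSS ?subn0; lra.
Qed.

Lemma rev_ord3_mid d : (rev_ord d == 1%N :> nat) = (d == 1%N :> nat).
Proof. by elim/ord3_case: d. Qed.

Lemma third_ex r : 0 <= r <= 1 -> exists d x, 0 <= x <= 1 /\ r = third x d.
Proof.
move=> r01; rewrite /third.
have [r1|r1] := leP r 3^-1.
  by exists ord0, (3 * r); split=> /=; lra.
have [r2|r2] := leP r (2 / 3).
  by exists (lift ord0 ord0), (3 * r - 1); split; rewrite /= /bump /=; lra.
by exists ord_max, (3 * r - 2); split=> /=; lra.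
Qed.

(** The end points of the thirds. Each is reached with a digit other than the middle one from
    another such point, which is what makes the set usable for coinduction. *)
Definition triadic r := [\/ r = 0, r = 3^-1, r = 2 / 3 | r = 1].

Lemma triadic_itv r : triadic r -> 0 <= r <= 1.
Proof. by case=> ->; lra. Qed.

Lemma triadic_third r : triadic r ->
  exists d x, [/\ d != 1%N :> nat, triadic x & r = third x d].
Proof.
case=> ->; rewrite /third.
- by exists ord0, 0; split=> //=; [constructor 1|lra].
- by exists ord0, 1; split=> //=; [constructor 4|lra].
- by exists ord_max, 0; split=> //=; [constructor 1|lra].
- by exists ord_max, 1; split=> //=; [constructor 4|lra].
Qed.

Lemma sixth_third (x : R) d : 0 <= x <= 1 -> 6^-1 = third x d -> x = 2^-1.
Proof.
by move=> x01; rewrite /third; elim/ord3_case: d => /=; rewrite ?/bump /=; lra.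
Qed.

Lemma half_third (x : R) d : 0 <= x <= 1 -> 2^-1 = third x d -> d = 1%N :> nat.
Proof.
by move=> x01; rewrite /third; elim/ord3_case: d => //= h; exfalso; lra.
Qed.

Lemma triadic_digit d : triadic (third (0 : R) d).
Proof.
rewrite /triadic /third; elim/ord3_case: d => /=; rewrite ?/bump /=.
- by constructor 1; lra.
- by constructor 2; lra.
- by constructor 3; lra.
Qed.

End thirds.

Section square_leg.
Variables (R : realType).
Local Notation I := (unit_interval R).

(* The square loop shrunk into the lower left cell and flipped upside down
   crosses the slit only along its first leg. *)
Lemma square_loop_slit (t : I) (p := square_loop t) :
  [/\ unit_val t <= 12^-1 -> 2 / 9 <= (1 - p.2) / 3,
      12^-1 <= unit_val t <= 8^-1 -> p.1 / 3 <= 6^-1 /\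
        6^-1 <= (1 - p.2) / 3 <= 2 / 9,
      8^-1 <= unit_val t <= 6^-1 -> p.1 / 3 <= 6^-1 /\
        9^-1 <= (1 - p.2) / 3 <= 6^-1
    & 6^-1 <= unit_val t ->
        [\/ 6^-1 <= p.1 / 3, (1 - p.2) / 3 <= 9^-1 | 2 / 9 <= (1 - p.2) / 3]].
Proof.
have [t4|t4] := leP (unit_val t) 4^-1.
  by rewrite /p square_loop_left//=; split=> t1; [|split|split|constructor 2]; lra.
have [_ [_ p3]] := square_loop_rest (ltW t4); rewrite -/p in p3.
split=> t1; [lra|lra|lra|].
by case: p3 => ->; [constructor 2|constructor 1|constructor 3]; lra.
Qed.

End square_leg.

(** * The Sierpinski carpet *)

Section carpet.
Variable R : realType.
Local Notation I := (unit_interval R).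
Local Notation E := (R * R)%type.
Local Notation K := (`[0 : R, 1] `*` `[0 : R, 1]).

Let phi (d : 'I_3 * 'I_3) (p : E) : E := (third p.1 d.1, third p.2 d.2).
Let D := [set d : 'I_3 * 'I_3 | ((d.1 == 1 :> nat) + (d.2 == 1 :> nat) < 2)%N].
Local Notation L := (sierpinski_carpet R).

Let KE (p : E) : K p <-> 0 <= p.1 <= 1 /\ 0 <= p.2 <= 1.
Proof. by rewrite /= !in_itv. Qed.

Let HK : hutchinson D phi K `<=` K.
Proof.
move=> _ [d _ [p /KE[p1 p2] <-]]; apply/KE.
by split; exact: third_itv.
Qed.

Let phi_inj d : injective (phi d).
Proof. by move=> [x y] [x' y'] [] /third_inj -> /third_inj ->. Qed.

Let LK p : L p -> 0 <= p.1 <= 1 /\ 0 <= p.2 <= 1.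
Proof. by move=> /(_ 0%N Logic.I)/KE. Qed.

Let unfold p : L p -> exists d q, [/\ D d, L q & p = phi d q].
Proof. by move=> /(ifs_limit_unfold HK phi_inj)[d Dd [q Lq <-]]; exists d, q. Qed.

Let fold d p : D d -> L p -> L (phi d p).
Proof. by move=> Dd Lp; apply: (ifs_limit_fold HK phi_inj); exists d => //; exists p. Qed.

(** A triadic coordinate can always be given a digit other than 1, and then the other coordinate may
    have any digit; so the union of these lines is closed under passing to a blow-up. *)
Let line (x y : R) : triadic x -> 0 <= y <= 1 -> L (x, y) /\ L (y, x).
Proof.
move=> tx y01; pose T := [set p : E | (triadic p.1 /\ 0 <= p.2 <= 1) \/
  (triadic p.2 /\ 0 <= p.1 <= 1)].
suff TL : T `<=` L by split; apply: TL; [left|right].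
apply: ifs_limit_coind => [p []|p []] [tp p01].
- by apply/KE; split=> //; exact: triadic_itv.
- by apply/KE; split=> //; exact: triadic_itv.
- have [d [x' [d1 tx' E1]]] := triadic_third tp.
  have [e [y' [y01' E2]]] := third_ex p01.
  exists (d, e); first by rewrite /= (negbTE d1); case: eqP.
  by exists (x', y'); [left|rewrite /= -E1 -E2 -surjective_pairing].
- have [d [x' [d1 tx' E1]]] := triadic_third tp.
  have [e [y' [y01' E2]]] := third_ex p01.
  exists (e, d); first by rewrite /= (negbTE d1); case: eqP.
  by exists (y', x'); [right|rewrite /= -E1 -E2 -surjective_pairing].
Qed.

(** Needed because [f] reverses the coordinates of some cells. Reflection reverses digits and fixes
    the middle one, so admissible cells go to admissible cells. *)
Let flip (x y : R) : L (x, y) -> L (1 - x, y) /\ L (x, 1 - y).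
Proof.
move=> Lxy; pose T := [set p : E | L (1 - p.1, p.2) \/ L (p.1, 1 - p.2)].
suff TL : T `<=` L by split; apply: TL; [left|right]; rewrite /= subKr.
apply: ifs_limit_coind => [p|p] /= [] Lp.
- by have /= [p1 p2] := LK Lp; apply/KE; split; lra.
- by have /= [p1 p2] := LK Lp; apply/KE; split; lra.
- have [d [q [Dd Lq [p1 p2]]]] := unfold Lp.
  exists (rev_ord d.1, d.2); first by rewrite /D /= rev_ord3_mid.
  exists (1 - q.1, q.2); first by left; rewrite /= subKr -surjective_pairing.
  by rewrite -third_flip -p1 -p2 /= subKr -surjective_pairing.
- have [d [q [Dd Lq [p1 p2]]]] := unfold Lp.
  exists (d.1, rev_ord d.2); first by rewrite /D /= rev_ord3_mid.
  exists (q.1, 1 - q.2); first by right; rewrite /= subKr -surjective_pairing.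
  by rewrite -third_flip -p1 -p2 /= subKr -surjective_pairing.
Qed.

Let L0 : L (0, 0).
Proof. by have [] := @line 0 0 (Or41 _ _ _ erefl); rewrite ?lexx ?ler01. Qed.

(** The centre of the lower left cell: after that cell, its address is forced to continue with the
    removed middle one. *)
Lemma carpet_center : ~ L (6^-1, 6^-1).
Proof.
move=> /unfold[d [q [_ Lq [q1 q2]]]]; have [i1 i2] := LK Lq.
move: Lq; rewrite [q]surjective_pairing (sixth_third i1 q1) (sixth_third i2 q2).
move=> /unfold[e [q' [De Lq' [e1 e2]]]]; have [j1 j2] := LK Lq'.
by move: De; rewrite /D /= (half_third j1 e1) (half_third j2 e2).
Qed.

Lemma carpet_path_connected (x y : set_type L) : inhabited (pathI R x y).
Proof.
apply: (@ifs_limit_path_connected R _ E D phi K (0, 0) 1) => //.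
- move=> d u v; rewrite /phi !prod_normE /=.
  rewrite (third_dist d.1) (third_dist d.2) -maxr_pMr ?invr_ge0//.
  by rewrite ler_wpM2r ?le_max ?normr_ge0//; lra.
- move=> u v /KE[u1 u2] /KE[v1 v2]; rewrite prod_normE /= ge_max.
  by rewrite !ler_norml; apply/andP; split; lra.
(* The base path runs along the bottom side first and then up a vertical grid line. *)
move=> d _; pose a b (t : I) : R := unit_val (clamp (2 * unit_val t - b)).
exists (fun t => (a 0 t * third 0 d.1, a 1 t * third 0 d.2)).
have a01 b t : 0 <= a b t <= 1 by exact: unit_val_itv.
have u01 (u v : R) : 0 <= u <= 1 -> 0 <= v <= 1 -> 0 <= u * v <= 1.
  by move=> /andP[u0 u1] /andP[v0 v1]; rewrite mulr_ge0// mulr_ile1.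
split.
- by rewrite /a; continuity.
- by rewrite /a I_zeroE !clamp_le0 ?clampE ?mul0r//; lra.
- by rewrite /a I_oneE !clamp_ge1 ?clampE ?mul1r//; lra.
move=> t; have [t1|t1] := leP (unit_val t) 2^-1.
  rewrite {2}/a clamp_le0 ?clampE ?mul0r//; [|lra..].
  apply: (proj2 (line _ _)); first by constructor 1.
  by apply: u01 => //; exact/triadic_itv/triadic_digit.
rewrite {1}/a clamp_ge1 ?clampE ?mul1r//; [|lra..].
apply: (proj1 (line _ _)); first exact: triadic_digit.
by apply: u01 => //; exact/triadic_itv/triadic_digit.
Qed.

Lemma carpet_not_hopfian (x0 : set_type L) : ~ hopfian (fundamental_group R x0).
Proof.
(* The map [f] unfolds every cell over the square; [s] and [s'] are its inverse branches on the
   lower left cell and on the cell above it. The first is upside down, so that they agree on the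
   common side. *)
pose f (p : E) : E := (1 - zigzag p.1, zigzag p.2).
pose s (p : E) : E := (p.1 / 3, (1 - p.2) / 3).
pose s' (p : E) : E := (p.1 / 3, (1 + p.2) / 3).
have sE x y : s (x, y) = phi (ord0, ord0) (x, 1 - y).
  by rewrite /s /phi /third /= !addr0.
have s'E x y : s' (x, y) = phi (ord0, lift ord0 ord0) (x, y).
  by rewrite /s' /phi /third /= addr0 addrC.
have fphi d q : L q -> f (phi d q) =
    (if d.1 == 1%N :> nat then 1 - q.1 else q.1,
     if d.2 == 1%N :> nat then q.2 else 1 - q.2).
  move=> Lq; have [q1 q2] := LK Lq.
  by rewrite /f /phi /= !zigzag_third//; congr pair; case: ifP => _; rewrite ?subKr.
(* The slit lies at height 1/6 and runs from the left side to the hole of the lower left cell. [A1]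
   and [A2] are the strips above and below it, and the three sets meet only at the centre of that
   hole. *)
pose A0 := [set p : E | [\/ 6^-1 <= p.1, p.2 <= 9^-1 | 2 / 9 <= p.2]].
pose A1 := [set p : E | p.1 <= 6^-1 /\ 6^-1 <= p.2 <= 2 / 9].
pose A2 := [set p : E | p.1 <= 6^-1 /\ 9^-1 <= p.2 <= 6^-1].
have square t := square_loop_itv (t : I).
have slit t := @square_loop_slit R t.
(* On its first leg the image of the loop under [s] is at height [(1 - 4 t) / 3], which takes the
   values 2/9, 1/6 and 1/9 at the three given times. *)
apply: (@folding_not_hopfian R E L f s s' _ _ _ _ _ _ _ _ (@square_loop R)
  _ _ _ _ A0 A1 A2 12^-1 8^-1 6^-1).
- by rewrite /f /zigzag; continuity.
- by rewrite /s; continuity.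
- by rewrite /s'; continuity.
- move=> p /unfold[d [q [_ Lq ->]]]; rewrite fphi//.
  have [Lf1 Lf2] : L (1 - q.1, q.2) /\ L (q.1, 1 - q.2).
    by apply: flip; rewrite -surjective_pairing.
  case: ifP => _; case: ifP => _ //; last by rewrite -surjective_pairing.
  by have [] := flip Lf1.
- move=> [x y] Lxy; rewrite sE; apply: fold => //.
  by have [] := flip Lxy.
- by move=> [x y] Lxy; rewrite s'E; apply: fold.
- move=> [x y] Lxy; rewrite sE fphi /= ?subKr//.
  by have [] := flip Lxy.
- by move=> [x y] Lxy; rewrite s'E fphi.
- exact: square_loop_continuous.
- move=> t; have [p1 p2] := square t.
  have [t4|/ltW t4] := leP (unit_val t) 4^-1.
    move: p1 p2; rewrite square_loop_left//= => _ p2.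
    by have [] := @line 0 (4 * unit_val t) (Or41 _ _ _ erefl) p2.
  have [_ [_]] := square_loop_rest t4; move: p1 p2.
  case: square_loop => x y /= p1 p2 [] ->.
  + by have [] := @line 1 x (Or44 _ _ _ erefl) p1.
  + by have [] := @line 1 y (Or44 _ _ _ erefl) p2.
  + by have [] := @line 0 x (Or41 _ _ _ erefl) p1.
- by rewrite square_loop_zero square_loop_one.
- by rewrite square_loop_zero /s /s' /= subr0 addr0.
- rewrite (_ : A0 = [set p | 6^-1 <= p.1] `|` [set p | p.2 <= 9^-1] `|` [set p | 2 / 9 <= p.2]).
    by closed_ineq.
  apply/seteqP; split=> p /=; first by case; [left; left|left; right|right].
  by case=> [[]|]; [constructor 1|constructor 2|constructor 3].
- rewrite (_ : A1 = [set p | p.1 <= 6^-1] `&` ([set p | 6^-1 <= p.2] `&` [set p | p.2 <= 2 / 9])).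
    by closed_ineq.
  by apply/seteqP; split=> p /= [p1]; [move=> /andP|move/andP].
- rewrite (_ : A2 = [set p | p.1 <= 6^-1] `&` ([set p | 9^-1 <= p.2] `&` [set p | p.2 <= 6^-1])).
    by closed_ineq.
  by apply/seteqP; split=> p /= [p1]; [move=> /andP|move/andP].
- move=> p; rewrite /A0 /A1 /A2 /=.
  have [p1|/ltW p1] := leP p.1 6^-1; last by constructor 1; constructor 1.
  have [p2|p2] := leP p.2 9^-1; first by constructor 1; constructor 2.
  have [p3|p3] := leP p.2 6^-1; first by constructor 3; split=> //; lra.
  have [p4|/ltW p4] := leP p.2 (2 / 9); first by constructor 2; split=> //; lra.
  by constructor 1; constructor 3.
- move=> p Lp; rewrite /A0 /A1 /A2 /= => a0 [a1 a2] [_ a3].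
  have p2 : p.2 = 6^-1 by lra.
  have p1 : p.1 = 6^-1 by case: a0; lra.
  by apply: carpet_center; move: Lp; rewrite [p]surjective_pairing p1 p2.
- by lra.
- by lra.
- by lra.
- by lra.
- by move=> t t1; have [/(_ t1) h _ _ _] := slit t; constructor 3.
- by move=> t t1; have [_ /(_ t1) h _ _] := slit t.
- by move=> t t1; have [_ _ /(_ t1) h _] := slit t.
- by move=> t t1; have [_ _ _ /(_ t1) h] := slit t.
- move=> t; have [_] := square t; rewrite /s'; case: square_loop => x y /= y01.
  by rewrite /A0 /=; constructor 3; lra.
- exact: carpet_path_connected.
Qed.

End carpet.

(** * The Menger sponge *)

Section sponge.
Variable R : realType.
Local Notation I := (unit_interval R).
Local Notation E := (R * R * R)%type.
Local Notation K := (`[0 : R, 1] `*` `[0 : R, 1] `*` `[0 : R, 1]).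

Let phi (d : 'I_3 * 'I_3 * 'I_3) (p : E) : E :=
  (third p.1.1 d.1.1, third p.1.2 d.1.2, third p.2 d.2).
Let D := [set d : 'I_3 * 'I_3 * 'I_3 |
  ((d.1.1 == 1 :> nat) + (d.1.2 == 1 :> nat) + (d.2 == 1 :> nat) < 2)%N].
Local Notation L := (menger_sponge R).

Let KE (p : E) : K p <-> [/\ 0 <= p.1.1 <= 1, 0 <= p.1.2 <= 1 & 0 <= p.2 <= 1].
Proof. by rewrite /= !in_itv; split=> [[[]]|[]]. Qed.

Let HK : hutchinson D phi K `<=` K.
Proof.
move=> _ [d _ [p /KE[p1 p2 p3] <-]]; apply/KE.
by split; exact: third_itv.
Qed.

Let phi_inj d : injective (phi d).
Proof.
by move=> [[x y] z] [[x' y'] z'] [] /third_inj -> /third_inj -> /third_inj ->.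
Qed.

Let LK p : L p -> [/\ 0 <= p.1.1 <= 1, 0 <= p.1.2 <= 1 & 0 <= p.2 <= 1].
Proof. by move=> /(_ 0%N Logic.I)/KE. Qed.

Let unfold p : L p -> exists d q, [/\ D d, L q & p = phi d q].
Proof. by move=> /(ifs_limit_unfold HK phi_inj)[d Dd [q Lq <-]]; exists d, q. Qed.

Let fold d p : D d -> L p -> L (phi d p).
Proof. by move=> Dd Lp; apply: (ifs_limit_fold HK phi_inj); exists d => //; exists p. Qed.

Let line (x y z : R) : triadic x -> triadic y -> 0 <= z <= 1 ->
  [/\ L (x, y, z), L (x, z, y) & L (z, x, y)].
Proof.
move=> tx ty z01.
pose T := [set p : E | exists x y z, [/\ triadic x, triadic y, 0 <= z <= 1 &
  [\/ p = (x, y, z), p = (x, z, y) | p = (z, x, y)]]].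
suff TL : T `<=` L.
  by split; apply: TL; exists x, y, z; split=> //;
    [constructor 1|constructor 2|constructor 3].
apply: ifs_limit_coind => p [{}x [{}y [{}z [{}tx {}ty {}z01 pE]]]].
  by apply/KE; case: pE => -> /=; split=> //; exact: triadic_itv.
have [d [x' [/negbTE d1 tx' xE]]] := triadic_third tx.
have [e [y' [/negbTE e1 ty' yE]]] := triadic_third ty.
have [i [z' [z01' zE]]] := third_ex z01.
case: pE => ->; rewrite xE yE zE.
- exists (d, e, i); first by rewrite /= d1 e1; case: eqP.
  by exists (x', y', z') => //; exists x', y', z'; split=> //; constructor 1.
- exists (d, i, e); first by rewrite /= d1 e1; case: eqP.
  by exists (x', z', y') => //; exists x', y', z'; split=> //; constructor 2.
- exists (i, d, e); first by rewrite /= d1 e1; case: eqP.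
  by exists (z', x', y') => //; exists x', y', z'; split=> //; constructor 3.
Qed.

Let fl (b : bool) (x : R) := if b then 1 - x else x.

Let flK b : involutive (fl b).
Proof. by move=> x; case: b; rewrite /fl ?subKr. Qed.

Let flip b1 b2 b3 x y z : L (x, y, z) -> L (fl b1 x, fl b2 y, fl b3 z).
Proof.
move=> Lp; pose T := [set p : E | L (fl b1 p.1.1, fl b2 p.1.2, fl b3 p.2)].
suff TL : T `<=` L by apply: TL; rewrite /T /= !flK.
have fl01 b u : 0 <= fl b u <= 1 -> 0 <= u <= 1 by rewrite /fl; case: b; lra.
pose flo b (d : 'I_3) := if b then rev_ord d else d.
have flE b (d : 'I_3) u : fl b (third u d) = third (fl b u) (flo b d).
  by rewrite /fl /flo; case: b => //; exact: third_flip.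
have flo1 b d : (flo b d == 1%N :> nat) = (d == 1%N :> nat).
  by rewrite /flo; case: b => //; exact: rev_ord3_mid.
apply: ifs_limit_coind => p; rewrite /T /= => {}Lp.
  by have /= [p1 p2 p3] := LK Lp; apply/KE; split; apply: fl01; eassumption.
have [d [q [Dd Lq [p1 p2 p3]]]] := unfold Lp.
exists (flo b1 d.1.1, flo b2 d.1.2, flo b3 d.2); first by rewrite /= !flo1.
exists (fl b1 q.1.1, fl b2 q.1.2, fl b3 q.2).
  by rewrite /T /= !flK -!surjective_pairing.
by rewrite /= -!flE -p1 -p2 -p3 !flK -!surjective_pairing.
Qed.

Let L0 : L (0, 0, 0).
Proof.
by have [] := @line 0 0 0 (Or41 _ _ _ erefl) (Or41 _ _ _ erefl); rewrite ?lexx ?ler01.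
Qed.

(** Two middle digits already exclude a cell, so the last coordinate is free: the end of the carpet
    slit becomes a line inside a tunnel of the sponge. *)
Lemma sponge_center z : ~ L (6^-1, 6^-1, z).
Proof.
move=> /unfold[d [q [_ Lq [q1 q2 _]]]]; have [i1 i2 _] := LK Lq.
move: Lq; rewrite [q]surjective_pairing [q.1]surjective_pairing.
rewrite (sixth_third i1 q1) (sixth_third i2 q2).
move=> /unfold[e [q' [De Lq' [e1 e2 _]]]]; have [j1 j2 _] := LK Lq'.
by move: De; rewrite /D /= (half_third j1 e1) (half_third j2 e2).
Qed.

Lemma sponge_path_connected (x y : set_type L) : inhabited (pathI R x y).
Proof.
apply: (@ifs_limit_path_connected R _ E D phi K (0, 0, 0) 1) => //.
- move=> d u v; rewrite /phi !prod_normE /= ?prod_normE /=.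
  rewrite (third_dist d.1.1) (third_dist d.1.2) (third_dist d.2).
  rewrite -!maxr_pMr ?invr_ge0//.
  by rewrite ler_wpM2r ?le_max ?normr_ge0 ?orbT//; lra.
- move=> u v /KE[u1 u2 u3] /KE[v1 v2 v3]; rewrite !prod_normE /= ?prod_normE /= !ge_max.
  by rewrite !ler_norml; apply/andP; split; [apply/andP; split|]; lra.
move=> d _; pose a b (t : I) : R := unit_val (clamp (3 * unit_val t - b)).
exists (fun t => (a 0 t * third 0 d.1.1, a 1 t * third 0 d.1.2, a 2 t * third 0 d.2)).
have a01 b t : 0 <= a b t <= 1 by exact: unit_val_itv.
have u01 (u v : R) : 0 <= u <= 1 -> 0 <= v <= 1 -> 0 <= u * v <= 1.
  by move=> /andP[u0 u1] /andP[v0 v1]; rewrite mulr_ge0// mulr_ile1.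
have a0 b t : 3 * unit_val t <= b -> a b t = 0.
  by move=> tb; rewrite /a clamp_le0 ?clampE//; lra.
have a1 b t : b + 1 <= 3 * unit_val t -> a b t = 1.
  by move=> tb; rewrite /a clamp_ge1 ?clampE//; lra.
have td (i : 'I_3) t b : 0 <= a b t * third 0 i <= 1.
  by apply: u01 => //; exact/triadic_itv/triadic_digit.
have t0 : triadic (0 : R) by constructor 1.
split.
- by rewrite /a; continuity.
- by rewrite !a0 ?mul0r// I_zeroE; lra.
- by rewrite !a1 ?mul1r// I_oneE; lra.
move=> t; have [t1|/ltW t1] := leP (unit_val t) 3^-1.
  rewrite (a0 1) ?(a0 2) ?mul0r; [|lra..].
  by have [] := line t0 t0 (td d.1.1 t 0).
have [t2|/ltW t2] := leP (unit_val t) (2 / 3).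
  rewrite (a1 0) ?(a0 2) ?mul0r ?mul1r; [|lra..].
  by have [] := line (triadic_digit R d.1.1) t0 (td d.1.2 t 1).
rewrite (a1 0) ?(a1 1) ?mul1r; [|lra..].
by have [] := line (triadic_digit R d.1.1) (triadic_digit R d.1.2) (td d.2 t 2).
Qed.

Lemma sponge_not_hopfian (x0 : set_type L) : ~ hopfian (fundamental_group R x0).
Proof.
(* The maps of the carpet, with the third coordinate folded in the same way; the loop stays in the
   face where that coordinate is 0. *)
pose f (p : E) : E := (1 - zigzag p.1.1, zigzag p.1.2, 1 - zigzag p.2).
pose s (p : E) : E := (p.1.1 / 3, (1 - p.1.2) / 3, p.2 / 3).
pose s' (p : E) : E := (p.1.1 / 3, (1 + p.1.2) / 3, p.2 / 3).
have sE x y z : s (x, y, z) = phi (ord0, ord0, ord0) (x, 1 - y, z).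
  by rewrite /s /phi /third /= !addr0.
have s'E x y z : s' (x, y, z) = phi (ord0, lift ord0 ord0, ord0) (x, y, z).
  by rewrite /s' /phi /third /= !addr0 [1 + y]addrC.
have fphi d q : L q -> f (phi d q) =
    (fl (d.1.1 == 1%N :> nat) q.1.1, fl (d.1.2 != 1%N :> nat) q.1.2,
     fl (d.2 == 1%N :> nat) q.2).
  move=> Lq; have [q1 q2 q3] := LK Lq.
  rewrite /f /phi /= !zigzag_third// /fl.
  by do 3 (case: ifP => _; rewrite ?subKr).
pose A0 := [set p : E | [\/ 6^-1 <= p.1.1, p.1.2 <= 9^-1 | 2 / 9 <= p.1.2]].
pose A1 := [set p : E | p.1.1 <= 6^-1 /\ 6^-1 <= p.1.2 <= 2 / 9].
pose A2 := [set p : E | p.1.1 <= 6^-1 /\ 9^-1 <= p.1.2 <= 6^-1].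
have square t := square_loop_itv (t : I).
have slit t := @square_loop_slit R t.
have flipy x y z : L (x, y, z) -> L (x, 1 - y, z).
  by move=> /(flip false true false).
have t0 : triadic (0 : R) by constructor 1.
have t1 : triadic (1 : R) by constructor 4.
apply: (@folding_not_hopfian R E L f s s' _ _ _ _ _ _ _ _
  (fun t => (@square_loop R t, 0)) _ _ _ _ A0 A1 A2 12^-1 8^-1 6^-1).
- by rewrite /f /zigzag; continuity.
- by rewrite /s; continuity.
- by rewrite /s'; continuity.
- move=> p /unfold[d [q [_ Lq ->]]]; rewrite fphi//; apply: flip.
  by rewrite -!surjective_pairing.
- by move=> [[x y] z] Lxy; rewrite sE; apply: fold => //; exact: flipy.
- by move=> [[x y] z] Lxy; rewrite s'E; apply: fold.
- by move=> [[x y] z] Lxy; rewrite sE fphi /= /fl /= ?subKr//; exact: flipy.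
- by move=> [[x y] z] Lxy; rewrite s'E fphi.
- apply: pair_continuous; last exact: continuous_cst.
  exact: square_loop_continuous.
- move=> t; have [p1 p2] := square t.
  have [t4|/ltW t4] := leP (unit_val t) 4^-1.
    move: p1 p2; rewrite square_loop_left//= => _ p2.
    by have [] := line t0 t0 p2.
  have [_ [_]] := square_loop_rest t4; move: p1 p2.
  case: square_loop => x y /= p1 p2 [] ->.
  + by have [] := line t1 t0 p1.
  + by have [] := line t1 t0 p2.
  + by have [] := line t0 t0 p1.
- by rewrite square_loop_zero square_loop_one.
- by rewrite square_loop_zero /s /s' /= subr0 addr0.
- rewrite (_ : A0 = [set p | 6^-1 <= p.1.1] `|` [set p | p.1.2 <= 9^-1] `|`
      [set p | 2 / 9 <= p.1.2]).
    by closed_ineq.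
  apply/seteqP; split=> p /=; first by case; [left; left|left; right|right].
  by case=> [[]|]; [constructor 1|constructor 2|constructor 3].
- rewrite (_ : A1 = [set p | p.1.1 <= 6^-1] `&`
      ([set p | 6^-1 <= p.1.2] `&` [set p | p.1.2 <= 2 / 9])).
    by closed_ineq.
  by apply/seteqP; split=> p /= [p1]; [move=> /andP|move/andP].
- rewrite (_ : A2 = [set p | p.1.1 <= 6^-1] `&`
      ([set p | 9^-1 <= p.1.2] `&` [set p | p.1.2 <= 6^-1])).
    by closed_ineq.
  by apply/seteqP; split=> p /= [p1]; [move=> /andP|move/andP].
- move=> p; rewrite /A0 /A1 /A2 /=.
  have [p1|/ltW p1] := leP p.1.1 6^-1; last by constructor 1; constructor 1.
  have [p2|p2] := leP p.1.2 9^-1; first by constructor 1; constructor 2.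
  have [p3|p3] := leP p.1.2 6^-1; first by constructor 3; split=> //; lra.
  have [p4|/ltW p4] := leP p.1.2 (2 / 9); first by constructor 2; split=> //; lra.
  by constructor 1; constructor 3.
- move=> [[x y] z] Lp; rewrite /A0 /A1 /A2 /= => a0 [a1 a2] [_ a3].
  have p2 : y = 6^-1 by lra.
  have p1 : x = 6^-1 by case: a0; lra.
  by apply: (@sponge_center z); move: Lp; rewrite p1 p2.
- by lra.
- by lra.
- by lra.
- by lra.
- by move=> t tt; have [/(_ tt) h _ _ _] := slit t; constructor 3.
- by move=> t tt; have [_ /(_ tt) h _ _] := slit t.
- by move=> t tt; have [_ _ /(_ tt) h _] := slit t.
- by move=> t tt; have [_ _ _ /(_ tt) h] := slit t.
- move=> t; have [_] := square t; rewrite /s'; case: square_loop => x y /= y01.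
  by rewrite /A0 /=; constructor 3; lra.
- exact: sponge_path_connected.
Qed.

End sponge.

(** * The Sierpinski gasket *)

Section gasket.
Variable R : realType.
Local Notation I := (unit_interval R).
Local Notation E := (R * R)%type.
Local Notation K := (gasket_triangle R).
Local Notation L := (sierpinski_gasket R).
Local Notation r3 := (Num.sqrt 3 : R).

Let phi (j : 'I_3) (p : E) : E :=
  ((p.1 + (gasket_vertex R j).1) / 2, (p.2 + (gasket_vertex R j).2) / 2).

(* Barycentric coordinates with respect to the second and third vertices. *)
Let P (b : E) : E := (b.1 + b.2 / 2, b.2 * (r3 / 2)).
Let Q (p : E) : E := (p.1 - p.2 / r3, p.2 * (2 / r3)).

Let r3_gt0 : 0 < r3.
Proof. by rewrite sqrtr_gt0 ltr0n. Qed.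

Let r3_sqr : r3 * r3 = 3.
Proof. by rewrite -expr2 sqr_sqrtr// ler0n. Qed.

Let r3_neq0 : r3 != 0.
Proof. by rewrite gt_eqF. Qed.

Let PK : cancel P Q.
Proof.
move: r3_neq0 => r0; case=> x y; rewrite /P /Q /=.
by congr pair; field.
Qed.

Let QK : cancel Q P.
Proof.
move: r3_neq0 => r0; case=> x y; rewrite /P /Q /=.
by congr pair; field.
Qed.

Let phi0 x y : phi ord0 (P (x, y)) = P (x / 2, y / 2).
Proof. by rewrite /phi /P /= !addr0; congr pair; field. Qed.

Let phi1 x y : phi (lift ord0 ord0) (P (x, y)) = P ((x + 1) / 2, y / 2).
Proof. by rewrite /phi /P /= !addr0; congr pair; field. Qed.

Let phi2 x y : phi ord_max (P (x, y)) = P (x / 2, (y + 1) / 2).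
Proof. by rewrite /phi /P /=; congr pair; field. Qed.

Let KE x y : K (P (x, y)) <-> [/\ 0 <= x, 0 <= y & x + y <= 1].
Proof.
split=> [[a [a0 a1 e1 e2]]|[x0 y0 xy]].
  rewrite !big_ord_recl !big_ord0 /= in a1 e1 e2.
  have : P (x, y) = P (a (lift ord0 ord0), a (lift ord0 (lift ord0 ord0))).
    rewrite /P /= e1 e2.
    by rewrite !mulr0 !add0r !addr0 mulr1.
  move=> /(can_inj PK)[-> ->]; split=> //.
  by rewrite -a1 addr0 lerDr.
exists (fun j : 'I_3 => nth 0 [:: 1 - x - y; x; y] j); split.
- by move=> j; elim/ord3_case: j => //=; lra.
- by rewrite !big_ord_recl big_ord0 /=; lra.
- by rewrite !big_ord_recl big_ord0 /=; lra.
- by rewrite !big_ord_recl big_ord0 /= !mulr0 !add0r addr0.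
Qed.

Let Pex p : exists x y, p = P (x, y).
Proof. by exists (Q p).1, (Q p).2; rewrite -surjective_pairing QK. Qed.

Let HK : hutchinson setT phi K `<=` K.
Proof.
move=> _ [j _ [p Kp <-]]; have [x [y pE]] := Pex p.
move: Kp; rewrite pE => /KE[x0 y0 xy].
elim/ord3_case: j; rewrite ?phi0 ?phi1 ?phi2; apply/KE; split; lra.
Qed.

Let phi_inj j : injective (phi j).
Proof.
by move=> [x y] [x' y'] []; rewrite /phi /= => e1 e2; congr pair; lra.
Qed.

Let LK x y : L (P (x, y)) -> [/\ 0 <= x, 0 <= y & x + y <= 1].
Proof. by move=> /(_ 0%N Logic.I)/KE. Qed.

Let unfold x y : L (P (x, y)) -> exists u v, L (P (u, v)) /\
  [\/ x = u / 2 /\ y = v / 2, x = (u + 1) / 2 /\ y = v / 2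
    | x = u / 2 /\ y = (v + 1) / 2].
Proof.
move=> /(ifs_limit_unfold HK phi_inj)[j _ [q]]; have [u [v ->]] := Pex q => Lq.
elim/ord3_case: j; rewrite ?phi0 ?phi1 ?phi2 => /(can_inj PK)[<- <-];
  exists u, v; split=> //; [constructor 1|constructor 2|constructor 3]; by [].
Qed.

Let fold j p : L p -> L (phi j p).
Proof. by move=> Lp; apply: (ifs_limit_fold HK phi_inj); exists j => //; exists p. Qed.

Let coind (A : R -> R -> Prop) :
  (forall x y, A x y -> [/\ 0 <= x, 0 <= y & x + y <= 1]) ->
  (forall x y, A x y -> exists u v, A u v /\
  [\/ x = u / 2 /\ y = v / 2, x = (u + 1) / 2 /\ y = v / 2
    | x = u / 2 /\ y = (v + 1) / 2]) ->
  forall x y, A x y -> L (P (x, y)).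
Proof.
move=> AK AH x y Axy; pose T := [set p | exists u v, A u v /\ p = P (u, v)].
suff TL : T `<=` L by apply: TL; exists x, y.
apply: ifs_limit_coind => _ [u [v [Auv ->]]]; first exact/KE/AK.
have [u' [v' [A' uv]]] := AH _ _ Auv.
case: uv => -[-> ->].
- by exists ord0 => //; exists (P (u', v')); [exists u', v'|exact: phi0].
- by exists (lift ord0 ord0) => //; exists (P (u', v')); [exists u', v'|exact: phi1].
- by exists ord_max => //; exists (P (u', v')); [exists u', v'|exact: phi2].
Qed.

(** Each half of a side of the triangle is a side of a smaller copy, so the boundary is closed under
    passing to a blow-up. *)
Let edge x y : 0 <= x -> 0 <= y -> x + y <= 1 ->
  [\/ x = 0, y = 0 | x + y = 1] -> L (P (x, y)).
Proof.
move=> x0 y0 xy e.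
apply: (@coind (fun x y => [/\ 0 <= x, 0 <= y, x + y <= 1 &
  [\/ x = 0, y = 0 | x + y = 1]])) => [{e xy y0 x0}|{e xy y0 x0}|//].
  by move=> x' y' [].
move=> {}x {}y [x0 y0 xy] e.
have [x2|x2] := leP x 2^-1; have [y2|y2] := leP y 2^-1.
- have [s|s] := leP (x + y) 2^-1.
    exists (2 * x), (2 * y); split; last by constructor 1; lra.
    split; [lra..|].
    case: e => e; [constructor 1; lra|constructor 2; lra|lra].
  have [xx|xx] := eqVneq x 2^-1.
    exists (2 * x - 1), (2 * y); split; last by constructor 2; lra.
    split; [lra..|]; case: e => e; [lra|constructor 2; lra|constructor 3; lra].
  case: e => e; [|exfalso; lra|].
    by exfalso; lra.
  exfalso; move: xx; rewrite (_ : x = 2^-1) ?eqxx//; lra.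
- exists (2 * x), (2 * y - 1); split; last by constructor 3; lra.
  by split; [lra..|]; case: e => e; [constructor 1; lra|exfalso; lra|constructor 3; lra].
- exists (2 * x - 1), (2 * y); split; last by constructor 2; lra.
  by split; [lra..|]; case: e => e; [exfalso; lra|constructor 2; lra|constructor 3; lra].
- exfalso; lra.
Qed.

(** Transposing two vertices permutes the three copies, so coinduction applies; these symmetries are
    the ones by which [f] unfolds the copies. *)
Let swap x y : L (P (x, y)) ->
  [/\ L (P (1 - x - y, y)), L (P (y, x)) & L (P (x, 1 - x - y))].
Proof.
move=> Lxy; split.
- apply: (@coind (fun u v => L (P (1 - u - v, v)))) => [u v /LK[]|u v /unfold|].
  + by move=> *; split; lra.
  + move=> [u' [v' [L' uv]]]; exists (1 - u' - v'), v'; split.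
      by rewrite (_ : 1 - _ - v' = u') //; lra.
    by case: uv => -[e1 e2]; [constructor 2|constructor 1|constructor 3]; lra.
  + by rewrite (_ : 1 - _ - y = x) //; lra.
- apply: (@coind (fun u v => L (P (v, u)))) => [u v /LK[]|u v /unfold|//].
  + by move=> *; split; lra.
  + move=> [u' [v' [L' uv]]]; exists v', u'; split=> //.
    by case: uv => -[e1 e2]; [constructor 1|constructor 3|constructor 2]; lra.
- apply: (@coind (fun u v => L (P (u, 1 - u - v)))) => [u v /LK[]|u v /unfold|].
  + by move=> *; split; lra.
  + move=> [u' [v' [L' uv]]]; exists u', (1 - u' - v'); split.
      by rewrite (_ : 1 - u' - _ = v') //; lra.
    by case: uv => -[e1 e2]; [constructor 3|constructor 2|constructor 1]; lra.
  + by rewrite (_ : 1 - x - _ = y) //; lra.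
Qed.

(** The point lies in the copy at the first vertex, and its blow-up (3/8, 1/4) is interior to the
    removed middle triangle. *)
Lemma gasket_hole : ~ L (P (3 / 16, 8^-1)).
Proof.
move=> /unfold[u [v [Luv uv]]]; have [u0 v0 uv1] := LK Luv.
have /unfold[u' [v' [Luv' uv']]] : L (P (3 / 8, 4^-1)).
  rewrite (_ : (3 / 8, 4^-1) = (u, v))//; congr pair; case: uv; lra.
by have [u0' v0' uv1'] := LK Luv'; case: uv'; lra.
Qed.

Lemma gasket_path_connected (x y : set_type L) : inhabited (pathI R x y).
Proof.
apply: (@ifs_limit_path_connected R _ E setT phi K (P (0, 0)) 1) => //.
- move=> j u v; rewrite /phi !prod_normE /=.
  have half a b c : `|(a + c) / 2 - (b + c) / 2| = 2^-1 * `|a - b| :> R.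
    rewrite -[in RHS](@ger0_norm _ 2^-1) ?invr_ge0// -normrM.
    by congr `|_|; lra.
  by rewrite !half -maxr_pMr ?invr_ge0.
- move=> u v; have [x1 [y1 ->]] := Pex u; have [x2 [y2 ->]] := Pex v.
  move=> /KE[a1 a2 a3] /KE[b1 b2 b3].
  rewrite prod_normE /= ge_max -mulrBl !ler_norml.
  have r2 : r3 <= 2 by rewrite -(ler_pXn2r (n := 2)) ?nnegrE ?ltW// expr2 r3_sqr; lra.
  move: r3_gt0 => r0; apply/andP; split; apply/andP; split; nra.
- by apply: edge; [lra..|constructor 1].
move=> j _.
exists (fun t => P (unit_val t * (Q (phi j (P (0, 0)))).1,
                    unit_val t * (Q (phi j (P (0, 0)))).2)).
split.
- rewrite /P /=; continuity.
- by lazy beta; rewrite I_zeroE !mul0r.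
- by lazy beta; rewrite I_oneE !mul1r -surjective_pairing QK.
move=> t; have t01 := unit_val_itv t.
by elim/ord3_case: j; rewrite ?phi0 ?phi1 ?phi2 PK /=; apply: edge;
  rewrite ?mul0r ?add0r ?mulr0 ?addr0; try lra; [constructor 1|constructor 2|constructor 1].
Qed.

Let tri (t : I) : E :=
  (unit_val (clamp (3 * unit_val t)) - unit_val (clamp (3 * unit_val t - 1)),
   unit_val (clamp (3 * unit_val t - 1)) - unit_val (clamp (3 * unit_val t - 2))).

Let tri1 t : unit_val t <= 3^-1 -> tri t = (3 * unit_val t, 0).
Proof.
have t01 := unit_val_itv t => t1; rewrite /tri.
rewrite (@clamp_le0 _ (_ - 1)) ?(@clamp_le0 _ (_ - 2)); [|lra..].
by rewrite !clampE ?subr0//; lra.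
Qed.

Let tri2 t : 3^-1 <= unit_val t <= 2 / 3 ->
  tri t = (2 - 3 * unit_val t, 3 * unit_val t - 1).
Proof.
have t01 := unit_val_itv t => t1; rewrite /tri.
rewrite (@clamp_ge1 _ (3 * _)) ?(@clamp_le0 _ (_ - 2)); [|lra..].
by rewrite !clampE ?subr0//; [congr pair|..]; lra.
Qed.

Let tri3 t : 2 / 3 <= unit_val t -> tri t = (0, 3 - 3 * unit_val t).
Proof.
have t01 := unit_val_itv t => t1; rewrite /tri.
rewrite (@clamp_ge1 _ (3 * _)) ?(@clamp_ge1 _ (_ - 1)); [|lra..].
by rewrite !clampE ?subrr//; [congr pair|..]; lra.
Qed.

Let tri_cases t (A : E -> Prop) :
  (unit_val t <= 3^-1 -> A (3 * unit_val t, 0)) ->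
  (3^-1 <= unit_val t <= 2 / 3 -> A (2 - 3 * unit_val t, 3 * unit_val t - 1)) ->
  (2 / 3 <= unit_val t -> A (0, 3 - 3 * unit_val t)) -> A (tri t).
Proof.
move=> A1 A2 A3; have [t1|/ltW t1] := leP (unit_val t) 3^-1.
  by rewrite tri1//; exact: A1.
have [t2|/ltW t2] := leP (unit_val t) (2 / 3).
  by rewrite tri2 ?t1//; apply: A2; rewrite t1.
by rewrite tri3//; exact: A3.
Qed.

Lemma gasket_not_hopfian (x0 : set_type L) : ~ hopfian (fundamental_group R x0).
Proof.
pose pos (r : R) := Num.max 0 r.
(* Plain blow-ups of the three copies disagree at the shared vertices. Following each by a
   transposition of barycentric coordinates, with results [(1 - u - v, v)], [(v, u)] and
   [(u, 1 - u - v)], makes them agree. Each [pos] term corrects the formula on one copy and vanishes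
   on the two others. *)
pose fold_xy (b : E) : E :=
  (`|1 - 2 * (1 - b.1 - b.2)| - pos (2 * b.1 - 1) - pos (2 * b.2 - 1),
   `|1 - 2 * b.1| - pos (1 - 2 * b.1 - 2 * b.2) - pos (2 * b.2 - 1)).
pose f (p : E) : E := P (fold_xy (Q p)).
pose s (p : E) : E := P ((1 - (Q p).1 - (Q p).2) / 2, (Q p).2 / 2).
pose s' (p : E) : E := P (((Q p).2 + 1) / 2, (Q p).1 / 2).
have posE r : pos r = if 0 <= r then r else 0.
  by rewrite /pos; case: (leP 0 r) => [/max_r|/ltW/max_l].
have posF r : r <= 0 -> pos r = 0 by move=> r0; exact/max_l.
have posT r : 0 <= r -> pos r = r by move=> r0; exact/max_r.
have f0 u v : L (P (u, v)) -> f (phi ord0 (P (u, v))) = P (1 - u - v, v).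
  move=> /LK[u0 v0 uv]; rewrite /f phi0 PK /fold_xy /=.
  rewrite (@posF (2 * (u / 2) - 1)) ?(@posF (2 * (v / 2) - 1)) ?posT; [|lra..].
  by congr (P (_, _)); [rewrite ler0_norm|rewrite ger0_norm]; lra.
have f1 u v : L (P (u, v)) -> f (phi (lift ord0 ord0) (P (u, v))) = P (v, u).
  move=> /LK[u0 v0 uv]; rewrite /f phi1 PK /fold_xy /=.
  rewrite (@posF (1 - _ - _)) ?(@posF (2 * (v / 2) - 1)) ?posT; [|lra..].
  by congr (P (_, _)); [rewrite ger0_norm|rewrite ler0_norm]; lra.
have f2 u v : L (P (u, v)) -> f (phi ord_max (P (u, v))) = P (u, 1 - u - v).
  move=> /LK[u0 v0 uv]; rewrite /f phi2 PK /fold_xy /=.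
  rewrite (@posF (1 - _ - _)) ?(@posF (2 * (u / 2) - 1)) ?posT; [|lra..].
  by congr (P (_, _)); [rewrite ger0_norm|rewrite ger0_norm]; lra.
have sE u v : s (P (u, v)) = phi ord0 (P (1 - u - v, v)).
  by rewrite /s PK /= phi0.
have s'E u v : s' (P (u, v)) = phi (lift ord0 ord0) (P (v, u)).
  by rewrite /s' PK /= phi1.
(* The slit is the part of the line [(Q p).1 = 3 / 16] from the bottom side up to the hole of the
   first copy, and the three sets meet only at the point of [gasket_hole]. *)
pose A0 := [set p : E | [\/ 8^-1 <= (Q p).2, 4^-1 <= (Q p).1 | (Q p).1 <= 8^-1]].
pose A1 := [set p : E | (Q p).2 <= 8^-1 /\ 3 / 16 <= (Q p).1 <= 4^-1].
pose A2 := [set p : E | (Q p).2 <= 8^-1 /\ 8^-1 <= (Q p).1 <= 3 / 16].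
have cf : continuous f by rewrite /f /fold_xy /P /Q /pos /=; continuity.
have cs : continuous s by rewrite /s /P /Q /=; continuity.
have cs' : continuous s' by rewrite /s' /P /Q /=; continuity.
have sPtri t : s (P (tri t)) = P ((1 - (tri t).1 - (tri t).2) / 2, (tri t).2 / 2).
  by rewrite /s PK.
(* The first leg of the loop goes under [s] to the point with coordinates [(1 - 3 t) / 2] and 0,
   which passes 1/4, 3/16 and 1/8 at the three given times. *)
apply: (@folding_not_hopfian R E L f s s' cf cs cs' _ _ _ _ _
  (P \o tri) _ _ _ _ A0 A1 A2 6^-1 (5 / 24) 4^-1).
- move=> p Lp; have [x [y pE]] := Pex p; move: Lp; rewrite pE => Lxy.
  have /(ifs_limit_unfold HK phi_inj)[j _ [q Lq <-]] := Lxy.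
  have [u [v qE]] := Pex q; move: Lq; rewrite qE => Lq.
  have [L1 L2 L3] := swap Lq.
  by elim/ord3_case: j; rewrite ?f0 ?f1 ?f2.
- move=> p Lp; have [x [y pE]] := Pex p; move: Lp; rewrite pE => Lxy.
  by rewrite sE; apply: fold; have [] := swap Lxy.
- move=> p Lp; have [x [y pE]] := Pex p; move: Lp; rewrite pE => Lxy.
  by rewrite s'E; apply: fold; have [] := swap Lxy.
- move=> p Lp; have [x [y pE]] := Pex p; move: Lp; rewrite pE => Lxy.
  rewrite sE f0; last by have [] := swap Lxy.
  by congr (P (_, _)); lra.
- move=> p Lp; have [x [y pE]] := Pex p; move: Lp; rewrite pE => Lxy.
  by rewrite s'E f1//; have [] := swap Lxy.
- by rewrite /tri /P /comp /=; continuity.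
- move=> t; have t01 := unit_val_itv t; rewrite /=.
  apply: (@tri_cases t (fun b => L (P b))) => tt; apply: edge; try lra.
  + by constructor 2.
  + by constructor 3; lra.
  + by constructor 1.
- rewrite /comp (@tri3 one) ?I_oneE; last by lra.
  by rewrite tri1 ?I_zeroE ?invr_ge0//; congr (P (_, _)); lra.
- rewrite /comp tri1 ?I_zeroE ?invr_ge0// sE s'E phi0 phi1.
  by congr (P (_, _)); lra.
- rewrite (_ : A0 = [set p | 8^-1 <= (Q p).2] `|` [set p | 4^-1 <= (Q p).1] `|`
      [set p | (Q p).1 <= 8^-1]).
    by rewrite /Q /=; closed_ineq.
  apply/seteqP; split=> p /=; first by case; [left; left|left; right|right].
  by case=> [[]|]; [constructor 1|constructor 2|constructor 3].
- rewrite (_ : A1 = [set p | (Q p).2 <= 8^-1] `&`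
      ([set p | 3 / 16 <= (Q p).1] `&` [set p | (Q p).1 <= 4^-1])).
    by rewrite /Q /=; closed_ineq.
  by apply/seteqP; split=> p /= [p1]; [move=> /andP|move/andP].
- rewrite (_ : A2 = [set p | (Q p).2 <= 8^-1] `&`
      ([set p | 8^-1 <= (Q p).1] `&` [set p | (Q p).1 <= 3 / 16])).
    by rewrite /Q /=; closed_ineq.
  by apply/seteqP; split=> p /= [p1]; [move=> /andP|move/andP].
- move=> p; rewrite /A0 /A1 /A2 /mkset; move: (Q p) => q.
  have [p2|/ltW p2] := leP q.2 8^-1; last by constructor 1; constructor 1.
  have [p1|p1] := leP q.1 8^-1; first by constructor 1; constructor 3.
  have [p3|p3] := leP q.1 (3 / 16); first by constructor 3; split=> //; lra.
  have [p4|/ltW p4] := leP q.1 4^-1; first by constructor 2; split=> //; lra.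
  by constructor 1; constructor 2.
- move=> p Lp; have [x [y pE]] := Pex p; move: Lp; rewrite pE /A0 /A1 /A2 /mkset !PK /=.
  move=> Lxy a0 [a1 a2] [_ a3]; have p1 : x = 3 / 16 by lra.
  have p2 : y = 8^-1 by case: a0; lra.
  by apply: gasket_hole; move: Lxy; rewrite p1 p2.
- by lra.
- by lra.
- by lra.
- by lra.
- move=> t tt; rewrite /comp sPtri /A0 /mkset !PK tri1 /=; last by lra.
  by constructor 2; lra.
- move=> t tt; rewrite /comp sPtri /A1 /mkset !PK tri1 /=; last by lra.
  by split; lra.
- move=> t tt; rewrite /comp sPtri /A2 /mkset !PK tri1 /=; last by lra.
  by split; lra.
- move=> t tt; rewrite /comp sPtri /A0 /mkset !PK.
  apply: (@tri_cases t (fun b => [\/ 8^-1 <= b.2 / 2, 4^-1 <= (1 - b.1 - b.2) / 2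
    | (1 - b.1 - b.2) / 2 <= 8^-1])) => tt' /=.
  + by constructor 3; lra.
  + by constructor 3; lra.
  + by have [y4|y4] := leP 8^-1 ((3 - 3 * unit_val t) / 2); [constructor 1|constructor 2; lra].
- move=> t; rewrite /comp /s' /A0 /mkset !PK /=; constructor 2.
  have t01 := unit_val_itv t.
  by apply: (@tri_cases t (fun b => 4^-1 <= (b.2 + 1) / 2)) => tt' /=; lra.
- exact: gasket_path_connected.
Qed.

End gasket.

(** * Countable sets in the plane *)

Section countable_avoidance.
Variable R : realType.
Local Notation E := (R * R)%type.
Local Notation I := (unit_interval R).
Implicit Types (p q u v : E) (B : set E).

(** Countable sets have Lebesgue measure zero, nonempty open intervals do not. *)
Lemma countable_avoid (A : set R) (a b : R) : countable A -> a < b ->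
  exists2 r, a < r < b & ~ A r.
Proof.
move=> cA ab; apply: contrapT => no.
have sub : `]a, b[%classic `<=` A.
  move=> r; rewrite /= in_itv /= => rab; apply: contrapT => Ar.
  by apply: no; exists r.
have : countable `]a, b[%classic by exact: sub_countable (subset_card_le sub) cA.
move=> /countable_lebesgue_measure0; rewrite lebesgue_measure_itv /= lte_fin ab.
by rewrite -EFinB => -[] /eqP; rewrite subr_eq0 gt_eqF.
Qed.

Lemma countable_image (S T : Type) (f : S -> T) (A : set S) :
  countable A -> countable (f @` A).
Proof. by move=> cA; apply: sub_countable cA; exact: card_image_le. Qed.

Lemma countableU (T : Type) (A A' : set T) :
  countable A -> countable A' -> countable (A `|` A').
Proof.
move=> cA cA'; rewrite -bigcup2E; apply: bigcup_countable => //.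
by move=> [|[|i]] _ //=; exact: countable0.
Qed.

Definition seg p q (t : R) : E :=
  (p.1 + t * (q.1 - p.1), p.2 + t * (q.2 - p.2)).

Lemma seg0 p q : seg p q 0 = p.
Proof. by rewrite /seg !mul0r !addr0 -surjective_pairing. Qed.

Lemma seg1 p q : seg p q 1 = q.
Proof. by rewrite /seg !mul1r !subrKC -surjective_pairing. Qed.

Definition seg_convex (C : set E) := forall p q (t : R), 0 <= t <= 1 ->
  C p -> C q -> C (seg p q t).

Lemma seg_path_continuous p q : continuous (fun t : I => seg p q (unit_val t)).
Proof.
have cv : continuous (fun t : I => unit_val t : R) by exact: unit_val_continuous.
rewrite /seg; continuity.
Qed.

Lemma seg_path_zero p q : seg p q (unit_val (zero : I)) = p.
Proof. by rewrite I_zeroE seg0. Qed.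

Lemma seg_path_one p q : seg p q (unit_val (one : I)) = q.
Proof. by rewrite I_oneE seg1. Qed.

Definition seg_path p q : pathI R p q :=
  mk_path (@seg_path_continuous p q) (seg_path_zero p q) (seg_path_one p q).

Definition det p q : R := p.1 * q.2 - p.2 * q.1.

(** Cramer's rule for the parameter at which the line through [p] and [b] meets the line through [u]
    and [v]. *)
Let hit p u v (b : E) : R := - det (b - p) (u - p) / det (b - p) (v - u).

Lemma hit_seg p u v b (s t : R) : det (v - u) (p - u) != 0 -> b != p ->
  b = seg p (seg u v t) s -> t = hit p u v b.
Proof.
move=> nd bp be; have s0 : s != 0.
  by apply: contra_neq bp => s0; rewrite be s0 seg0.
have e1 : (b - p).1 = s * (u.1 + t * (v.1 - u.1) - p.1).
  by rewrite be /seg /=; ring.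
have e2 : (b - p).2 = s * (u.2 + t * (v.2 - u.2) - p.2).
  by rewrite be /seg /=; ring.
have d0 : det (b - p) (v - u) = s * det (v - u) (p - u).
  by rewrite /det e1 e2 /=; ring.
have dn : det (b - p) (v - u) != 0 by rewrite d0 mulf_neq0.
apply: (mulIf dn); rewrite /hit divfK// /det e1 e2 /=; ring.
Qed.

(** A path with one corner, sought on the segment from [u] to [v]. Because [p] and [q] are off its
    line, each point of [B] spoils at most one corner for [p] and one for [q], so countably many are
    excluded. *)
Lemma broken_path B p q u v : countable B -> ~ B p -> ~ B q ->
  det (v - u) (p - u) != 0 -> det (v - u) (q - u) != 0 ->
  exists w : pathI R p q, forall t, ~ B (w t) /\
    forall C, seg_convex C -> C p -> C q -> C u -> C v -> C (w t).
Proof.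
move=> cB Bp Bq dp dq.
have [||r r01] := @countable_avoid ((hit p u v) @` B `|` (hit q u v) @` B) 0 1.
- by apply: countableU; exact: countable_image.
- exact: ltr01.
move=> /not_orP[hp hq]; pose m := seg u v r.
exists (path_concat (seg_path p m) (path_rev (seg_path q m))) => t.
have [s [s01 [z [zpq ->]]]] : exists s, 0 <= s <= 1 /\ exists z,
    (z = p \/ z = q) /\
    path_concat (seg_path p m) (path_rev (seg_path q m)) t = seg z m s.
  rewrite /= /mk_path /path_concat_fun; case: ifP => _.
    exists (unit_val (clamp (2 * unit_val t))); split; first exact: unit_val_itv.
    by exists p; split; [left|].
  exists (unit_val (clamp (1 - unit_val (clamp (2 * unit_val t - 1))))).
  split; first exact: unit_val_itv.
  by exists q; split; [right|].
have r01' : 0 <= r <= 1 by lra.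
split; last first.
  move=> C cC Cp Cq Cu Cv; apply: (cC) => //; last exact: cC.
  by case: zpq => ->.
move=> Bz; case: zpq => zE; rewrite zE in Bz.
  apply: hp; exists (seg p m s) => //; apply/esym/(@hit_seg _ _ _ _ s) => //.
  by apply/eqP => sp; apply: Bp; rewrite -sp.
apply: hq; exists (seg q m s) => //; apply/esym/(@hit_seg _ _ _ _ s) => //.
by apply/eqP => sp; apply: Bq; rewrite -sp.
Qed.

(** The candidate corners lie on a vertical segment inside [C], at an abscissa different from those
    of [p] and [q]; this makes both determinants of [broken_path] nonzero. *)
Lemma convex_path B C p q (a b y0 y1 : R) : countable B -> ~ B p -> ~ B q ->
  seg_convex C -> C p -> C q -> a < b -> y0 != y1 ->
  (forall c, a < c < b -> C (c, y0) /\ C (c, y1)) ->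
  exists w : pathI R p q, forall t, ~ B (w t) /\ C (w t).
Proof.
move=> cB Bp Bq cC Cp Cq ab y01 Cab.
have [|//|c cab] := @countable_avoid ([set p.1] `|` [set q.1]) a b.
  by apply: countableU; exact: countable1.
move=> /not_orP[/= cp cq]; have [C0 C1] := Cab c cab.
have dn (z : E) : c <> z.1 -> det ((c, y1) - (c, y0)) (z - (c, y0)) != 0.
  move=> cz; rewrite /det /= subrr mul0r sub0r oppr_eq0 mulf_eq0 !subr_eq0.
  rewrite negb_or [y1 == y0]eq_sym y01 /=; apply/eqP => zc; exact: cz (esym zc).
have [w wP] := @broken_path B p q (c, y0) (c, y1) cB Bp Bq (dn p cp) (dn q cq).
by exists w => t; have [nB inC] := wP t; split=> //; exact: inC.
Qed.

Lemma plane_path B p q : countable B -> ~ B p -> ~ B q ->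
  exists w : pathI R p q, forall t, ~ B (w t).
Proof.
move=> cB Bp Bq.
have y01 : 0 != 1 :> R by rewrite eq_sym oner_eq0.
have cT : seg_convex (setT : set E) by [].
have [//|w wP] := convex_path cB Bp Bq cT Logic.I Logic.I ltr01 y01.
by exists w => t; have [] := wP t.
Qed.

End countable_avoidance.

(** * Uniform limits with a geometric rate *)

Section geometric_limit.
Variable R : realType.

Lemma half_pow_lt (e : R) : 0 < e -> exists n : nat, 2^-1 ^+ n < e.
Proof.
move=> e0; have /cvgrPdist_lt /(_ e e0) : (2^-1 : R) ^+ n @[n --> \oo] --> 0.
  by apply: cvg_expr; rewrite ger0_norm ?invr_ge0// invf_lt1// ltr1n.
move=> [N _ /(_ N (leqnn N))]; rewrite /= sub0r normrN ger0_norm ?exprn_ge0 ?invr_ge0//.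
by exists N.
Qed.

(** Lowering the terms by [2^-1 ^+ n] gives an increasing sequence, raising them a decreasing one
    above it; the supremum of the former lies between the two, which is the stated rate. *)
Lemma geometric_limit (r : nat -> R) :
  (forall n, `|r n.+1 - r n| <= 2^-1 ^+ n.+1) ->
  exists l, forall n, `|l - r n| <= 2^-1 ^+ n.
Proof.
move=> rS; pose s n := r n - 2^-1 ^+ n; pose t n := r n + 2^-1 ^+ n.
have half n : (2^-1 : R) ^+ n = 2^-1 ^+ n.+1 + 2^-1 ^+ n.+1.
  by rewrite exprS; lra.
have sS n : s n <= s n.+1.
  rewrite /s [in X in X <= _]half; have := rS n; rewrite ler_norml; lra.
have tS n : t n.+1 <= t n.
  rewrite /t [in X in _ <= X]half; have := rS n; rewrite ler_norml; lra.
have s_incr m n : (m <= n)%N -> s m <= s n.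
  by move/subnKC => <-; elim: (n - m)%N => [|k IH]; rewrite ?addn0// addnS (le_trans IH).
have t_decr m n : (m <= n)%N -> t n <= t m.
  by move/subnKC => <-; elim: (n - m)%N => [|k IH]; rewrite ?addn0// addnS (le_trans _ IH).
have st m n : s m <= t n.
  have e0 k : (0 : R) <= 2^-1 ^+ k by rewrite exprn_ge0// invr_ge0.
  have [mn|/ltnW nm] := leqP m n.
    by apply: le_trans (s_incr _ _ mn) _; have := e0 n; rewrite /s /t; lra.
  by apply: le_trans (t_decr _ _ nm); have := e0 m; rewrite /s /t; lra.
have hs : has_sup (range s).
  by split; [exists (s 0%N); exists 0%N|exists (t 0%N) => _ [m _ <-]].
exists (sup (range s)) => n; rewrite ler_norml; apply/andP; split.
  have : s n <= sup (range s) by apply: ub_le_sup; [case: hs|exists n].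
  by rewrite /s; lra.
have : sup (range s) <= t n by apply: ge_sup; [case: hs|move=> _ [m _ <-]].
by rewrite /t; lra.
Qed.

Local Notation E := (R * R)%type.

Lemma norm_pair_le (p : E) (e : R) : (`|p| <= e) = (`|p.1| <= e) && (`|p.2| <= e).
Proof. by rewrite prod_normE ge_max. Qed.

Lemma uniform_geometric_limit (u : nat -> E -> E) :
  (forall n, continuous (u n)) ->
  (forall n x, `|u n.+1 x - u n x| <= 2^-1 ^+ n.+1) ->
  exists2 v : E -> E, continuous v & forall n x, `|v x - u n x| <= 2^-1 ^+ n.
Proof.
move=> cu uS.
have lim x : exists v : E, forall n, `|v - u n x| <= 2^-1 ^+ n.
  have [|l1 l1P] := @geometric_limit (fun n => (u n x).1).
    by move=> n; have := uS n x; rewrite norm_pair_le => /andP[].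
  have [|l2 l2P] := @geometric_limit (fun n => (u n x).2).
    by move=> n; have := uS n x; rewrite norm_pair_le => /andP[].
  by exists (l1, l2) => n; rewrite norm_pair_le l1P l2P.
have [v vP] := choice lim; exists v => // x.
apply/cvgrPdist_lt => e e0.
have [n ne] : exists n : nat, (2^-1 : R) ^+ n < e / 3.
  by apply: half_pow_lt; rewrite divr_gt0.
have /cvgrPdist_lt /(_ (e / 3)) := cu n x.
move=> /(_ (divr_gt0 e0 (ltr0Sn _ 2))); apply: filterS => y xy.
rewrite (_ : v x - v y = (v x - u n x) + (u n x - u n y) - (v y - u n y)); last first.
  by rewrite opprB addrA subrKA subrK.
apply: (le_lt_trans (ler_normB _ _)); apply: (@lt_le_trans _ _ (e / 3 + e / 3 + e / 3)).
  apply: ler_ltD; last exact: le_lt_trans (vP y n) ne.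
  apply: (le_trans (ler_normD _ _)); apply: lerD; last exact: ltW.
  exact: le_trans (vP x n) (ltW ne).
lra.
Qed.

End geometric_limit.

Lemma countable_enum (T : choiceType) (A : set T) : countable A -> A !=set0 ->
  exists e : nat -> T, forall x, A x <-> exists n, e n = x.
Proof.
move=> /countable_injP[f finj] [a0 Aa0].
have ex n : exists x, A x /\ forall y, A y -> f y = n -> x = y.
  have [[y [Ay yn]]|no] := pselect (exists y, A y /\ f y = n).
    exists y; split=> // z Az zn; apply: finj; rewrite ?inE//.
    by rewrite yn zn.
  by exists a0; split=> // y Ay yn; case: no; exists y.
have [e eP] := choice ex; exists e => x; split=> [Ax|[n <-]].
  by exists (f x); apply: (proj2 (eP (f x))).
exact: (proj1 (eP n)).
Qed.

(** * Small shears that fix finitely many points *)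

Section shears.
Variable R : realType.
Local Notation E := (R * R)%type.
Implicit Types (p q u x y : E).

(** The inverse and its Lipschitz constant are part of the data, so that a small change made after
    [h] moves the inverse by a controlled amount. *)
Definition bilipschitz (h k : E -> E) (l : R) := [/\ 0 <= l, cancel h k,
  cancel k h, forall x y, `|h x - h y| <= l * `|x - y| &
  forall x y, `|k x - k y| <= l * `|x - y|].

Lemma bilipschitz_comp h k l h' k' l' : bilipschitz h k l ->
  bilipschitz h' k' l' -> bilipschitz (h' \o h) (k \o k') (l' * l).
Proof.
move=> [l0 hk kh hl kl] [l0' hk' kh' hl' kl']; split.
- exact: mulr_ge0.
- exact: can_comp.
- exact: can_comp.
- by move=> x y; apply: (le_trans (hl' _ _)); rewrite -mulrA ler_wpM2l.
- move=> x y; apply: (le_trans (kl _ _)); rewrite [l' * l]mulrC -mulrA.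
  by rewrite ler_wpM2l.
Qed.

Lemma bilipschitz_sym h k l : bilipschitz h k l -> bilipschitz k h l.
Proof. by case. Qed.

Lemma lipschitz_continuous (h : E -> E) (l : R) :
  (forall x y, `|h x - h y| <= l * `|x - y|) -> continuous h.
Proof.
move=> hl x; apply/cvgrPdist_lt => e e0.
have l1 : 0 < `|l| + 1 by rewrite ltr_wpDl.
have /cvgrPdist_lt /(_ _ (divr_gt0 e0 l1)) := @continuous_id E x.
apply: filterS => y; rewrite ltr_pdivlMr// => xy; apply: le_lt_trans xy.
apply: (le_trans (hl x y)); rewrite mulrC ler_wpM2l// (le_trans (ler_norm _))//.
by rewrite lerDl.
Qed.

Lemma det_norm p q : `|det p q| <= 2 * `|p| * `|q|.
Proof.
have := lexx `|p|; have := lexx `|q|; rewrite {1}norm_pair_le => /andP[q1 q2].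
rewrite {1}norm_pair_le => /andP[p1 p2]; rewrite /det.
apply: (le_trans (ler_normB _ _)); rewrite !normrM.
have := ler_pM (normr_ge0 _) (normr_ge0 _) p1 q2.
have := ler_pM (normr_ge0 _) (normr_ge0 _) p2 q1.
lra.
Qed.

(** Makes room to choose the direction of a shear at [q]: it must not point along any [c - q]. At a
    bad point [b0], a displacement by [t] times the perpendicular of [c - q] changes the determinant
    by [t] times the squared Euclidean length. *)
Lemma generic_open (T : seq E) (q : E) (O : set E) : q \notin T -> open O ->
  O !=set0 -> exists O' : set E, [/\ open O', O' !=set0, O' `<=` O &
    forall b c, O' b -> c \in T -> det (b - q) (c - q) != 0].
Proof.
elim: T O => [|c T IH] O; first by exists O; split.
rewrite inE negb_or => /andP[qc qT] oO O0.
have [O' [oO' [b0 O'b0] sub gen]] := IH O qT oO O0.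
pose W := [set b : E | det (b - q) (c - q) != 0].
have oW : open W.
  have cd : continuous (fun b : E => det (b - q) (c - q)).
    by rewrite /det /=; continuity.
  rewrite (_ : W = (fun b : E => det (b - q) (c - q)) @^-1` [set r | r != 0]) //.
  apply: open_comp => [x _|]; [exact: cd|exact: open_neq].
exists (O' `&` W); split.
- exact: openI.
- have [Wb0|] := pselect (W b0); first by exists b0.
  move=> /negP; rewrite negbK => /eqP d0.
  have : nbhs b0 O' by exact: open_nbhs_nbhs.
  move=> /nbhs_ballP[e /= e0 eO]; pose d : E := c - q.
  pose t := e / 2 / (`|d| + 1).
  have D1 : 0 < `|d| + 1 by rewrite ltr_wpDl.
  have t0 : 0 < t by rewrite !divr_gt0.
  have td (r : R) : `|r| <= `|d| -> `|t * r| < e.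
    move=> rd; rewrite normrM gtr0_norm// /t mulrAC ltr_pdivrMr//.
    apply: (@le_lt_trans _ _ (e / 2 * `|d|)); first by rewrite ler_wpM2l// divr_ge0// ltW.
    have := normr_ge0 d; nra.
  have := lexx `|d|; rewrite {1}norm_pair_le => /andP[d1 d2].
  exists (b0.1 + t * d.2, b0.2 - t * d.1); split.
    apply: eO; split; rewrite /ball /= opprD addrA subrr sub0r ?normrN ?opprK; exact: td.
  rewrite /W /=; apply/eqP => e1.
  have : t * (d.1 ^+ 2 + d.2 ^+ 2) = 0.
    by move: e1 d0; rewrite /det /d /=; nra.
  move=> /eqP; rewrite mulf_eq0 (gt_eqF t0) /= paddr_eq0 ?sqr_ge0// !sqrf_eq0.
  rewrite /d /= !subr_eq0 => /andP[/eqP c1 /eqP c2]; move: qc.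
  by rewrite [q]surjective_pairing [c]surjective_pairing c1 c2 eqxx.
- by move=> b [/sub].
- move=> b c' [O'b Wb]; rewrite inE => /predU1P[->|c'T]; first exact: Wb.
  exact: gen.
Qed.

(** Points slide along [u] by the factor [psi (om x)]. Since [om] is constant along [u], sliding
    back is the inverse. The factor is 1 at [q], which thus moves to [b], and 0 at the points of
    [T], where [M] has been taken large enough for [om] to be at least 1 in absolute value. *)
Lemma shear (q : E) (T : seq E) (S : set E) (e : R) : q \notin T -> dense S ->
  0 < e -> exists g g' l, [/\ bilipschitz g g' l, S (g q),
    forall c, c \in T -> g c = c, forall x, `|g x - x| <= e &
    forall x, `|g' x - x| <= e].
Proof.
move=> qT dS e0.
have q0 : ball q e !=set0 by exists q; exact: ballxx.
have [O [oO O0 sub gen]] := generic_open qT (ball_open q e) q0.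
have [b [Ob Sb]] := dS _ O0 oO; pose u : E := b - q.
have ue : `|u| <= e.
  by have := sub _ Ob; rewrite -ball_normE /= distrC => /ltW.
have [M M0 MT] : exists2 M : R, 0 <= M & forall c, c \in T -> 1 <= M * `|det u (c - q)|.
  have : forall c, c \in T -> det u (c - q) != 0 by move=> c; exact: gen.
  elim: (T) => [_|c T' IH nz]; first by exists 0.
  have [c' c'T|M M0 MT] := IH; first by apply: nz; rewrite inE c'T orbT.
  have dc : 0 < `|det u (c - q)| by rewrite normr_gt0 nz// inE eqxx.
  exists (M + `|det u (c - q)|^-1); first by rewrite addr_ge0// invr_ge0.
  move=> c'; rewrite inE => /predU1P[->|c'T]; rewrite mulrDl.
    by rewrite mulVf ?gt_eqF// lerDr mulr_ge0.
  by apply: (le_trans (MT _ c'T)); rewrite lerDl mulr_ge0// invr_ge0.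
pose psi (r : R) := Num.max 0 (1 - `|r|).
have psi0 r : 0 <= psi r by rewrite le_max lexx.
have psi1 r : psi r <= 1 by rewrite ge_max ler01 /= lerBlDr lerDl.
have psiL r s : `|psi r - psi s| <= `|r - s|.
  have := ler_dist_dist r s; rewrite /psi ler_norml => /andP[a1 a2].
  rewrite ler_norml; apply/andP.
  by case: (leP 0 (1 - `|r|)) => h1; case: (leP 0 (1 - `|s|)) => h2; split; lra.
pose om x := M * det u (x - q).
have omD x (r : R) : om (x.1 + r * u.1, x.2 + r * u.2) = om x.
  by rewrite /om; congr (M * _); rewrite /det /=; ring.
pose sh (a : R) x : E := (x.1 + a * psi (om x) * u.1, x.2 + a * psi (om x) * u.2).
have shK a : cancel (sh a) (sh (- a)).
  move=> x; rewrite /sh omD /=; case: x => x1 x2 /=; congr pair; ring.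
have she a x : `|a| = 1 -> `|sh a x - x| <= e.
  move=> a1; rewrite norm_pair_le /sh /=.
  move: ue; rewrite norm_pair_le => /andP[u1 u2].
  rewrite ![_ + _ - _]addrAC !subrr !add0r !normrM a1 mul1r ger0_norm//.
  by apply/andP; split; [apply: le_trans u1|apply: le_trans u2]; rewrite ler_piMl.
have shL a x y : `|a| = 1 -> `|sh a x - sh a y| <= (1 + 2 * M * `|u| * `|u|) * `|x - y|.
  move=> a1.
  have dom : `|psi (om x) - psi (om y)| <= M * (2 * `|u| * `|x - y|).
    apply: (le_trans (psiL _ _)); rewrite /om -mulrBr normrM ger0_norm// ler_wpM2l//.
    rewrite (_ : _ - _ = det u (x - y)); last by rewrite /det /=; ring.
    exact: det_norm.
  have := lexx `|u|; rewrite {1}norm_pair_le => /andP[u1 u2].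
  have := lexx `|x - y|; rewrite {1}norm_pair_le => /andP[x1 x2].
  have coord (xx yy uu : R) : `|xx - yy| <= `|x - y| -> `|uu| <= `|u| ->
      `|xx + a * psi (om x) * uu - (yy + a * psi (om y) * uu)| <=
      (1 + 2 * M * `|u| * `|u|) * `|x - y|.
    move=> xy uu1.
    rewrite (_ : _ - _ = (xx - yy) + a * ((psi (om x) - psi (om y)) * uu)); last by ring.
    apply: (le_trans (ler_normD _ _)); rewrite [X in _ <= X]mulrDl [1 * _]mul1r lerD//.
    rewrite !normrM a1 mul1r.
    have := ler_pM (normr_ge0 _) (normr_ge0 _) dom uu1; lra.
  by rewrite norm_pair_le /sh /= !coord.
have det_self : det u u = 0 by rewrite /det mulrC subrr.
exists (sh 1), (sh (-1)), (1 + 2 * M * `|u| * `|u|); split.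
- split.
  + by rewrite addr_ge0// !mulr_ge0.
  + exact: shK.
  + by have := shK (-1); rewrite opprK.
  + by move=> x y; apply: shL; rewrite normr1.
  + by move=> x y; apply: shL; rewrite normrN normr1.
- rewrite (_ : sh 1 q = b)// /sh /om subrr.
  rewrite (_ : det u 0 = 0); last by rewrite /det /= !mulr0 subrr.
  rewrite mulr0 /psi normr0 subr0 max_r// !mul1r /u /=.
  by rewrite !subrKC -surjective_pairing.
- move=> c cT; rewrite /sh (_ : psi _ = 0) ?mulr0 ?mul0r ?addr0 -?surjective_pairing//.
  rewrite /psi max_l// subr_le0 /om normrM ger0_norm//; exact: MT.
- by move=> x; apply: she; rewrite normr1.
- by move=> x; apply: she; rewrite normrN normr1.
Qed.

End shears.

(** * Countable dense homogeneity of the plane, by back and forth *)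

Section countable_dense_homogeneity.
Variable R : realType.
Local Notation E := (R * R)%type.
Local Notation state := ((E -> E) * (E -> E) * seq (E * E))%type.

(* [st.2] lists the pairs (a, b) with [st.1.1 a = b] that are frozen. *)
Definition back_forth_inv (A B : set E) (st : state) :=
  (exists l, bilipschitz st.1.1 st.1.2 l) /\
  forall c, c \in st.2 -> [/\ A c.1, B c.2 & st.1.1 c.1 = c.2].

Definition back_forth_sym (st : state) : state :=
  (st.1.2, st.1.1, [seq (c.2, c.1) | c <- st.2]).

Lemma back_forth_inv_sym A B st : back_forth_inv A B st ->
  back_forth_inv B A (back_forth_sym st).
Proof.
move=> [[l hl] stP]; split; first by exists l; exact: bilipschitz_sym.
move=> _ /mapP[c /stP[Ac Bc e] ->] /=; split=> //.
by have [_ hk _ _ _] := hl; rewrite -e hk.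
Qed.

Definition back_forth_next (e : R) (st st' : state) := [/\ {subset st.2 <= st'.2},
  forall x, `|st'.1.1 x - st.1.1 x| <= e & forall x, `|st'.1.2 x - st.1.2 x| <= e].

(** The pair for [a] is frozen by a shear applied after [h], which fixes the images frozen before.
    Its size is [e / (l + 1)] because the new inverse is [k \o g'] and [k] stretches by at most
    [l]. *)
Lemma forth_step (A B : set E) (st : state) (a : E) (e : R) : dense B ->
  back_forth_inv A B st -> A a -> 0 < e ->
  exists st', [/\ back_forth_inv A B st', back_forth_next e st st' &
    exists b, (a, b) \in st'.2].
Proof.
move: st => [[h k] T] dB [/= [l hl] TP] Aa e0.
have [[b abT]|aT] := pselect (exists b, (a, b) \in T).
  exists (h, k, T); split; [by split; first by exists l| |by exists b].
  by split=> //= x; rewrite subrr normr0 ltW.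
have [l0 hk kh hL kL] := hl.
have qT : h a \notin [seq c.2 | c <- T].
  apply/mapP => -[c cT e1]; have [_ _ e2] := TP c cT; apply: aT.
  exists c.2; rewrite (_ : a = c.1) -?surjective_pairing//.
  by apply: (can_inj hk); rewrite e1 e2.
have l1 : 0 < l + 1 by rewrite ltr_wpDl.
have [g [g' [l' [gl Bb gT ge ge']]]] := shear qT dB (divr_gt0 e0 l1).
have le_e (r : R) : 0 <= r -> r <= e / (l + 1) -> r <= e.
  move=> r0; rewrite ler_pdivlMr// => re; apply: le_trans re.
  by rewrite mulrDr mulr1 lerDr mulr_ge0.
exists (g \o h, k \o g', (a, g (h a)) :: T); split.
- split; first by exists (l' * l); exact: bilipschitz_comp.
  move=> c; rewrite inE => /predU1P[->//|cT]; have [Ac Bc e1] := TP c cT.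
  by split=> //=; rewrite e1 gT//; apply/mapP; exists c.
- split=> [c cT|x|x] /=; first by rewrite inE cT orbT.
    exact: le_e.
  apply: (le_trans (kL _ _)); have := ge' x; rewrite ler_pdivlMr// => ex.
  by apply: le_trans ex; rewrite mulrC ler_wpM2l// lerDl.
- by exists (g (h a)); rewrite inE eqxx.
Qed.

(** The back half is [forth_step] for the inverse state, and each half spends [e / 2]. *)
Lemma back_forth_step (A B : set E) (st : state) (a b : E) (e : R) : dense A ->
  dense B -> back_forth_inv A B st -> A a -> B b -> 0 < e ->
  exists st', [/\ back_forth_inv A B st', back_forth_next e st st',
    exists b', (a, b') \in st'.2 & exists a', (a', b) \in st'.2].
Proof.
move=> dA dB stP Aa Bb e0; have e2 : 0 < e / 2 by rewrite divr_gt0.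
have [st1 [st1P [sub1 n1 n1'] [b' ab']]] := forth_step dB stP Aa e2.
have := forth_step dA (back_forth_inv_sym st1P) Bb e2.
move=> [st2 [st2P [sub2 n2 n2'] [a' a'b]]].
exists (back_forth_sym st2).
have sub12 c : c \in st1.2 -> c \in (back_forth_sym st2).2.
  move=> cT; apply/mapP; exists (c.2, c.1); last by rewrite -surjective_pairing.
  by apply: sub2; apply/mapP; exists c.
have tri (x y z : E) : `|x - y| <= e / 2 -> `|y - z| <= e / 2 -> `|x - z| <= e.
  move=> xy yz; rewrite -(subrKA y) (le_trans (ler_normD _ _))//.
  by rewrite [e]splitr lerD.
split.
- exact: back_forth_inv_sym st2P.
- split=> [c /sub1/sub12//|x|x]; first exact: tri (n2' x) (n1 x).
  exact: tri (n2 x) (n1' x).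
- by exists b'; exact: sub12.
- by exists a'; apply/mapP; exists (b, a').
Qed.

(** The maps and their inverses both converge uniformly, so the limits are inverse to each other,
    and frozen pairs survive in the limit. As every point of [A] and of [B] is frozen at some step,
    [h] matches the two sets. The bound on [k] adds up all the steps; it is what makes the map
    expanding after a rescaling. *)
Theorem plane_countable_dense_homogeneous (A B : set E) :
  countable A -> dense A -> countable B -> dense B ->
  exists h k : E -> E, [/\ continuous h, continuous k, cancel h k, cancel k h &
    (forall x, B (h x) <-> A x) /\ forall x, `|k x - x| <= 1].
Proof.
move=> cA dA cB dB.
have ne (C : set E) : dense C -> C !=set0.
  by move=> dC; have [||x [_ Cx]] := dC setT; [exists 0|exact: openT|exists x].
have [ea eaP] := countable_enum cA (ne A dA).
have [eb ebP] := countable_enum cB (ne B dB).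
have Aea n : A (ea n) by apply/eaP; exists n.
have Beb n : B (eb n) by apply/ebP; exists n.
pose X := {st : state | back_forth_inv A B st}.
have ep n : 0 < (2^-1 : R) ^+ n by rewrite exprn_gt0// invr_gt0.
have step (nst : nat * X) : exists st' : X,
    [/\ back_forth_next (2^-1 ^+ nst.1.+1) (sval nst.2) (sval st'),
        exists b', (ea nst.1, b') \in (sval st').2 &
        exists a', (a', eb nst.1) \in (sval st').2].
  have [st' [st'P nx ab ba]] := back_forth_step dA dB (svalP nst.2)
    (Aea nst.1) (Beb nst.1) (ep nst.1.+1).
  by exists (exist _ st' st'P).
have [next nextP] := choice step.
have st0P : back_forth_inv A B (id, id, [::]).
  by split=> //; exists 1; split=> //= x y; rewrite mul1r.
pose st := fix st (n : nat) : X := if n is m.+1 then next (m, st m)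
  else exist _ _ st0P.
have stS n : [/\ back_forth_next (2^-1 ^+ n.+1) (sval (st n)) (sval (st n.+1)),
        exists b', (ea n, b') \in (sval (st n.+1)).2 &
        exists a', (a', eb n) \in (sval (st n.+1)).2].
  exact: (nextP (n, st n)).
pose u n := (sval (st n)).1.1; pose v n := (sval (st n)).1.2.
have bl n : exists l, bilipschitz (u n) (v n) l by have [] := svalP (st n).
have cu n : continuous (u n).
  by have [l [_ _ _ + _]] := bl n; exact: lipschitz_continuous.
have cv n : continuous (v n).
  by have [l [_ _ _ _]] := bl n; exact: lipschitz_continuous.
have uS n x : `|u n.+1 x - u n x| <= 2^-1 ^+ n.+1.
  by have [[_ + _] _ _] := stS n; exact.
have vS n x : `|v n.+1 x - v n x| <= 2^-1 ^+ n.+1.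
  by have [[_ _ +] _ _] := stS n; exact.
have [h ch hu] := uniform_geometric_limit cu uS.
have [k ck kv] := uniform_geometric_limit cv vS.
have small (x y : E) : (forall n, `|x - y| <= 2^-1 ^+ n) -> x = y.
  move=> xy; apply/eqP; rewrite -subr_eq0 -normr_eq0; apply: contrapT => /negP nz.
  have [|n] := @half_pow_lt R `|x - y|; first by rewrite lt_neqAle eq_sym nz normr_ge0.
  by rewrite ltNge xy.
have inv (f g : E -> E) (f' g' : nat -> E -> E) : continuous f ->
    (forall n x, `|f x - f' n x| <= 2^-1 ^+ n) ->
    (forall n x, `|g x - g' n x| <= 2^-1 ^+ n) ->
    (forall n, cancel (g' n) (f' n)) -> cancel g f.
  move=> cf ff' gg' gf x; apply/eqP; rewrite -subr_eq0 -normr_eq0.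
  apply: contrapT => /negP nz.
  have z0 : 0 < `|f (g x) - x| / 2 by rewrite divr_gt0// lt_neqAle eq_sym nz normr_ge0.
  have /cvgrPdist_lt /(_ _ z0) := cf (g x).
  move=> /nbhs_ballP[d /= d0 db].
  have [n nd] := half_pow_lt d0; have [m mz] := half_pow_lt z0.
  pose N := maxn n m.
  have mono i : (i <= N)%N -> (2^-1 : R) ^+ N <= 2^-1 ^+ i.
    by move=> iN; apply: ler_wiXn2l; rewrite ?invr_ge0// invf_le1//; lra.
  have near1 : `|f (g x) - f (g' N x)| < `|f (g x) - x| / 2.
    apply: db; rewrite -ball_normE /=; apply: le_lt_trans (gg' N x) _.
    by apply: le_lt_trans nd; apply: mono; exact: leq_maxl.
  have near2 : `|f (g' N x) - x| < `|f (g x) - x| / 2.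
    rewrite -{2}(gf N x); apply: le_lt_trans (ff' N _) _.
    by apply: le_lt_trans mz; apply: mono; exact: leq_maxr.
  have : `|f (g x) - x| < `|f (g x) - x|.
    rewrite -{1}(subrKA (f (g' N x))) (le_lt_trans (ler_normD _ _))//.
    by rewrite [X in _ < X]splitr ltrD.
  by rewrite ltxx.
have hk : cancel h k.
  by apply: (inv k h v u) => // n; have [l [_ + _ _ _]] := bl n.
have kh : cancel k h.
  by apply: (inv h k u v) => // n; have [l [_ _ + _ _]] := bl n.
have frozen n c : c \in (sval (st n)).2 -> [/\ A c.1, B c.2 & h c.1 = c.2].
  move=> cn; have [_ /(_ c cn)[Ac Bc _]] := svalP (st n); split=> //.
  apply: small => m.
  have cnm : c \in (sval (st (n + m)%N)).2.
    elim: m => [|m IH]; first by rewrite addn0.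
    by rewrite addnS; have [[sub _ _] _ _] := stS (n + m)%N; exact: sub.
  have [_ /(_ c cnm)[_ _ e]] := svalP (st (n + m)%N).
  rewrite -{1}e; apply: le_trans (hu (n + m)%N c.1) _.
  by apply: ler_wiXn2l; rewrite ?leq_addl ?invr_ge0// invf_le1//; lra.
exists h, k; split=> //; split=> x; last by have := kv 0%N x; rewrite expr0.
split=> [/ebP[n bE]|/eaP[n <-]].
  have [_ _ [a' aT]] := stS n; have [Aa _ /= e] := frozen _ _ aT.
  by rewrite (_ : x = a') //; apply: (can_inj hk); rewrite e.
have [_ [b' bT] _] := stS n; have [_ Bb /= e] := frozen _ _ bT.
by rewrite e.
Qed.

End countable_dense_homogeneity.

(** * The swallowing map *)

Lemma open_subtype_continuous_at (T Y : topologicalType) (O : set T)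
    (F : T -> Y) (x : T) : open O -> O x ->
  continuous (fun y : set_type O => F (set_val y)) -> {for x, continuous F}.
Proof.
move=> oO Ox cF W; have xE : set_val (SigSub (mem_set Ox) : set_type O) = x.
  by rewrite set_valE.
rewrite -{1}xE => /cF[_ [[G oG <-] /=]]; rewrite xE => Gx GW.
have : nbhs x (G `&` O) by apply: open_nbhs_nbhs; split=> //; exact: openI.
apply: filterS => z [Gz Oz]; have := GW (SigSub (mem_set Oz)).
by rewrite /= set_valE; exact.
Qed.

(** * The l1 norm *)

Section l1_norm.
Variable R : realType.
Local Notation E := (R * R)%type.
Implicit Types p : E.

Definition l1 p : R := `|p.1| + `|p.2|.

Lemma l1_ge0 p : 0 <= l1 p.
Proof. by rewrite addr_ge0. Qed.

Lemma l1_scale (r : R) p : 0 <= r -> l1 (r * p.1, r * p.2) = r * l1 p.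
Proof. by move=> r0; rewrite /l1 /= !normrM ger0_norm// mulrDr. Qed.

Lemma l1_continuous (X : topologicalType) (f : X -> E) : continuous f ->
  continuous (fun x => l1 (f x)).
Proof. by move=> cf; rewrite /l1; continuity. Qed.

Lemma l1_convex (r : R) : seg_convex [set p | l1 p <= r].
Proof.
move=> p q t /andP[t0 t1] /= pr qr; rewrite /seg /l1 /=.
have co (x y : R) : `|x + t * (y - x)| <= (1 - t) * `|x| + t * `|y|.
  rewrite (_ : x + t * (y - x) = (1 - t) * x + t * y); last by ring.
  apply: (le_trans (ler_normD _ _)).
  by rewrite !normrM (ger0_norm t0) (@ger0_norm _ (1 - t)) ?lexx// subr_ge0.
apply: (le_trans (lerD (co _ _) (co _ _))).
apply: (@le_trans _ _ ((1 - t) * l1 p + t * l1 q)); first by rewrite /l1; lra.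
have : (1 - t) * l1 p <= (1 - t) * r by rewrite ler_wpM2l//; lra.
have : t * l1 q <= t * r by rewrite ler_wpM2l.
lra.
Qed.

Lemma l1_generic (B : set E) (a b : R) : countable B -> a < b ->
  exists2 w, a < w < b & forall p, B p -> l1 p != 1 - w /\ l1 p != 1 + w.
Proof.
move=> cB ab.
have [|//|w wab] := @countable_avoid R
    ((fun p => 1 - l1 p) @` B `|` (fun p => l1 p - 1) @` B) a b.
  by apply: countableU; exact: countable_image.
move=> /not_orP[n1 n2]; exists w => // p Bp; split; apply/eqP => e.
  by apply: n1; exists p => //; lra.
by apply: n2; exists p => //; lra.
Qed.

End l1_norm.

(** * A map of the punctured annulus *)

Section annulus_map.
Variable R : realType.
Local Notation E := (R * R)%type.
Local Notation I := (unit_interval R).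
Variables (w : R) (h : E -> E) (kap : R -> E).
Hypotheses (w1 : 2^-1 < w) (w2 : w < 3 / 4).
Hypotheses (ch : continuous h) (ck : continuous kap).
Hypotheses (kap0 : kap 0 = (1 + w, 0)) (kap1 : kap 1 = h (1 - w, 0)).
Implicit Types p : E.

(* In the coordinates [angle] (normalized to [0, 1], vanishing on the negative
   axis) and [height], the annulus is the rectangle [0, 1] * [-1, 1], doubled
   along its edge [angle = 0]; dividing by [gauge] is the radial projection of
   the rectangle minus the origin onto its three other edges. *)
Definition angle p : R := (1 + p.1 / l1 p) / 2.
Definition height p : R := (l1 p - 1) / w.
Definition gauge p : R := Num.min 1 (Num.max `|height p| (angle p)).

(** The point of the unit diamond with normalized angle [t], on the upper or lower half according to
    the sign [s]. *)
Definition diamond (s t : R) : E := (2 * t - 1, s * (2 * Num.min t (1 - t))).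

Definition direction p : E :=
  if p.2 <= 0 then diamond (-1) (angle p / gauge p)
  else diamond 1 (angle p / gauge p).

(** For [height p <= 0] the test decides whether the radial projection lands on the edge
    [height = -1], the inner boundary; otherwise it lands on the edge [angle = 1], the segment of
    the positive axis that is sent along [kap]. *)
Definition annulus_in p : E :=
  if angle p + height p <= 0
  then h ((1 - w) * (direction p).1, (1 - w) * (direction p).2)
  else kap ((1 - height p / gauge p) / 2).

Definition annulus_out p : E :=
  if angle p - height p <= 0
  then ((1 + w) * (direction p).1, (1 + w) * (direction p).2)
  else kap ((1 - height p / gauge p) / 2).

Definition annulus_mid p : E :=
  if height p <= 0 then annulus_in p else annulus_out p.

Definition annulus_map p : E :=
  if l1 p <= 1 - w then h p else if l1 p <= 1 + w then annulus_mid p else p.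

Lemma angle_itv p : 0 <= angle p <= 1.
Proof.
suff : `|p.1 / l1 p| <= 1 by rewrite ler_norml /angle; lra.
rewrite normrM normfV (ger0_norm (l1_ge0 p)).
have [->|n0] := eqVneq (l1 p) 0; first by rewrite invr0 mulr0.
by rewrite ler_pdivrMr ?lt_neqAle 1?eq_sym ?n0 ?l1_ge0// mul1r /l1 lerDl.
Qed.

Lemma angle0 p : 0 < l1 p -> angle p = 0 -> p = (- l1 p, 0).
Proof.
move=> p0; rewrite /angle => a0; have : p.1 / l1 p = -1 by lra.
move=> /(congr1 (fun r => r * l1 p)); rewrite divfK ?gt_eqF// mulN1r => e.
rewrite [LHS]surjective_pairing e; congr pair; move: e p0; rewrite /l1.
have := normr_ge0 p.2; have [p1|p1] := leP 0 p.1.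
  by rewrite (ger0_norm p1); lra.
by rewrite (ltr0_norm p1) => _ e _; apply/eqP; rewrite -normr_eq0; apply/eqP; lra.
Qed.

Let w_gt0 : 0 < w. Proof. by move: w1; lra. Qed.

Lemma gauge_gt0 p : 0 < l1 p -> p <> (-1, 0) -> 0 < gauge p.
Proof.
move=> p0 pa; rewrite /gauge lt_min ltr01 lt_max normr_gt0.
have /andP[a0 _] := angle_itv p; have [h0|//] := eqVneq (height p) 0.
rewrite /= lt_neqAle a0 andbT eq_sym; apply/eqP => /(angle0 p0) pE; apply: pa.
rewrite pE; congr (_, _); congr (- _).
move: h0 => /(congr1 (fun r => r * w)); rewrite /height divfK ?gt_eqF// mul0r; lra.
Qed.

Lemma l1_diamond s t : `|s| = 1 -> 0 <= t <= 1 -> l1 (diamond s t) = 1.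
Proof.
move=> s1 t01; rewrite /l1 /= normrM s1 mul1r.
have [t2|t2] := leP t (1 - t).
  by rewrite (@ler0_norm _ (_ - 1)) ?(@ger0_norm _ (2 * t)); lra.
by rewrite (@ger0_norm _ (_ - 1)) ?(@ger0_norm _ (2 * _)); lra.
Qed.

Lemma direction_l1 p : angle p <= gauge p -> l1 (direction p) = 1.
Proof.
move=> ag; have /andP[a0 _] := angle_itv p.
have : 0 <= angle p / gauge p <= 1.
  rewrite divr_ge0 ?(le_trans a0)//=.
  (* This happens at the puncture, where division by 0 returns 0; the value of the map there is
     still on a boundary circle or its image. *)
  have [->|g0] := eqVneq (gauge p) 0; first by rewrite invr0 mulr0.
  by rewrite ler_pdivrMr ?mul1r// lt_neqAle eq_sym g0 (le_trans a0).
by move=> /l1_diamond d; rewrite /direction; case: ifP => _; rewrite d ?normrN ?normr1.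
Qed.

(** Where the gauge is 1 nothing is projected; on the two boundary circles the map therefore glues
    with [h] and with the identity. *)
Lemma direction_id p : 0 < l1 p -> gauge p = 1 ->
  (l1 p * (direction p).1, l1 p * (direction p).2) = p.
Proof.
move=> p0 g1; rewrite /direction g1 divr1.
have n0 : l1 p != 0 by rewrite gt_eqF.
have e1 : l1 p * (2 * angle p - 1) = p.1 by rewrite /angle; field.
have e2 : l1 p * (2 * Num.min (angle p) (1 - angle p)) = `|p.2|.
  have : l1 p * (2 * angle p) = l1 p + p.1 by rewrite /angle; field.
  have : l1 p * (2 * (1 - angle p)) = l1 p - p.1 by rewrite /angle; field.
  have l1E : l1 p = `|p.1| + `|p.2| by [].
  have [a1|a1] := leP (angle p) (1 - angle p) => f1 f2.
    have : p.1 <= 0 by nra.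
    by move=> /ler0_norm; lra.
  have : 0 <= p.1 by nra.
  by move=> /ger0_norm; lra.
rewrite [RHS]surjective_pairing.
case: ifPn => [p2|]; rewrite /= ?mulN1r ?mul1r ?mulrN e1 e2.
  by rewrite ler0_norm// opprK.
by rewrite -ltNge => /ltW/ger0_norm ->.
Qed.

Lemma gauge1 p : 1 <= `|height p| -> gauge p = 1.
Proof. by move=> h1; rewrite /gauge min_l// le_max h1. Qed.

Lemma height_lo p : l1 p = 1 - w -> height p = -1.
Proof. by move=> e; rewrite /height e; field; rewrite gt_eqF. Qed.

Lemma height_hi p : l1 p = 1 + w -> height p = 1.
Proof. by move=> e; rewrite /height e; field; rewrite gt_eqF. Qed.

Lemma annulus_mid_lo p : l1 p = 1 - w -> annulus_mid p = h p.
Proof.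
move=> e; have hp := height_lo e; have /andP[a0 a1] := angle_itv p.
have g1 : gauge p = 1 by apply: gauge1; rewrite hp normrN normr1.
rewrite /annulus_mid /annulus_in hp ifT; last by lra.
rewrite ifT; last by lra.
by rewrite -e direction_id// e; move: w2; lra.
Qed.

Lemma annulus_mid_hi p : l1 p = 1 + w -> annulus_mid p = p.
Proof.
move=> e; have hp := height_hi e; have /andP[a0 a1] := angle_itv p.
have g1 : gauge p = 1 by apply: gauge1; rewrite hp normr1.
rewrite /annulus_mid /annulus_out hp ifF; last by apply/negbTE; rewrite -ltNge.
rewrite ifT; last by lra.
by rewrite -e direction_id// e; move: w_gt0; lra.
Qed.

(** The angle needs a positive distance from the origin. As [1 - w] exceeds 1/4, this open set
    contains the closed annulus without its puncture. *)
Let O := [set p : E | p <> (-1, 0) /\ 4^-1 < l1 p].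

Let O_open : open O.
Proof.
rewrite (_ : O = ~` [set (-1, 0)] `&` ((fun p => l1 p) @^-1` [set r | r > 4^-1])).
  apply: openI.
    rewrite openC; apply: accessible_closed_set1; apply: hausdorff_accessible.
    exact: norm_hausdorff.
  apply: open_comp; last exact: open_gt.
  by move=> p _; apply: (@l1_continuous R E id); exact: continuous_id.
by apply/seteqP; split.
Qed.

Let v : set_type O -> E := set_val.
Let cv : continuous v. Proof. exact: set_val_continuous. Qed.
Let vO x : v x <> (-1, 0) /\ 4^-1 < l1 (v x). Proof. exact: (set_valP x). Qed.
Let v0 x : 0 < l1 (v x).
Proof. by have [_] := vO x; apply: lt_trans; rewrite invr_gt0. Qed.
Let cl : continuous (fun x => l1 (v x)). Proof. exact: l1_continuous. Qed.
Let cheight : continuous (fun x => height (v x)).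
Proof. by rewrite /height; continuity. Qed.
Let cangle : continuous (fun x => angle (v x)).
Proof.
have ci : continuous (fun x => (l1 (v x))^-1).
  by apply: continuousV => // x; rewrite gt_eqF.
by rewrite /angle; continuity.
Qed.
Let cgauge : continuous (fun x => gauge (v x)).
Proof. by rewrite /gauge; continuity. Qed.
Let g0 x : 0 < gauge (v x).
Proof. by apply: gauge_gt0 => //; have [] := vO x. Qed.
Let cgaugeV : continuous (fun x => (gauge (v x))^-1).
Proof. by apply: continuousV => // x; rewrite gt_eqF. Qed.

(** The two halves of the diamond meet over the horizontal axis, where the projected angle is 0 or 1
    and both signs give the same point. *)
Let cdirection : continuous (fun x => direction (v x)).
Proof.
rewrite /direction; apply: paste_continuous.
- by continuity.
- by rewrite /diamond; continuity.
- by rewrite /diamond; continuity.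
move=> x e; have l1E : l1 (v x) = `|(v x).1| by rewrite /l1 e normr0 addr0.
have n0 := v0 x; rewrite l1E normr_gt0 in n0.
suff m0 : Num.min (angle (v x) / gauge (v x)) (1 - angle (v x) / gauge (v x)) = 0.
  by rewrite /diamond m0 !mulr0.
have [p1|p1] := leP 0 (v x).1.
  have a1 : angle (v x) = 1.
    by rewrite /angle l1E ger0_norm// divff//; lra.
  have -> : gauge (v x) = 1 by rewrite /gauge a1 min_l// le_max lexx orbT.
  by rewrite a1 divr1 subrr min_r.
have a0 : angle (v x) = 0.
  by rewrite /angle l1E ltr0_norm// invrN mulrN divff// subrr mul0r.
by rewrite a0 mul0r subr0 min_l.
Qed.

Let gauge_eq x : `|height (v x)| = angle (v x) -> gauge (v x) = angle (v x).
Proof.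
move=> e; rewrite /gauge e maxxx min_r//; by have /andP[] := angle_itv (v x).
Qed.

Let cparam : continuous (fun x => kap ((1 - height (v x) / gauge (v x)) / 2)).
Proof. by apply: (comp_continuous _ ck); continuity. Qed.

Let cannulus_in : continuous (fun x => annulus_in (v x)).
Proof.
rewrite /annulus_in; apply: paste_continuous.
- by continuity.
- by apply: (comp_continuous _ ch); continuity.
- exact: cparam.
move=> x e; have /andP[a0 a1] := angle_itv (v x); have gg := g0 x.
have gE : gauge (v x) = angle (v x) by apply: gauge_eq; rewrite ler0_norm; lra.
have hE : height (v x) = - angle (v x) by lra.
rewrite /direction gE hE mulNr divff -?gE ?gt_eqF// opprK.
rewrite (_ : (1 + 1) / 2 = 1) ?kap1; last by lra.
rewrite (_ : 1 - w = (1 - w) * 1) ?mulr1//.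
by case: ifP => _; rewrite /diamond /= subrr min_r// !mulr0; congr (h (_, _)); lra.
Qed.

Let cannulus_out : continuous (fun x => annulus_out (v x)).
Proof.
rewrite /annulus_out; apply: paste_continuous.
- by continuity.
- by continuity.
- exact: cparam.
move=> x e; have /andP[a0 a1] := angle_itv (v x); have gg := g0 x.
have gE : gauge (v x) = angle (v x) by apply: gauge_eq; rewrite ger0_norm; lra.
have hE : height (v x) = angle (v x) by lra.
rewrite /direction gE hE divff -?gE ?gt_eqF// subrr mul0r kap0.
by case: ifP => _; rewrite /diamond /= subrr min_r// !mulr0; congr pair; lra.
Qed.

(** At height 0 away from the puncture the angle is positive, so the inner and outer formulas both
    take the value of [kap] at 1/2. *)
Let cannulus_mid : continuous (fun x => annulus_mid (v x)).
Proof.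
apply: paste_continuous => // x hx.
have /andP[a0 _] := angle_itv (v x).
have a1 : 0 < angle (v x).
  have := g0 x; rewrite /gauge hx normr0 lt_min => /andP[_].
  by rewrite lt_max ltxx.
by rewrite /annulus_in /annulus_out hx addr0 subr0 leNgt a1.
Qed.

Lemma annulus_map_continuous p : p <> (-1, 0) -> {for p, continuous annulus_map}.
Proof.
move=> pa; have [p1|p1] := ltP (l1 p) (1 - w).
  have cl1 : continuous (fun q : E => l1 q).
    by apply: (@l1_continuous R E id); exact: continuous_id.
  have nearE : \forall q \near p, h q = annulus_map q.
    have : \forall q \near p, l1 q < 1 - w by exact: (cvgr_lt _ (cl1 p)).
    by apply: filterS => q q1; rewrite /annulus_map ltW.
  have hE : h p = annulus_map p := nbhs_singleton nearE.
  have := @ch p; rewrite /continuous_at hE => c.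
  by apply: cvg_trans c; exact: (near_eq_cvg nearE).
apply: (open_subtype_continuous_at O_open).
  by split=> //; move: w2 p1; lra.
rewrite /annulus_map; apply: paste_continuous => //.
- exact: (comp_continuous cv ch).
- apply: paste_continuous => // x e; exact: annulus_mid_hi.
- move=> x e; rewrite ifT ?annulus_mid_lo// e; move: w_gt0; lra.
Qed.

Lemma annulus_map_outside p : 1 + w <= l1 p -> annulus_map p = p.
Proof.
move=> p1; rewrite /annulus_map ifF; last first.
  by apply/negbTE; rewrite -ltNge; move: w_gt0; lra.
case: ifPn => // p2; apply: annulus_mid_hi; lra.
Qed.

Lemma annulus_map_inside p : l1 p <= 1 - w -> annulus_map p = h p.
Proof. by move=> p1; rewrite /annulus_map p1. Qed.

(** The values lie on the outer circle, on the image of the inner circle under [h], or on [kap], all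
    free of [B]. This includes the values at points of [B], which is why loops around such points
    are killed. *)
Lemma annulus_map_avoid (B : set E) p :
  (forall q, B q -> l1 q != 1 - w /\ l1 q != 1 + w) ->
  (forall q, B (h q) <-> B q) -> (forall r, ~ B (kap r)) ->
  1 - w <= l1 p <= 1 + w -> ~ B (annulus_map p).
Proof.
move=> Bl Bh Bk /andP[p1 p2]; rewrite /annulus_map p2.
case: ifPn => p3.
  by move=> /Bh/Bl[/eqP + _]; apply; lra.
have hp : `|height p| <= 1.
  rewrite /height normrM normfV (gtr0_norm w_gt0) ler_pdivrMr// mul1r ler_norml; lra.
have dir : angle p <= `|height p| -> l1 (direction p) = 1.
  move=> ah; apply: direction_l1; rewrite /gauge (max_l ah) min_r//.
have bnd (r : R) : 0 <= r -> angle p <= `|height p| ->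
    l1 (r * (direction p).1, r * (direction p).2) = r.
  by move=> r0 ah; rewrite l1_scale// dir// mulr1.
rewrite /annulus_mid; case: ifPn => h0.
  rewrite /annulus_in; case: ifPn => // c Bx.
  have ah : angle p <= `|height p| by rewrite ler0_norm//; lra.
  by have [/eqP + _] := Bl _ (proj1 (Bh _) Bx); rewrite bnd//; move: w2; lra.
rewrite /annulus_out; case: ifPn => // c Bx.
have ah : angle p <= `|height p| by rewrite ger0_norm; lra.
by have [_ /eqP] := Bl _ Bx; rewrite bnd//; move: w_gt0; lra.
Qed.

Lemma annulus_map_ray (t : R) : 0 <= t <= 1 ->
  annulus_map (1 + w - 2 * w * t, 0) = kap t.
Proof.
move=> t01; set p := (_, _).
have wt : 0 <= w * t <= w by move: w_gt0; nra.
have p0 : 0 < p.1 by rewrite /p /=; move: w2; lra.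
have l1E : l1 p = p.1 by rewrite /l1 /= normr0 addr0 gtr0_norm.
have a1 : angle p = 1 by rewrite /angle l1E divff ?gt_eqF//; lra.
have gE : gauge p = 1 by rewrite /gauge a1 min_l// le_max lexx orbT.
have hE : height p = 1 - 2 * t.
  by rewrite /height l1E /p /=; field; rewrite gt_eqF.
have kE : (1 - height p / gauge p) / 2 = t by rewrite gE hE; lra.
have [t1|t1] := eqVneq t 1.
  rewrite annulus_map_inside; last by rewrite l1E /p /= t1; lra.
  by rewrite t1 kap1 /p t1; congr (h (_, _)); lra.
have [t0|t0] := eqVneq t 0.
  rewrite annulus_map_outside; last by rewrite l1E /p /= t0; lra.
  by rewrite t0 kap0 /p t0; congr (_, _); lra.
have t0' : 0 < t by rewrite lt_neqAle eq_sym t0; case/andP: t01.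
have t1' : t < 1 by rewrite lt_neqAle t1; case/andP: t01.
have wt' : w * t < w by rewrite gtr_pMr.
have wt0 : 0 < w * t by rewrite mulr_gt0.
rewrite /annulus_map ifF; last by apply/negbTE; rewrite -ltNge l1E /p /=; lra.
rewrite ifT; last by rewrite l1E /p /=; lra.
rewrite /annulus_mid /annulus_in /annulus_out kE a1 hE.
by case: ifP => _; rewrite ifF//; apply/negbTE; rewrite -ltNge; lra.
Qed.

End annulus_map.

(** * Paths in a shell, and the swallowing map of the plane *)

Section shell.
Variable R : realType.
Local Notation E := (R * R)%type.

(* The shell is the union of four convex trapezoids, consecutive ones
   overlapping around the four half-axes. *)
Lemma shell_path (B : set E) (r : R) (p : E) : countable B -> 1 < r -> r < 2 ->
  ~ B p -> r <= l1 p < 4 -> ~ B (r, 0) ->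
  exists w : pathI R p (r, 0), forall t, ~ B (w t) /\ r <= l1 (w t) < 4.
Proof.
move=> cB r1 r2 Bp /andP[pr p4] Br0.
pose C (s s' : R) := [set q : E | r <= s * q.1 + s' * q.2 /\ l1 q < 4].
have l1_lt (q q' : E) (t : R) : 0 <= t <= 1 -> l1 q < 4 -> l1 q' < 4 -> l1 (seg q q' t) < 4.
  move=> t01 q4 q4'; apply: (@le_lt_trans _ _ (Num.max (l1 q) (l1 q'))).
    by apply: l1_convex => //=; rewrite le_max lexx ?orbT.
  by rewrite gt_max q4.
have convC s s' : seg_convex (C s s').
  move=> q q' t t01 [q1 q2] [q1' q2']; split; last exact: l1_lt.
  have /andP[t0 t1] := t01; rewrite /seg /=.
  have : 0 <= t * (s * q'.1 + s' * q'.2 - r) by rewrite mulr_ge0// subr_ge0.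
  have : 0 <= (1 - t) * (s * q.1 + s' * q.2 - r) by rewrite mulr_ge0// subr_ge0.
  by lra.
have sgn (s x : R) : s = 1 \/ s = -1 -> s * x <= `|x|.
  by case=> ->; rewrite ?mul1r ?mulN1r ?ler_norm// -normrN ler_norm.
have Cshell s s' q : s = 1 \/ s = -1 -> s' = 1 \/ s' = -1 -> C s s' q -> r <= l1 q < 4.
  move=> s1 s1' [qr q4]; rewrite q4 andbT (le_trans qr)// /l1.
  by apply: lerD; exact: sgn.
have path s s' q q' : s = 1 \/ s = -1 -> s' = 1 \/ s' = -1 ->
    ~ B q -> ~ B q' -> C s s' q -> C s s' q' ->
    exists w : pathI R q q', forall t, ~ B (w t) /\ r <= l1 (w t) < 4.
  move=> s1 s1' Bq Bq' Cq Cq'.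
  have [w wP] : exists w : pathI R q q', forall t, ~ B (w t) /\ C s s' (w t).
    have sx (c x : R) : c = 1 \/ c = -1 -> c * (c * x) = x.
      by case=> ->; lra.
    have l1s (x y : R) : 0 <= x -> 0 <= y -> l1 (s * x, s' * y) = x + y.
      move=> x0 y0; rewrite /l1 /= !normrM (ger0_norm x0) (ger0_norm y0).
      by case: s1 => ->; case: s1' => ->; rewrite ?normrN !normr1 !mul1r.
    case: s1 => sE.
      apply: (convex_path (C := C s s') (a := 3 / 2) (b := 8 / 5)
        (y0 := s' * (8 / 5)) (y1 := s' * (17 / 10))) => //.
      - lra.
      - by case: s1' => ->; apply/eqP; lra.
      move=> c c12; rewrite /C /= !sx// sE !mul1r.
      have := l1s c (8 / 5); have := l1s c (17 / 10); rewrite sE !mul1r => -> ; [|lra..].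
      by move=> ->; lra.
    apply: (convex_path (C := C s s') (a := - (8 / 5)) (b := - (3 / 2))
        (y0 := s' * (8 / 5)) (y1 := s' * (17 / 10))) => //.
    - lra.
    - by case: s1' => ->; apply/eqP; lra.
    move=> c c12; rewrite /C /= !sx// sE !mulN1r.
    have := l1s (- c) (8 / 5); have := l1s (- c) (17 / 10).
    rewrite sE !mulN1r opprK => -> ; [|lra..].
    by move=> ->; lra.
  by exists w => t; have [? ?] := wP t; split=> //; exact: (Cshell s s').
have comp q q' q'' : (exists w : pathI R q q', forall t, ~ B (w t) /\ r <= l1 (w t) < 4) ->
    (exists w : pathI R q' q'', forall t, ~ B (w t) /\ r <= l1 (w t) < 4) ->
    exists w : pathI R q q'', forall t, ~ B (w t) /\ r <= l1 (w t) < 4.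
  move=> [w1 w1P] [w2 w2P]; exists (w1 ** w2) => t.
  by rewrite /= /mk_path /path_concat_fun; case: ifP.
have p1 : (1 : R) = 1 \/ (1 : R) = -1 by left.
have m1 : (-1 : R) = 1 \/ (-1 : R) = -1 by right.
have right_half s' q : s' = 1 \/ s' = -1 -> ~ B q -> C 1 s' q ->
    exists w : pathI R q (r, 0), forall t, ~ B (w t) /\ r <= l1 (w t) < 4.
  move=> s1' Bq Cq; apply: (path 1 s') => //.
  by rewrite /C /l1 /= mulr0 normr0 !addr0 mul1r gtr0_norm; [split|]; lra.
(* A point of the left half reaches the upper right trapezoid through the
   overlap above the origin. *)
have [m [Bm Cm Cm']] : exists m, [/\ ~ B m, C 1 1 m & C (-1) 1 m].
  have [||y y12 By] := @countable_avoid R ((fun q => q.2) @` B) 2 3.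
  - exact: countable_image.
  - lra.
  exists (0, y); split; first by move=> Bm; apply: By; exists (0, y).
    by rewrite /C /l1 /= normr0 gtr0_norm; [split|]; lra.
  by rewrite /C /l1 /= normr0 gtr0_norm; [split|]; lra.
have upper_left q : ~ B q -> C (-1) 1 q ->
    exists w : pathI R q (r, 0), forall t, ~ B (w t) /\ r <= l1 (w t) < 4.
  move=> Bq Cq; apply: (comp _ m); first exact: (path (-1) 1).
  exact: (right_half 1).
have [n [Bn Cn Cn']] : exists n, [/\ ~ B n, C (-1) 1 n & C (-1) (-1) n].
  have [||x x12 Bx] := @countable_avoid R ((fun q => - q.1) @` B) 2 3.
  - exact: countable_image.
  - lra.
  exists (- x, 0); split; first by move=> Bx0; apply: Bx; exists (- x, 0); rewrite //= opprK.
    by rewrite /C /l1 /= normr0 normrN gtr0_norm; [split|]; lra.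
  by rewrite /C /l1 /= normr0 normrN gtr0_norm; [split|]; lra.
have Cp s s' : s * p.1 = `|p.1| -> s' * p.2 = `|p.2| -> C s s' p.
  by move=> e1 e2; split=> //; rewrite e1 e2.
have [x0|x0] := leP 0 p.1; have [y0|y0] := leP 0 p.2.
- by apply: (right_half 1) => //; apply: Cp; rewrite mul1r ger0_norm.
- by apply: (right_half (-1)) => //; apply: Cp;
    [rewrite mul1r ger0_norm|rewrite mulN1r ltr0_norm].
- by apply: upper_left => //; apply: Cp;
    [rewrite mulN1r ltr0_norm|rewrite mul1r ger0_norm].
- apply: (comp _ n); last exact: upper_left.
  by apply: (path (-1) (-1)) => //; apply: Cp; rewrite mulN1r ltr0_norm.
Qed.

(** Homogeneity is applied to [B] and its enlargement by 24, so that the rescaled map preserves [B].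
    The inverse [k0] moves each coordinate by at most 1, hence sends the diamond of radius 4 into
    that of radius 6; dividing by 24 brings it inside radius 1/4, which is less than [1 - w]. *)
Lemma swallowing_map (B : set E) : countable B -> dense B -> B (-1, 0) ->
  (forall x : R, 0 < x -> ~ B (x, 0)) ->
  exists (w : R) (h k F : E -> E) (xi : pathI R (1 - w, 0) (k (1 + w, 0))),
  [/\ 2^-1 < w < 3 / 4,
      [/\ continuous k, cancel k h, forall p, B (h p) <-> B p &
          forall p, l1 p < 4 -> l1 (k p) < 1 - w],
      forall t, ~ B (xi t) /\ l1 (xi t) <= 1 - w &
      [/\ forall p, p <> (-1, 0) -> {for p, continuous F},
          forall p, 1 + w <= l1 p -> F p = p,
          forall p, l1 p <= 1 - w -> F p = h p,
          forall p, 1 - w <= l1 p <= 1 + w -> ~ B (F p) &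
          forall t : unit_interval R, F (1 + w - 2 * w * unit_val t, 0) =
            h (xi (clamp (1 - unit_val t)))]].
Proof.
move=> cB dB Ba Bx.
have half34 : (2^-1 : R) < 3 / 4 by lra.
have [w /andP[w1 w2] wB] := l1_generic cB half34.
pose D := [set p : E | B (p.1 / 24, p.2 / 24)].
have cD : countable D.
  have : countable ((fun p : E => (24 * p.1, 24 * p.2)) @` B) by exact: countable_image.
  apply: sub_countable; apply: subset_card_le => p Dp.
  by exists (p.1 / 24, p.2 / 24) => //=; rewrite [RHS]surjective_pairing; congr pair; field.
have dD : dense D.
  move=> O [q Oq] oO; pose sc (p : E) : E := (24 * p.1, 24 * p.2).
  have csc : continuous sc by rewrite /sc; continuity.
  have [||p [Op Bp]] := dB (sc @^-1` O).
  - exists (q.1 / 24, q.2 / 24); rewrite /sc /= (_ : (_, _) = q)//.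
    by rewrite [RHS]surjective_pairing; congr pair; field.
  - by apply: open_comp => // x _; exact: csc.
  exists (sc p); split=> //; rewrite /D /sc /= (_ : (_, _) = p)//.
  by rewrite [RHS]surjective_pairing; congr pair; field.
have [h0 [k0 [ch0 ck0 hk0 kh0 [hD k01]]]] :=
  plane_countable_dense_homogeneous cD dD cB dB.
pose h p := h0 (24 * p.1, 24 * p.2).
pose k p : E := ((k0 p).1 / 24, (k0 p).2 / 24).
have ch : continuous h by apply: (comp_continuous _ ch0); continuity.
have ck : continuous k by rewrite /k; continuity.
have kh : cancel k h.
  move=> p; rewrite /h /k /= -[RHS]kh0; congr h0.
  by rewrite [RHS]surjective_pairing; congr pair; field.
have Bh p : B (h p) <-> B p.
  rewrite hD /D /= (_ : (_, _) = p)//.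
  by rewrite [RHS]surjective_pairing; congr pair; field.
have kin p : l1 p < 4 -> l1 (k p) < 1 - w.
  move=> p4; rewrite /l1 /k /= !normrM normfV (@ger0_norm _ 24)//.
  have := k01 p; rewrite norm_pair_le => /andP[/= e1 e2].
  have := ler_normD ((k0 p).1 - p.1) p.1; have := ler_normD ((k0 p).2 - p.2) p.2.
  by move: p4; rewrite /l1 !subrK; lra.
pose r := 1 + w; pose c := (1 - w) / 2.
have Br0 : ~ B (r, 0) by apply: Bx; rewrite /r; lra.
have l1r (x : R) : 0 <= x -> l1 (x, 0) = x by move=> x0; rewrite /l1 /= normr0 addr0 ger0_norm.
have c0 : 0 < c by rewrite /c; lra.
(* The path [xi] stays in the inner diamond, where [F] will be [h]. With [kap] defined as [h] along
   the reverse of [xi], the images of the segment and of [xi] cancel. *)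
have [|||||||xi xiP] := convex_path (p := (1 - w, 0)) (q := k (1 + w, 0)) (a := 0)
  (b := c) (y0 := 0) (y1 := c / 2) cB _ _ (@l1_convex R (1 - w)).
- by apply: Bx; lra.
- by move=> /Bh; rewrite kh; exact: Br0.
- by rewrite /= l1r//; lra.
- by rewrite /= ltW// kin// l1r; lra.
- exact: c0.
- by rewrite eq_sym gt_eqF// divr_gt0.
- move=> d /andP[d0 dc]; have c20 : 0 < c / 2 by rewrite divr_gt0.
  rewrite /l1 /= normr0 (gtr0_norm d0) (gtr0_norm c20).
  by move: dc; rewrite /c => dc; split; lra.
pose kap (s : R) := h (xi (clamp (1 - s))).
have ckap : continuous kap.
  apply: (comp_continuous _ ch); apply: (comp_continuous _ (@cts_fun _ _ xi)).
  by continuity.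
have kap0 : kap 0 = (1 + w, 0) by rewrite /kap subr0 [xi _]path_one kh.
have kap1 : kap 1 = h (1 - w, 0) by rewrite /kap subrr [xi _]path_zero.
exists w, h, k, (annulus_map w h kap), xi; split.
- by rewrite w1.
- by split.
- exact: xiP.
split.
- by move=> p; exact: annulus_map_continuous.
- by move=> p; exact: annulus_map_outside.
- by move=> p; exact: annulus_map_inside.
- move=> p; apply: annulus_map_avoid => //.
  by move=> s /Bh; have [] := xiP (clamp (1 - s)).
- move=> t; rewrite (annulus_map_ray w1 w2)//; exact: unit_val_itv.
Qed.

End shell.

(** * Transfer to the surface through a chart *)

Section chart_transfer.
Variables (R : realType) (S : topologicalType).
Local Notation E := (R * R)%type.
Local Notation I := (unit_interval R).
Variable j : E -> S.
Hypotheses (hS : hausdorff_space S) (cj : continuous j) (injj : injective j)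
  (openj : forall O, open O -> open (j @` O)).

Definition chart_transfer (g : E -> E) (z : S) : S :=
  if pselect (exists c, j c = z) is left jc then j (g (sval (cid jc))) else z.

Lemma chart_transferE g c : chart_transfer g (j c) = j (g c).
Proof.
rewrite /chart_transfer; case: pselect => [jc|[]]; last by exists c.
by congr (j (g _)); apply: injj; exact: (svalP (cid jc)).
Qed.

Lemma chart_transfer_id g z : (forall c, j c = z -> g c = c) ->
  chart_transfer g z = z.
Proof.
move=> gz; rewrite /chart_transfer; case: pselect => // jc.
by rewrite gz; exact: (svalP (cid jc)).
Qed.

Lemma chart_nbhs c (W : set E) : nbhs c W -> nbhs (j c) (j @` W).
Proof.
move=> cW; have : nbhs (j c) (j @` W°).
  by apply: open_nbhs_nbhs; split; [exact/openj/open_interior|exists c].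
by apply: filterS => _ [d Wd <-]; exists d => //; exact: interior_subset.
Qed.

Lemma chart_transfer_continuous_at g c : {for c, continuous g} ->
  {for j c, continuous (chart_transfer g)}.
Proof.
move=> cg W; rewrite chart_transferE => gW.
have /chart_nbhs : nbhs c ((j \o g) @^-1` W).
  by apply: (continuous_comp cg); [exact: cj|exact: gW].
by apply: filterS => _ [d dW <-] /=; rewrite chart_transferE.
Qed.

Lemma l1_compact (r : R) : compact [set p : E | l1 p <= r].
Proof.
apply: (@subclosed_compact _ _ (`[- r, r] `*` `[- r, r])).
- apply: closed_le_fun; last exact: continuous_cst.
  by apply: l1_continuous; exact: continuous_id.
- by apply: compact_setX; exact: segment_compact.
- move=> p pr; rewrite /= !in_itv /=; move: pr; rewrite /= /l1.
  have := normr_ge0 p.1; have := normr_ge0 p.2.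
  have := ler_norm p.1; have := ler_norm p.2.
  have := ler_norm (- p.1); have := ler_norm (- p.2); rewrite !normrN.
  by split; lra.
Qed.

Lemma chart_compact_closed (C : set E) : compact C -> closed (j @` C).
Proof.
move=> cC; apply: compact_closed => //; apply: continuous_compact => //.
exact: continuous_subspaceT.
Qed.

(** In a Hausdorff space the image of a compact diamond is closed, so a point outside it has a
    neighbourhood outside it, even beyond the range of the chart. *)
Lemma chart_outside_nbhs (r : R) z : (forall c, j c = z -> r < l1 c) ->
  nbhs z [set z' | forall c, j c = z' -> r < l1 c].
Proof.
move=> zr; apply: (@filterS _ _ _ (~` (j @` [set p : E | l1 p <= r]))).
  move=> z' nz' c cz'; rewrite ltNge; apply/negP => cr; apply: nz'.
  by exists c.
apply: open_nbhs_nbhs; split.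
  by rewrite openC; apply: chart_compact_closed; exact: l1_compact.
by move=> [c cr cz]; have := zr c cz; rewrite ltNge cr.
Qed.

Lemma chart_transfer_continuous_outside g (r : R) z :
  (forall c, r < l1 c -> g c = c) -> (forall c, j c = z -> r < l1 c) ->
  {for z, continuous (chart_transfer g)}.
Proof.
move=> gr zr W; rewrite chart_transfer_id; last by move=> c /zr/gr.
move=> zW; apply: filterS2 (chart_outside_nbhs zr) zW => z' z'r Wz' /=.
by rewrite chart_transfer_id// => c /z'r/gr.
Qed.

Variable A : set S.
Let B := j @^-1` A.
Local Notation X := (set_type (~` A)).

Lemma set_val_notin (x : X) : ~ A (set_val x). Proof. exact: (set_valP x). Qed.

Lemma set_val_continuous_at (f : X -> X) (F : S -> S) (x : X) :
  (forall y, set_val (f y) = F (set_val y)) ->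
  {for set_val x, continuous F} -> {for x, continuous f}.
Proof.
move=> fF cF W [_ [[O oO <-] /= Ofx OW]].
have OF : O (F (set_val x)) by rewrite -fF.
have : nbhs x ((fun y => F (set_val y)) @^-1` O).
  apply: (continuous_comp (@set_val_continuous S (~` A) x) cF).
  exact: open_nbhs_nbhs.
by apply: filterS => y Oy; apply: OW; rewrite /= fF.
Qed.

Definition chart_point c (Bc : ~ B c) : X := SigSub (mem_set (Bc : (~` A) (j c))).

Lemma chart_pointE c (Bc : ~ B c) : set_val (chart_point Bc) = j c.
Proof. by rewrite set_valE. Qed.

Lemma chart_path (x y : X) c d (p : pathI R c d) : set_val x = j c ->
  set_val y = j d -> (forall t, ~ B (p t)) ->
  exists q : pathI R x y, forall t, set_val (q t) = j (p t).
Proof.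
move=> xE yE Bp; apply: set_type_path => //.
- by apply: (comp_continuous _ cj); exact: cts_fun.
- by rewrite path_zero xE.
- by rewrite path_one yE.
Qed.

Variables (w : R) (h k F : E -> E) (xi : pathI R (1 - w, 0) (k (1 + w, 0))).
Hypotheses (w12 : 2^-1 < w < 3 / 4) (ck : continuous k) (kh : cancel k h)
  (Bh : forall p, B (h p) <-> B p) (kin : forall p, l1 p < 4 -> l1 (k p) < 1 - w)
  (xiP : forall t, ~ B (xi t) /\ l1 (xi t) <= 1 - w)
  (cF : forall p, p <> (-1, 0) -> {for p, continuous F})
  (Fout : forall p, 1 + w <= l1 p -> F p = p)
  (Fin : forall p, l1 p <= 1 - w -> F p = h p)
  (Fmid : forall p, 1 - w <= l1 p <= 1 + w -> ~ B (F p))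
  (Fray : forall t : I, F (1 + w - 2 * w * unit_val t, 0) =
     h (xi (clamp (1 - unit_val t))))
  (cB : countable B) (Ba : B (-1, 0)) (Bx : forall x, 0 < x -> ~ B (x, 0)).

Lemma swallow_avoid c : ~ B c -> ~ B (F c).
Proof.
move=> Bc; have [c1|c1] := leP (l1 c) (1 - w); first by rewrite Fin// Bh.
have [c2|c2] := leP (l1 c) (1 + w); first by apply: Fmid; rewrite ltW.
by rewrite Fout// ltW.
Qed.

Lemma section_avoid c : ~ B c -> ~ B (k c).
Proof. by move=> Bc /Bh; rewrite kh. Qed.

Lemma chart_transfer_avoid g : (forall c, ~ B c -> ~ B (g c)) ->
  forall z, ~ A z -> ~ A (chart_transfer g z).
Proof.
move=> Bg z Az; rewrite /chart_transfer; case: pselect => // jc.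
by apply: Bg; rewrite /B /=; have := svalP (cid jc) => /= ->.
Qed.

Let F_avoid (x : X) : (~` A) (chart_transfer F (set_val x)).
Proof. exact: (chart_transfer_avoid swallow_avoid (@set_val_notin x)). Qed.

Let k_avoid (x : X) : (~` A) (chart_transfer k (set_val x)).
Proof. exact: (chart_transfer_avoid section_avoid (@set_val_notin x)). Qed.

Definition swallow : X -> X := to_set_type F_avoid.
(** It is a section of [swallow] over [V], and its continuity is established there alone; beyond the
    chart it is the identity. *)
Let s : X -> X := to_set_type k_avoid.

Lemma swallowE x : set_val (swallow x) = chart_transfer F (set_val x).
Proof. exact: to_set_typeE. Qed.

Let sE x : set_val (s x) = chart_transfer k (set_val x).
Proof. exact: to_set_typeE. Qed.

Lemma swallow_chart c (x y : X) : set_val x = j c -> set_val y = j (F c) ->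
  swallow x = y.
Proof. by move=> xc yc; apply: set_val_inj; rewrite swallowE xc chart_transferE. Qed.

Lemma swallow_continuous : continuous swallow.
Proof.
move=> x; apply: (set_val_continuous_at swallowE).
have [[c cx]|nc] := pselect (exists c, j c = set_val x); last first.
  apply: (@chart_transfer_continuous_outside _ (1 + w)).
    by move=> c /ltW; exact: Fout.
  by move=> c cx; case: nc; exists c.
rewrite -cx; apply: chart_transfer_continuous_at; apply: cF => ca.
by apply: (@set_val_notin x); rewrite -cx ca.
Qed.

(** [U] and [V] overlap in the shell between radii [1 + w] and 4, where the two kinds of lift are
    exchanged. *)
Let U : set X := [set x | forall c, j c = set_val x -> 1 + w <= l1 c].
Let V : set X := [set x | exists2 c, j c = set_val x & l1 c < 4].

Let swallowU x : U x -> swallow x = x.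
Proof.
by move=> Ux; apply: set_val_inj; rewrite swallowE chart_transfer_id// => c /Ux/Fout.
Qed.

Let swallowV x : V x -> swallow (s x) = x.
Proof.
move=> [c cx c4]; apply: set_val_inj.
rewrite swallowE sE -cx !chart_transferE Fin ?kh//; exact/ltW/kin.
Qed.

Let csV x : V x -> {for x, continuous s}.
Proof.
move=> [c cx c4]; apply: (set_val_continuous_at sE); rewrite -cx.
by apply: chart_transfer_continuous_at; exact: ck.
Qed.

Let UV (x : X) : nbhs x U \/ nbhs x V.
Proof.
have [[c [cx c4]]|no] := pselect (exists c, j c = set_val x /\ l1 c < 4).
  right; have cl : continuous (fun p : E => l1 p).
    by apply: l1_continuous; exact: continuous_id.
  have : nbhs (set_val x) (j @` [set p | l1 p < 4]).
    have c4' : \forall q \near c, l1 q < 4 by exact: (cvgr_lt _ (cl c)).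
    by rewrite -cx; exact: chart_nbhs.
  move=> xn; have : nbhs x ((set_val : X -> S) @^-1` (j @` [set p | l1 p < 4])).
    exact: (@set_val_continuous S (~` A)) xn.
  by apply: filterS => y [d d4 dy]; exists d.
left.
have : nbhs (set_val x) [set z | forall c, j c = z -> 3 < l1 c].
  apply: chart_outside_nbhs => c cx; rewrite ltNge; apply/negP => c3.
  by apply: no; exists c; split=> //; rewrite (le_lt_trans c3)// ltr_nat.
move=> xn; have : nbhs x ((set_val : X -> S) @^-1` [set z | forall c, j c = z -> 3 < l1 c]).
  exact: (@set_val_continuous S (~` A)) xn.
apply: filterS => y yP c cy.
by have := yP c cy; move: w12; lra.
Qed.

Let Bp0 : ~ B (1 + w, 0).
Proof. by apply: Bx; move: w12; lra. Qed.
Let p0 : X := chart_point Bp0.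

Let l1_axis (x : R) : 0 <= x -> l1 ((x, 0) : E) = x.
Proof. by move=> x0; rewrite /l1 /= normr0 addr0 ger0_norm. Qed.

Let Up0 : U p0.
Proof.
move=> c; rewrite chart_pointE => /injj ->; rewrite l1_axis//; move: w12; lra.
Qed.

(** The path goes through the shell to the positive axis, inwards along the ray, along [xi], and
    back along the image of its first piece under [k]. The first and last pieces have mutually
    inverse images under [swallow], and so do the ray and [xi], so everything cancels. *)
Let switch x (Ux : U x) (Vx : V x) : exists z : pathI R x (s x),
  path_map swallow_continuous z (swallowU Ux) (swallowV Vx) ~~ path_cst R x.
Proof.
have [c cx c4] := Vx; have c1 := Ux c cx.
have w0 : 0 < w by move: w12; lra.
have Bc : ~ B c by rewrite /B /= cx; exact: set_val_notin.
have r1 : 1 < 1 + w by lra.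
have r2 : 1 + w < 2 by move: w12; lra.
have [d dP] := @shell_path R B (1 + w) c cB r1 r2 Bc (introT andP (conj c1 c4)) Bp0.
have Bd t : ~ B (d t) by have [] := dP t.
have By1 : ~ B (1 - w, 0) by apply: Bx; move: w12; lra.
pose y1 : X := chart_point By1.
have By2 : ~ B (k (1 + w, 0)) by exact: section_avoid.
pose y2 : X := chart_point By2.
have [P1 P1E] := chart_path (esym cx) (chart_pointE Bp0) Bd.
have Bray t : ~ B (seg_path (1 + w, 0) (1 - w, 0) t).
  rewrite /= /mk_path /seg /= subrr mulr0 addr0; apply: Bx.
  have := unit_val_itv t => t01; have : 0 <= w * unit_val t <= w by nra.
  by move: w12; lra.
have [P2 P2E] := chart_path (chart_pointE Bp0) (chart_pointE By1) Bray.
have Bxi t : ~ B (xi t) by have [] := xiP t.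
have [P3 P3E] := chart_path (chart_pointE By1) (chart_pointE By2) Bxi.
have sx : set_val (s x) = j (k c) by rewrite sE -cx chart_transferE.
have Bkd t : ~ B (path_map ck d erefl erefl t) by apply: section_avoid; exact: Bd.
have [P4 P4E] := chart_path sx (chart_pointE By2) Bkd.
exists (P1 ** P2 ** P3 ** path_rev P4).
have e0 : swallow p0 = p0 by exact: swallowU.
have e2 : swallow y2 = p0.
  apply: (@swallow_chart (k (1 + w, 0))); first exact: chart_pointE.
  rewrite Fin ?kh ?chart_pointE//; apply/ltW/kin.
  by rewrite l1_axis; move: w12; lra.
rewrite (path_map_concat swallow_continuous _ _ _ e2).
rewrite (path_map_concat swallow_continuous _ _ _ (erefl (swallow y1))).
rewrite (path_map_concat swallow_continuous _ _ _ e0).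
rewrite (path_map_rev swallow_continuous P4 (swallowV Vx) e2).
set Q1 := path_map _ P1 _ _; set Q2 := path_map _ P2 _ _.
rewrite (_ : path_map _ P3 _ _ = path_rev Q2); last first.
  apply/path_eqP => t; apply: (@swallow_chart (xi t)); first exact: P3E.
  rewrite /= /mk_path /path_rev_fun /Q2 path_mapE swallowE P2E chart_transferE.
  rewrite (@Fin (xi t)); last by have [] := xiP t.
  rewrite /= /mk_path /seg /= subrr mulr0 addr0; congr j.
  rewrite (_ : 1 + w + _ = 1 + w - 2 * w * unit_val (clamp (1 - unit_val t))); last by ring.
  rewrite Fray clampE; last by have := unit_val_itv t; lra.
  by rewrite subKr clampK.
rewrite (_ : path_map _ P4 _ _ = Q1); last first.
  apply/path_eqP => t; apply: (@swallow_chart (k (d t))); first by rewrite P4E.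
  have [_ /andP[d1 d4]] := dP t.
  rewrite Fin; last exact/ltW/kin.
  by rewrite kh /Q1 path_mapE swallowE P1E chart_transferE Fout.
by path_simp.
Qed.

Lemma swallow_lift_loops (g : pathI R p0 p0) : exists g' : pathI R p0 p0,
  path_map swallow_continuous g' (swallowU Up0) (swallowU Up0) ~~ g.
Proof. exact: (@lift_loops R X swallow s U V p0 swallow_continuous swallowU
  swallowV csV UV Up0 switch). Qed.

(** The straight contraction of the loop may cross points of [B]. But the box lies in the annulus
    and away from the puncture, where [F] is continuous with values off [B], so the image of the
    contraction stays in the punctured surface. *)
Lemma swallow_box_null (x : X) (l : pathI R x x) (g : I -> E) : continuous g ->
  (forall t, set_val (l t) = j (g t)) ->
  (forall t, [/\ ~ B (g t), `|(g t).1| <= 10^-1 & `|(g t).2 - 1| <= 10^-1]) ->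
  path_map swallow_continuous l erefl erefl ~~ path_cst R (swallow x).
Proof.
move=> cg lE gP.
pose G (z : I * I) := seg (g z.2) (g zero) (unit_val z.1).
have cG : continuous G.
  have cg2 : continuous (fun z : I * I => g z.2).
    by apply: (comp_continuous _ cg); exact: snd_continuous.
  have cu : continuous (fun z : I * I => unit_val z.1 : R).
    by apply: unit_val_comp_continuous; exact: fst_continuous.
  by rewrite /G /seg; continuity.
have Gbox z : `|(G z).1| <= 10^-1 /\ `|(G z).2 - 1| <= 10^-1.
  have [_ a1 a2] := gP z.2; have [_ b1 b2] := gP zero.
  move: a1 a2 b1 b2; rewrite /G /seg /= !ler_norml.
  move: (unit_val_itv z.1) => /andP[t0 t1] a1 a2 b1 b2.
  by split; apply/andP; split; nra.
have Gl1 z : 1 - w <= l1 (G z) <= 1 + w.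
  have [a1] := Gbox z; rewrite /l1 ler_norml => a2; move: w12 => ww.
  rewrite (@ger0_norm _ (G z).2); last by lra.
  have := normr_ge0 (G z).1; lra.
have cFG : continuous (F \o G).
  move=> z; apply: continuous_comp; first exact: cG.
  apply: cF => ez; have [_] := Gbox z; rewrite ez /= sub0r normrN normr1; lra.
have AH z : (~` A) (j (F (G z))) by exact: (Fmid (Gl1 z)).
have lg1 : g one = g zero.
  by apply: injj; rewrite -!lE path_zero path_one.
exists (to_set_type AH); split=> [|t|t|r|r].
- by apply: to_set_type_continuous; exact: (comp_continuous cFG cj).
- apply: set_val_inj; rewrite to_set_typeE path_mapE swallowE lE chart_transferE.
  by rewrite /G /= I_zeroE seg0.
- apply: set_val_inj; rewrite to_set_typeE /G /= /mk_path /cst I_oneE seg1 swallowE.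
  by rewrite -chart_transferE -lE path_zero.
- apply: set_val_inj; rewrite to_set_typeE /G /= swallowE.
  rewrite (_ : seg _ _ _ = g zero); first by rewrite -chart_transferE -lE path_zero.
  by rewrite /seg !subrr !mulr0 !addr0 -surjective_pairing.
- apply: set_val_inj; rewrite to_set_typeE /G /= swallowE lg1.
  rewrite (_ : seg _ _ _ = g zero); first by rewrite -chart_transferE -lE path_zero.
  by rewrite /seg !subrr !mulr0 !addr0 -surjective_pairing.
Qed.

End chart_transfer.

(** * A loop through a slit *)

Lemma dense_box (R : realType) (D : set (R * R)) (a b c d : R) : dense D -> a < b -> c < d ->
  exists p, [/\ D p, a < p.1 < b & c < p.2 < d].
Proof.
move=> dD ab cd.
pose O := ((fun p : R * R => p.1) @^-1` `]a, b[) `&` ((fun p : R * R => p.2) @^-1` `]c, d[).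
have oO : open O.
  apply: openI; apply: open_comp; try exact: interval_open.
    by move=> p _; exact: fst_continuous.
  by move=> p _; exact: snd_continuous.
have [|p [[/= p1 p2] Dp]] := dD O _ oO.
  exists ((a + b) / 2, (c + d) / 2); split; rewrite /= in_itv /=; lra.
by exists p; rewrite !in_itv /= in p1 p2.
Qed.

(** The slit is the segment between two points [a1], [a2] of [B], thickened to a lens tapering to
    these points. [C1] and [C2] are the two halves of the lens, and the third set is everything
    else, including all of the surface beyond the chart. The three meet only at the removed points
    [a1] and [a2], so the global topology of the surface has no influence. *)
Lemma slit_loop (R : realType) (S : topologicalType) (j : R * R -> S) (A : set S) :
  hausdorff_space S -> continuous j -> injective j ->
  (forall O, open O -> open (j @` O)) ->
  countable (j @^-1` A) -> dense (j @^-1` A) ->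
  exists (x : set_type (~` A)) (l : pathI R x x) (g : unit_interval R -> R * R),
  [/\ continuous g, forall t, set_val (l t) = j (g t),
      forall t, [/\ ~ A (j (g t)), `|(g t).1| <= 10^-1 & `|(g t).2 - 1| <= 10^-1] &
      ~ path_homotopic l (path_cst R x)].
Proof.
move=> hS cj injj openj; set B := j @^-1` A => cB dB.
have [||a1 [Ba1 a1x a1y]] :=
  @dense_box R B (- 20^-1) (- 25^-1) (99 / 100) (101 / 100) dB; [lra..|].
have [||a2 [Ba2 a2x a2y]] :=
  @dense_box R B 25^-1 20^-1 (99 / 100) (101 / 100) dB; [lra..|].
have avoid1 (a b : R) : a < b -> exists2 r, a < r < b & forall p, B p -> p.1 != r.
  move=> ab; have [|//|r rab nr] := @countable_avoid R ((fun p => p.1) @` B) a b.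
    exact: countable_image.
  by exists r => // p Bp; apply/eqP => pr; apply: nr; exists p.
have avoid2 (a b : R) : a < b -> exists2 r, a < r < b & forall p, B p -> p.2 != r.
  move=> ab; have [|//|r rab nr] := @countable_avoid R ((fun p => p.2) @` B) a b.
    exact: countable_image.
  by exists r => // p Bp; apply/eqP => pr; apply: nr; exists p.
(* The sides of the rectangle are put on lines free of [B]. The left side passes between [a1] and
   [a2], and the three others go around [a2] without touching the lens. *)
have [|u0 u0r Bu0] := avoid1 (- 100^-1) 100^-1; first by lra.
have [|u1 u1r Bu1] := avoid1 (6 / 100) (7 / 100); first by lra.
have [|v0 v0r Bv0] := avoid2 (92 / 100) (93 / 100); first by lra.
have [|v1 v1r Bv1] := avoid2 (107 / 100) (108 / 100); first by lra.
pose g (t : unit_interval R) : R * R := (u0 + (u1 - u0) * (square_loop t).1,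
                       v0 + (v1 - v0) * (square_loop t).2).
have cg : continuous g.
  have csq := @square_loop_continuous R.
  by rewrite /g; continuity.
have gleft t : unit_val t <= 4^-1 -> g t = (u0, v0 + (v1 - v0) * (4 * unit_val t)).
  by move=> t4; rewrite /g square_loop_left//= mulr0 addr0.
have grest t : 4^-1 <= unit_val t ->
    [/\ u0 <= (g t).1 <= u1, v0 <= (g t).2 <= v1 &
        [\/ (g t).2 = v1, (g t).1 = u1 | (g t).2 = v0]].
  move=> /square_loop_rest[]; rewrite /g; case: square_loop => x y /= x01 [y01 xy].
  have ux : 0 <= (u1 - u0) * x <= u1 - u0 by have := x01; nra.
  have vy : 0 <= (v1 - v0) * y <= v1 - v0 by have := y01; nra.
  split; [clear - ux; lra|clear - vy; lra|].
  by case: xy => ->; [constructor 1|constructor 2|constructor 3]; ring.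
have gB t : ~ B (g t).
  have [t4|/ltW t4] := leP (unit_val t) 4^-1.
    by rewrite gleft// => /Bu0/=; rewrite eqxx.
  have [_ _ gt] := grest t t4 => Bg; case: gt => e.
  - by have := Bv1 _ Bg; rewrite e eqxx.
  - by have := Bu1 _ Bg; rewrite e eqxx.
  - by have := Bv0 _ Bg; rewrite e eqxx.
have gbox t : u0 <= (g t).1 <= u1 /\ v0 <= (g t).2 <= v1.
  have [t4|/ltW/grest[]//] := leP (unit_val t) 4^-1.
  rewrite gleft//=; have := unit_val_itv t => t01; split; first by lra.
  have : 0 <= (v1 - v0) * (4 * unit_val t) <= v1 - v0 by nra.
  by lra.
pose x : set_type (~` A) := @chart_point R S j A _ (gB zero).
have g01 : g one = g zero by rewrite /g square_loop_one square_loop_zero.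
have gA t : (~` A) (j (g t)) by exact: gB.
have [|||l lE] := @set_type_path R S (~` A) x x (j \o g) _ _ _ gA.
- exact: comp_continuous cg cj.
- by rewrite /= chart_pointE.
- by rewrite /= g01 chart_pointE.
exists x, l, g; split=> // [t|].
  have [/andP[g1 g2] /andP[g3 g4]] := gbox t; split; first exact: gB.
    by rewrite ler_norml; apply/andP; clear - g1 g2 u0r u1r; split; lra.
  by rewrite ler_norml; apply/andP; clear - g3 g4 v0r v1r; split; lra.
pose lin (s : R) := a1.2 + (a2.2 - a1.2) * ((s - a1.1) / (a2.1 - a1.1)).
pose width (s : R) := Num.min (s - a1.1) (a2.1 - s).
have clin : continuous (fun p : R * R => lin p.1) by rewrite /lin; continuity.
have cwidth : continuous (fun p : R * R => width p.1) by rewrite /width; continuity.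
have a12 : 0 < a2.1 - a1.1 by clear - a1x a2x; lra.
have lin_itv s : a1.1 <= s <= a2.1 -> 99 / 100 < lin s < 101 / 100.
  move=> /andP[s1 s2].
  have : 0 <= (s - a1.1) / (a2.1 - a1.1) <= 1.
    by apply/andP; split; [apply: divr_ge0|rewrite ler_pdivrMr//];
      clear - s1 s2 a12; lra.
  rewrite /lin; move: ((s - _) / _) => r r01; rewrite addrC.
  move: a1y a2y => /andP[b1 b2] /andP[b3 b4].
  by apply/andP; split; [exact: convex_gt|exact: convex_lt].
have width_le s : width s <= 20^-1.
  by rewrite /width ge_min; apply/orP; have [s0|s0] := leP s 0;
    clear - a1x a2x s0; [left|right]; lra.
pose C1 := [set p : R * R | (a1.1 <= p.1 /\ p.1 <= a2.1) /\
  (lin p.1 - width p.1 <= p.2 /\ p.2 <= lin p.1)].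
pose C2 := [set p : R * R | (a1.1 <= p.1 /\ p.1 <= a2.1) /\
  (lin p.1 <= p.2 /\ p.2 <= lin p.1 + width p.1)].
pose D := [set p : R * R | (p.1 <= a1.1 \/ a2.1 <= p.1) \/
  (p.2 <= lin p.1 - width p.1 \/ lin p.1 + width p.1 <= p.2)].
have cD : closed D.
  rewrite (_ : D = ([set p | p.1 <= a1.1] `|` [set p | a2.1 <= p.1]) `|`
    ([set p | p.2 <= lin p.1 - width p.1] `|` [set p | lin p.1 + width p.1 <= p.2])) //.
  by closed_ineq.
have compact_box (C : set (R * R)) : closed C ->
    C `<=` [set p | a1.1 <= p.1 <= a2.1 /\ 0 <= p.2 <= 2] -> compact C.
  move=> cC Cbox.
  have cK : compact (`[a1.1, a2.1] `*` `[0 : R, 2]).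
    by apply: compact_setX; exact: segment_compact.
  apply: (subclosed_compact cC cK) => p /Cbox[p1 p2].
  by split; rewrite /= in_itv.
have C1c : compact C1.
  apply: compact_box.
    rewrite (_ : C1 = ([set p | a1.1 <= p.1] `&` [set p | p.1 <= a2.1]) `&`
      ([set p | lin p.1 - width p.1 <= p.2] `&` [set p | p.2 <= lin p.1])) //.
    by closed_ineq.
  move=> p [[p1 p2] [p3 p4]]; have p12 : a1.1 <= p.1 <= a2.1 by rewrite p1.
  have lp := lin_itv _ p12; have wp := width_le p.1; split=> //.
  by clear - lp wp p3 p4; lra.
have C2c : compact C2.
  apply: compact_box.
    rewrite (_ : C2 = ([set p | a1.1 <= p.1] `&` [set p | p.1 <= a2.1]) `&`
      ([set p | lin p.1 <= p.2] `&` [set p | p.2 <= lin p.1 + width p.1])) //.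
    by closed_ineq.
  move=> p [[p1 p2] [p3 p4]]; have p12 : a1.1 <= p.1 <= a2.1 by rewrite p1.
  have lp := lin_itv _ p12; have wp := width_le p.1; split=> //.
  by clear - lp wp p3 p4; lra.
pose pre (Q : set S) := (set_val : set_type (~` A) -> S) @^-1` Q.
have cpre Q : closed Q -> closed (pre Q).
  by move=> cQ; apply: preimage_closed cQ => y _; exact: set_val_continuous.
have u0in : a1.1 <= u0 <= a2.1 by clear - a1x a2x u0r; lra.
have lin0 := lin_itv u0 u0in; have wid0 := width_le u0.
have wid0' : 0 < width u0.
  by rewrite /width lt_min; apply/andP; clear - a1x a2x u0r; split; lra.
(* The time at which the left side of the rectangle reaches height [y]. *)
pose time (y : R) := (y - v0) / (4 * (v1 - v0)).
have v01 : 0 < 4 * (v1 - v0) by clear - v0r v1r; lra.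
have timeE (y t : R) : (t <= time y) = (v0 + (v1 - v0) * (4 * t) <= y).
  by rewrite /time ler_pdivlMr// lerBrDr; congr (_ <= _); ring.
have timeE' (y t : R) : (time y <= t) = (y <= v0 + (v1 - v0) * (4 * t)).
  by rewrite /time ler_pdivrMr// lerBlDr; congr (_ <= _); ring.
have time_lt (y y' : R) : y < y' -> time y < time y'.
  by move=> yy; rewrite /time ltr_pM2r ?invr_gt0// ltrD2r.
have time4 (y : R) : y <= v1 -> time y <= 4^-1.
  by move=> yv; rewrite timeE' divff// mulr1 subrKC.
pose y1 := lin u0 - width u0; pose y2 := lin u0; pose y3 := lin u0 + width u0.
have y01 : v0 < y1 by rewrite /y1; clear - lin0 wid0 v0r; lra.
have y12 : y1 < y2 by rewrite /y1 /y2 ltrBlDr ltrDl.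
have y23 : y2 < y3 by rewrite /y2 /y3 ltrDl.
have y3v : y3 <= v1 by rewrite /y3; clear - lin0 wid0 v1r; lra.
have y2v : y2 <= v1 by rewrite (le_trans (ltW y23)).
have y1v : y1 <= v1 by rewrite (le_trans (ltW y12)).
have inC (C : set (R * R)) t : C (g t) -> pre (j @` C) (l t).
  by move=> Cg; exists (g t); rewrite ?lE.
have inD t : D (g t) -> pre (~` (j @` (~` D))) (l t).
  by move=> Dg [d nDd]; rewrite lE => /injj dg; apply: nDd; rewrite dg.
apply: (@winding_not_null R _ (pre (~` (j @` (~` D)))) (pre (j @` C1)) (pre (j @` C2))
  x l (time y1) (time y2) (time y3)).
- by apply: cpre; apply: open_closedC; apply: openj; rewrite openC.
- by apply: cpre; exact: chart_compact_closed.
- by apply: cpre; exact: chart_compact_closed.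
- move=> y; have [[d nDd dy]|nd] := pselect ((j @` (~` D)) (set_val y)); last by constructor 1.
  have [[d1 d2] [d3 d4]] : (a1.1 < d.1 /\ d.1 < a2.1) /\
      (lin d.1 - width d.1 < d.2 /\ d.2 < lin d.1 + width d.1).
    by split; split; rewrite ltNge; apply/negP => dd; apply: nDd;
      [left; left|left; right|right; left|right; right].
  have [dl|/ltW dl] := leP d.2 (lin d.1).
    by constructor 2; exists d => //; split; split=> //; exact: ltW.
  by constructor 3; exists d => //; split; split=> //; exact: ltW.
- move=> y nD [d [[d1 d2] [d3 d4]] dy] [d' [_ [d5 _]] d'y].
  have d'E : d' = d by apply: injj; rewrite dy.
  rewrite d'E in d5; have dl : d.2 = lin d.1 by apply/eqP; rewrite eq_le d4.
  have Bd : ~ B d by rewrite /B /= dy; exact: set_val_notin.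
  apply: nD; exists d => //; case=> [[e|e]|].
  + have e1 : d.1 = a1.1 by apply/eqP; rewrite eq_le e.
    apply: Bd; rewrite [d]surjective_pairing dl e1 /lin subrr mul0r mulr0 addr0.
    by rewrite -surjective_pairing.
  + have e1 : d.1 = a2.1 by apply/eqP; rewrite eq_le e d2.
    apply: Bd; rewrite [d]surjective_pairing dl e1 /lin divff ?mulr1 ?subrKC;
        last by rewrite gt_eqF.
    by rewrite -surjective_pairing.
  + move=> e; have wd : width d.1 <= 0 by rewrite dl in e; clear - e; case: e; lra.
    have [wd1|wd1] : d.1 = a1.1 \/ d.1 = a2.1.
      move: wd; rewrite /width ge_min => /orP[] e1; clear - d1 d2 e1; [left|right]; lra.
    * apply: Bd; rewrite [d]surjective_pairing dl wd1 /lin subrr mul0r mulr0 addr0.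
      by rewrite -surjective_pairing.
    * apply: Bd; rewrite [d]surjective_pairing dl wd1 /lin divff ?mulr1 ?subrKC;
        last by rewrite gt_eqF.
      by rewrite -surjective_pairing.
- by rewrite /time divr_gt0// subr_gt0.
- exact: time_lt.
- exact: time_lt.
- by apply: le_lt_trans (time4 _ y3v) _; rewrite invf_lt1 ?ltr1n.
- move=> t tt; apply: inD; rewrite gleft; last exact: le_trans tt (time4 _ y1v).
  by right; left; rewrite /= -timeE.
- move=> t /andP[tt tt']; apply: inC; rewrite gleft; last first.
    exact: le_trans tt' (time4 _ y2v).
  by split; [|rewrite /= -timeE -timeE'; split]; case/andP: u0in.
- move=> t /andP[tt tt']; apply: inC; rewrite gleft; last first.
    exact: le_trans tt' (time4 _ y3v).
  by split; [|rewrite /= -timeE -timeE'; split]; case/andP: u0in.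
- move=> t tt; apply: inD; have [t4|/ltW t4] := leP (unit_val t) 4^-1.
    by rewrite gleft//; right; right; rewrite /= -timeE'.
  have [g1 g2 gt] := grest t t4.
  have [/andP[i1 i2]|no] := boolP (a1.1 <= (g t).1 <= a2.1); last first.
    left; move: no; rewrite negb_and -!ltNge => /orP[/ltW|/ltW]; [left|right]; by [].
  have := lin_itv (g t).1; rewrite i1 i2 => /(_ isT) lg; have wg := width_le (g t).1.
  case: gt => e.
  + by right; right; rewrite e; clear - lg wg v1r; lra.
  + by left; right; rewrite e; clear - a2x u1r; lra.
  + by right; left; rewrite e; clear - lg wg v0r; lra.
Qed.

(** * Charts *)

Lemma pair_continuous_at (X Y Z : topologicalType) (f : X -> Y) (g : X -> Z)
    (x : X) : {for x, continuous f} -> {for x, continuous g} ->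
  {for x, continuous (fun y => (f y, g y))}.
Proof. by move=> cf cg; apply: cvg_pair; [exact: cf|exact: cg]. Qed.

Section charts.
Variable R : realType.
Local Notation E := (R * R)%type.

Definition is_chart (S : topologicalType) (j : E -> S) :=
  [/\ continuous j, injective j & forall O, open O -> open (j @` O)].

Let squash (t : R) := t / (1 + `|t|).
Let unsquash (s : R) := s / (1 - `|s|).

Let one_norm_gt0 (t : R) : 0 < 1 + `|t|.
Proof. by rewrite ltr_wpDr. Qed.

Let squash_lt1 t : `|squash t| < 1.
Proof.
rewrite /squash normrM normfV (gtr0_norm (one_norm_gt0 t)).
by rewrite ltr_pdivrMr// mul1r ltrDr.
Qed.

Let squashK : cancel squash unsquash.
Proof.
move=> t; have t1 := one_norm_gt0 t; have n0 : 1 + `|t| != 0 by rewrite gt_eqF.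
rewrite /unsquash /squash normrM normfV (gtr0_norm t1).
rewrite (_ : 1 - _ = (1 + `|t|)^-1); last by move: `|t| n0 => u n0; field.
by rewrite invrK divfK.
Qed.

Let unsquashK s : `|s| < 1 -> squash (unsquash s) = s.
Proof.
move=> s1; have d0 : 0 < 1 - `|s| by rewrite subr_gt0.
have n0 : 1 - `|s| != 0 by rewrite gt_eqF.
rewrite /squash /unsquash normrM normfV (gtr0_norm d0).
rewrite (_ : 1 + `|s| / _ = (1 - `|s|)^-1); last by move: `|s| n0 => u n0; field.
by rewrite invrK divfK.
Qed.

Let squash_continuous (X : topologicalType) (f : X -> R) : continuous f ->
  continuous (fun x => squash (f x)).
Proof.
move=> cf; apply: continuousM => //; apply: continuousV; first by continuity.
by move=> x; rewrite gt_eqF.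
Qed.

(** Charts are defined on the whole plane, by squeezing it homeomorphically onto an open square
    inside the given planar set. *)
Lemma chart_exists (S : topologicalType) (x : S) : locally_planar R S ->
  exists j : E -> S, is_chart j /\ exists c, j c = x.
Proof.
move=> /(_ x)[U [V [oU Ux oV [f [g [cf cg fK gK]]]]]].
pose x' : set_type U := SigSub (mem_set Ux).
have x'E : set_val x' = x by rewrite set_valE.
pose v : E := set_val (f x'); have Vv : V v by exact: set_valP.
have : nbhs v V by exact: open_nbhs_nbhs.
move=> /nbhs_ballP[r /= r0 rV].
pose be (c : E) : E := (v.1 + r * squash c.1, v.2 + r * squash c.2).
pose bi (p : E) : E := (unsquash ((p.1 - v.1) / r), unsquash ((p.2 - v.2) / r)).
have rn0 : r != 0 by rewrite gt_eqF.
have beK : cancel be bi.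
  move=> [c1 c2]; rewrite /be /bi /= ![_ + _ - _]addrAC !subrr !add0r.
  by rewrite ![r * _]mulrC !mulfK// !squashK.
have small (t : R) : `|r * squash t| < r.
  by rewrite normrM (gtr0_norm r0) gtr_pMr.
have beV c : V (be c).
  by apply: rV; split; rewrite /ball /= opprD addrA subrr sub0r normrN.
have cbe : continuous be.
  have c1 := @squash_continuous E (fun p => p.1) (@fst_continuous R R).
  have c2 := @squash_continuous E (fun p => p.2) (@snd_continuous R R).
  by rewrite /be; continuity.
pose be' := to_set_type beV.
have cbe' : continuous be' by exact: to_set_type_continuous.
pose j c := set_val (g (be' c)).
have jU c : U (j c) by exact: set_valP.
exists j; split; last first.
  exists 0; rewrite /j (_ : be' 0 = f x') ?fK//.
  apply: set_val_inj; rewrite to_set_typeE /be /squash /= !mul0r !mulr0 !addr0.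
  by rewrite -surjective_pairing.
split.
- apply: (comp_continuous _ (@set_val_continuous S U)).
  exact: comp_continuous cbe' cg.
- move=> c d /set_val_inj/(can_inj gK)/(congr1 set_val).
  by rewrite !to_set_typeE => /(can_inj beK).
move=> O oO.
have obe : open (be @` O).
  rewrite openE => _ [c Oc <-].
  have lt1 (t : R) : `|(r * squash t) / r| < 1 by rewrite mulrC mulKf.
  have cbi : {for be c, continuous bi}.
    have cu (pr : E -> R) (a t : R) : continuous pr -> pr (be c) - a = r * squash t ->
        {for be c, continuous (fun p => unsquash ((pr p - a) / r))}.
      move=> cpr e; have ca : continuous (fun p : E => (pr p - a) / r) by continuity.
      apply: cvgM; first exact: ca.
      apply: cvgV; first by rewrite e subr_eq0 eq_sym lt_eqF.
      have := @continuousB R E (fun=> 1) (fun p => `|(pr p - a) / r|).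
      by apply; continuity.
    apply: pair_continuous_at.
      by apply: (cu (fun p => p.1) v.1 c.1); [exact: fst_continuous|rewrite /be /=; ring].
    by apply: (cu (fun p => p.2) v.2 c.2); [exact: snd_continuous|rewrite /be /=; ring].
  have n1 : nbhs (be c) (bi @^-1` O).
    by apply: cbi; rewrite beK; exact: open_nbhs_nbhs.
  have n2 : nbhs (be c) (ball v r).
    apply: open_nbhs_nbhs; split; first exact: ball_open.
    by split; rewrite /ball /= opprD addrA subrr sub0r normrN.
  apply: filterS2 n1 n2 => p Op [p1 p2]; exists (bi p) => //.
  have un (a b : R) : ball a r b -> a + r * squash (unsquash ((b - a) / r)) = b.
    rewrite /ball /= => ab; rewrite unsquashK; first by rewrite mulrC divfK// subrKC.
    by rewrite normrM normfV (gtr0_norm r0) ltr_pdivrMr// mul1r distrC.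
  by rewrite /be /bi /= !un// -surjective_pairing.
have : open (f @^-1` ((set_val : set_type V -> E) @^-1` (be @` O))).
  apply: open_comp => [y _|]; first exact: cf.
  by apply: open_comp => // y _; exact: set_val_continuous.
move=> [G oG GE].
rewrite (_ : j @` O = G `&` U); first exact: openI.
apply/seteqP; split=> [_ [c Oc <-]|z [Gz Uz]].
  split; last exact: jU.
  have : (f @^-1` ((set_val : set_type V -> E) @^-1` (be @` O))) (g (be' c)).
    by rewrite /= gK to_set_typeE; exists c.
  by rewrite -GE.
pose z' : set_type U := SigSub (mem_set Uz).
have z'E : set_val z' = z by rewrite set_valE.
have : ((set_val : set_type U -> S) @^-1` G) z' by rewrite /= z'E.
rewrite GE /= => -[c Oc ce]; exists c => //.
rewrite /j (_ : be' c = f z') ?fK//.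
by apply: set_val_inj; rewrite to_set_typeE ce.
Qed.

Lemma chart_affine (S : topologicalType) (j : E -> S) (a : E) (m : R) :
  is_chart j ->
  is_chart (fun p => j (a.1 + (p.1 + 1), a.2 + m * (p.1 + 1) + p.2)).
Proof.
move=> [cj ij oj].
pose T (p : E) : E := (a.1 + (p.1 + 1), a.2 + m * (p.1 + 1) + p.2).
pose T' (q : E) : E := (q.1 - a.1 - 1, q.2 - a.2 - m * (q.1 - a.1)).
have TK : cancel T T' by move=> [x y]; rewrite /T /T' /=; congr pair; ring.
have TK' : cancel T' T by move=> [x y]; rewrite /T /T' /=; congr pair; ring.
have cT : continuous T by rewrite /T; continuity.
have cT' : continuous T' by rewrite /T'; continuity.
split.
- exact: comp_continuous cT cj.
- by move=> p q /ij/(can_inj TK).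
- move=> O oO; rewrite (_ : _ @` O = j @` (T' @^-1` O)).
    by apply: oj; apply: open_comp => // p _; exact: cT'.
  apply/seteqP; split=> _ [p Op <-]; first by exists (T p); rewrite //= TK.
  by exists (T' p) => //; rewrite -[in RHS](TK' p).
Qed.

Lemma chart_countable (S : topologicalType) (j : E -> S) (A : set S) :
  injective j -> countable A -> countable (j @^-1` A).
Proof.
move=> ij /countable_injP[f finj]; apply/countable_injP; exists (f \o j).
move=> x y xA yA /= fxy; apply: ij; by apply: finj fxy; rewrite inE; apply: set_mem.
Qed.

Lemma chart_dense (S : topologicalType) (j : E -> S) (A : set S) :
  (forall O, open O -> open (j @` O)) -> dense A -> dense (j @^-1` A).
Proof.
move=> oj dA O [c Oc] oO.
have [|_ [[d Od <-] Ad]] := dA (j @` O) _ (oj O oO); first by exists (j c), c.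
by exists d.
Qed.

Lemma open_avoid (O B : set E) : open O -> O !=set0 -> countable B ->
  exists2 c, O c & ~ B c.
Proof.
move=> oO [c Oc] cB; have : nbhs c O by exact: open_nbhs_nbhs.
move=> /nbhs_ballP[e /= e0 eO].
have [|//|t /andP[t0 te] nt] := @countable_avoid R ((fun p => p.1 - c.1) @` B) 0 e.
  exact: countable_image.
exists (c.1 + t, c.2); last by move=> Bc; apply: nt; exists (c.1 + t, c.2) => //=; ring.
apply: eO; split; rewrite /ball /= ?subrr ?normr0//.
by rewrite opprD addrA subrr sub0r normrN gtr0_norm.
Qed.

(** The predicate [P] concerns all points of [S], punctures included, because the connectedness
    available is that of [S]. It propagates because the overlap of two charts is open, hence
    contains an unpunctured point through which paths can be continued. *)
Lemma punctured_path_connected (S : topologicalType) (A : set S) :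
  connected [set: S] ->
  (forall x : S, exists j : E -> S, is_chart j /\ exists c, j c = x) ->
  countable A -> forall x y : set_type (~` A), inhabited (pathI R x y).
Proof.
move=> cS charts cA x y.
have local j (u v : set_type (~` A)) : is_chart j -> (exists c, j c = set_val u) ->
    (exists c, j c = set_val v) -> inhabited (pathI R u v).
  move=> [cj ij oj] [c cu] [d dv].
  have Bc : ~ (j @^-1` A) c by rewrite /= cu; exact: set_val_notin.
  have Bd : ~ (j @^-1` A) d by rewrite /= dv; exact: set_val_notin.
  have [w wB] := plane_path (chart_countable ij cA) Bc Bd.
  by have [q _] := chart_path cj (esym cu) (esym dv) wB; split.
pose P (z : S) := exists j : E -> S, [/\ is_chart j, exists c, j c = z &
  forall u : set_type (~` A), (exists c, j c = set_val u) -> inhabited (pathI R x u)].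
have Px : P (set_val x).
  have [j [jc jx]] := charts (set_val x); exists j; split=> // u ju.
  exact: local jc jx ju.
have : P (set_val y).
  apply: connected_locally_constant Px => // z.
  have [j [jc [c cz]]] := charts z; have [cj ij oj] := jc.
  exists (range j).
    apply: open_nbhs_nbhs; split; last by exists c.
    by apply: oj; exact: openT.
  move=> u v [cu _ cuE] [cv _ cvE] [j' [[cj' ij' oj'] [cu' cu'E] reach]].
  exists j; split=> //; first by exists cv.
  move=> t jt.
  have oI : open (j @^-1` (range j')).
    by apply: open_comp => [p _|]; [exact: cj|apply: oj'; exact: openT].
  have [|d [d' _ d'E] Bd] := open_avoid oI _ (chart_countable ij cA).
    by exists cu; exists cu'; rewrite // cu'E cuE.
  pose m : set_type (~` A) := chart_point Bd.
  have [p] : inhabited (pathI R x m).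
    by apply: reach; exists d'; rewrite chart_pointE d'E.
  have [q] : inhabited (pathI R m t).
    by apply: (local j) => //; exists d; rewrite chart_pointE.
  by split; exact: path_concat p q.
by move=> [j [_ jy]]; exact.
Qed.

End charts.

(** * Punctured surfaces *)

Section surfaces.
Variable R : realType.
Local Notation E := (R * R)%type.

(** An affine change of the chart puts a point [a] of the countable set at (-1, 0). The axis becomes
    a line through [a] whose slope [m] differs from the slopes from [a] to all other points of the
    set, so the positive half-axis avoids it. *)
Lemma normalized_chart (S : topologicalType) (j0 : E -> S) (A : set S) :
  is_chart j0 -> countable A -> dense A -> exists j : E -> S,
  [/\ is_chart j, A (j (-1, 0)) & forall x : R, 0 < x -> ~ A (j (x, 0))].
Proof.
move=> j0c cA dA; have [cj ij oj] := j0c.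
have cB := chart_countable ij cA; have dB := chart_dense oj dA.
have [|a [_ Ba]] := dB setT _ openT; first by exists 0.
have [|//|m _ nm] := @countable_avoid R
    ((fun b : E => (b.2 - a.2) / (b.1 - a.1)) @` (j0 @^-1` A)) 0 1.
  exact: countable_image.
exists (fun p => j0 (a.1 + (p.1 + 1), a.2 + m * (p.1 + 1) + p.2)); split.
- exact: chart_affine.
- by rewrite /= addNr mulr0 !addr0 -surjective_pairing.
move=> x x0 Ax; apply: nm; exists (a.1 + (x + 1), a.2 + m * (x + 1) + 0) => //=.
by field; rewrite gt_eqF//; lra.
Qed.

Lemma punctured_surface_not_hopfian (S : topologicalType) (A : set S)
    (x0 : set_type (~` A)) :
  surface R S -> connected [set: S] -> countable A -> dense A ->
  ~ hopfian (fundamental_group R x0).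
Proof.
move=> [hS _ pS] cS cA dA.
have [j0 [j0c _]] := chart_exists (set_val x0) pS.
have [j [[cj ij oj] Ba Bx]] := normalized_chart j0c cA dA.
have cB := chart_countable ij cA; have dB := chart_dense oj dA.
have [w [h [k [F [xi [w12 [ck kh Bh kin] xiP [cF Fout Fin Fmid Fray]]]]]]] :=
  swallowing_map cB dB Ba Bx.
have [x [l [g [cg lE gP nl]]]] := slit_loop hS cj ij oj cB dB.
have conn : forall u v : set_type (~` A), inhabited (pathI R u v).
  by apply: punctured_path_connected => // z; exact: chart_exists.
have lift := swallow_lift_loops (w12 := w12) (Bx := Bx) hS cj ij oj ck kh Bh kin xiP
  cF Fout Fin Fmid Fray cB Ba.
have null := swallow_box_null hS cj ij oj w12 Bh cF Fout Fin Fmid Ba cg lE gP.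
exact: (not_hopfian_endo conn lift null nl).
Qed.

End surfaces.

Theorem theorem1p3 (R : realType) :
  (forall (Sigma : topologicalType) (A : set Sigma) (x0 : set_type (~` A)),
      surface R Sigma -> connected [set: Sigma] ->
      countable A -> dense A ->
      ~ hopfian (fundamental_group R x0))
  /\ (forall x0 : set_type (sierpinski_carpet R),
      ~ hopfian (fundamental_group R x0))
  /\ (forall x0 : set_type (sierpinski_gasket R),
      ~ hopfian (fundamental_group R x0))
  /\ (forall x0 : set_type (menger_sponge R),
      ~ hopfian (fundamental_group R x0)).
Proof.
split; first by move=> Sigma A x0; exact: punctured_surface_not_hopfian.
split; first exact: carpet_not_hopfian.
by split; [exact: gasket_not_hopfian|exact: sponge_not_hopfian].
Qed.
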